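(* Let $y=X\beta+\varepsilon$ with $X=(x_1,\dots,x_p)\in\mathbb{R}^{n\times p}$ deterministic, $\|x_j\|^2=n$ for all $j\le p$, $\beta\in\mathbb{R}^p$ and $\varepsilon\sim N(0,\sigma^2 I_n)$. Let $A^o=\{j:\beta_j\neq0\}$, $d^o=|A^o|$, $\beta_*=\min_{j\in A^o}|\beta_j|$, and let $\widehat\beta^o=\arg\min_b\{\|y-Xb\|^2: b_j=0\ \forall j\notin A^o\}$ be the oracle least squares estimator (LSE). Suppose that for a positive integer $d^*$ and constants $0<c_*\le c^*<\infty$ $$c_*\le \min_{|A|\le d^*}c_{\min}(\Sigma_A)\le\max_{|A|\le d^*}c_{\max}(\Sigma_A)\le c^*,$$ and that $d^o\le d_*=d^*/(c^*/c_*+1/2)$. Let $\lambda_{1,\epsilon}=\sigma\sqrt{(2/n)\log((p-d^o)/\epsilon)}$ and $\lambda_{2,\epsilon}\ge\max\{2\sqrt{c^*}\,\sigma\sqrt{(2/n)\log\widetilde p_\epsilon},\ \lambda_{1,\epsilon}\}$, where $\epsilon\in(0,1]$ is fixed and $\widetilde p_\epsilon$ is defined with $m=d^*-d^o$. Let $w^o$ be the largest diagonal element of $\Sigma_{A^o}^{-1}$. Let $\widehat\beta=\widehat\beta(\widehat\lambda)$ with a deterministic or random $\widehat\lambda$, where $\widehat\beta(\lambda)$ is the MC+ selector with regularization parameter $\gamma\ge c_*^{-1}\sqrt{4+c_*/c^*}$, and let $\widehat A=\{j:\widehat\beta_j\ne0\}$. Then $$P\{\widehat\beta\neq\widehat\beta^o\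 \text{or}\ \mathrm{sgn}(\widehat\beta)\neq\mathrm{sgn}(\beta)\}\ \le\ P\{\widehat\lambda\notin[\lambda_{1,\epsilon},\lambda_{2,\epsilon}]\}+(3/2+1/\sqrt2)\,\epsilon ,$$ provided that $$\beta_*\ \ge\ \sigma\sqrt{w^o(2/n)\log(d^o/\epsilon)}+\gamma\lambda_{2,\epsilon}.$$ Moreover, $P\{\widehat A=A^o\}\to1$ and the MC+ estimator $\widehat\beta$ achieves the estimation efficiency of the oracle LSE $\widehat\beta^o$, provided that $P\{\lambda_{1,\epsilon}\le\widehat\lambda\le\lambda_{2,\epsilon}\}\to1$ and $$\epsilon^{-1}\vee\min\big\{p-d^o,\ \widetilde p_1,\ \sqrt{n/w^o}\,(\beta_*-\gamma\lambda_{2,\epsilon})/\sigma\big\}\to\infty.$$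
   Context: Notation: $\|\cdot\|$ is the Euclidean norm; $\mathrm{sgn}(t)=I\{t>0\}-I\{t<0\}$, applied componentwise to vectors; $a\vee b=\max(a,b)$. For $A\subseteq\{1,\dots,p\}$, $X_A=(x_j,j\in A)$ and $\Sigma_A=X_A'X_A/n$; $c_{\min}(M)$ and $c_{\max}(M)$ are the smallest and largest eigenvalues of a nonnegative definite $M$. In the asymptotic (''Moreover'') part, limits are along a sequence of such problems, in which $p,d^*,c_*,c^*,d^o,\beta,\sigma,\epsilon$ are all allowed to depend on $n$. Definition of $\widetilde p_\epsilon$: for an integer $1\le m\le p-d^o$ and $\epsilon\in(0,1]$, $\widetilde p_\epsilon$ (with $2\log\widetilde p_\epsilon\ge1$) is the solution of $2\log\widetilde p_\epsilon-1-\log(2\log\widetilde p_\epsilon)=(2/m)\{\log\binom{p-d^o}{m}+\log(1/\epsilon)\}$; $\widetilde p_1$ is the value for $\epsilon=1$. MCP (minimax concave penalty) with parameter $\gamma>0$: $\rho(t;\lambda)=\lambda\int_0^t(1-x/(\gamma\lambda))_+\,dx$, $t\ge0$; $\dot\rho(t;\lambda)=\partial\rho(t;\lambda)/\partial t$. Estimating equation for a penalty $\rho$: $\lambda\oplus\widehat\beta\in\mathbb{R}^{1+p}$ is a solution if $x_j'(y-X\widehat\beta)/n=\mathrm{sgn}(\widehat\beta_j)\dot\rho(|\widehat\beta_j|;\lambda)$ whenever $\widehat\beta_j\ne0$, and $|x_j'(y-X\widehat\beta)/n|\le\lambda$ whenever $\widehat\beta_j=0$. Solution path: $x\mapsto\lambda^{(x)}\oplus\widehat\beta^{(x)}$,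 $x\in[0,\infty)$, denotes a continuous path in $\mathbb{R}^{1+p}$ of solutions of the estimating equation with $\widehat\beta^{(0)}=0$ and $\lim_{x\to\infty}\lambda^{(x)}=0$ (for the MCP, such a path exists and is unique up to reparametrization for almost every $(X,y)$). Then $\widehat\beta(\lambda)=\widehat\beta^{(x_\lambda)}$ with $x_\lambda=\inf\{x\ge0:\lambda^{(x)}\le\lambda\}$. The MC+ selector is this $\widehat\beta(\lambda)$ when $\rho$ is the MCP. *)

(* Defs.v *)
From HB Require Import structures.
From mathcomp Require Import all_boot all_order all_algebra.
From mathcomp Require Import all_classical all_reals all_analysis.

Set Implicit Arguments.
Unset Strict Implicit.
Unset Printing Implicit Defensive.

Import Order.TTheory GRing.Theory Num.Theory.
Import numFieldNormedType.Exports.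

Local Open Scope classical_set_scope.
Local Open Scope ring_scope.

Section LinearModel.
Context {R : realType}.

Definition sqnorm n (v : 'cV[R]_n) : R := \sum_i v i 0 ^+ 2.

Definition active_set p (b : 'cV[R]_p) : {set 'I_p} := [set j | b j 0 != 0]%SET.

Definition gram n p (X : 'M[R]_(n, p)) (A : {set 'I_p}) : 'M[R]_#|A| :=
  let XA : 'M[R]_(n, #|A|) := colsub (fun i : 'I_#|A| => enum_val i) X in
  n%:R^-1 *: (XA^T *m XA).

(* Meant for symmetric matrices of positive size, whose set of real
   eigenvalues is finite and nonempty. *)
Definition c_min k (M : 'M[R]_k) : R := inf [set a | eigenvalue M a].
Definition c_max k (M : 'M[R]_k) : R := sup [set a | eigenvalue M a].

(* The empty set, for which the Gram matrix has no eigenvalue, is left out. *)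
Definition sparse_riesz n p (X : 'M[R]_(n, p)) (d : nat) (clo chi : R) : Prop :=
  forall A : {set 'I_p}, (0 < #|A| <= d)%N ->
    clo <= c_min (gram X A) /\ c_max (gram X A) <= chi.

(* Diagonal elements of the inverse of a positive definite matrix are
   positive, so 0 only shows up as the value for the empty set. *)
Definition max_diag_inv_gram n p (X : 'M[R]_(n, p)) (A : {set 'I_p}) : R :=
  \big[Num.max/0]_(i < #|A|) invmx (gram X A) i i.

(* +oo when b = 0 *)
Definition min_abs_coef p (b : 'cV[R]_p) : \bar R :=
  \big[Order.min/+oo%E]_(j in active_set b) (`|b j 0|%:E).

Definition is_restricted_lse n p (X : 'M[R]_(n, p)) (y : 'cV[R]_n)
    (A : {set 'I_p}) (b : 'cV[R]_p) : Prop :=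
  (forall j, j \notin A -> b j 0 = 0) /\
  (forall b' : 'cV[R]_p, (forall j, j \notin A -> b' j 0 = 0) ->
     sqnorm (y - X *m b) <= sqnorm (y - X *m b')).

Definition restricted_lse n p (X : 'M[R]_(n, p)) (y : 'cV[R]_n)
    (A : {set 'I_p}) : 'cV[R]_p :=
  xget 0 [set b | is_restricted_lse X y A b].

(* The solution x, with 2 log x >= 1, of
     2 log x - 1 - log (2 log x) = (2 / m) (log 'C(N, m) + log (1 / e));
   it exists and is unique when 1 <= m <= N and 0 < e <= 1. *)
Definition ptilde (N m : nat) (e : R) : R :=
  xget 1 [set x : R | 1 <= 2 * ln x /\
    2 * ln x - 1 - ln (2 * ln x) =
      2 / m%:R * (ln ('C(N, m)%:R) + ln (1 / e))].

Section Paths.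
(* A penalty is a function of the penalty level lam and of t >= 0. *)
Variables (rho : R -> R -> R) (n p : nat) (X : 'M[R]_(n, p)) (y : 'cV[R]_n).

Definition score (b : 'cV[R]_p) (j : 'I_p) : R :=
  (X^T *m (y - X *m b)) j 0 / n%:R.

Definition estimating_equation (lam : R) (b : 'cV[R]_p) : Prop :=
  forall j : 'I_p,
    (b j 0 != 0 -> score b j = Num.sg (b j 0) * derive1 (rho lam) `|b j 0|) /\
    (b j 0 = 0 -> `|score b j| <= lam).

(* Continuity in R^(1+p) is written coordinatewise. *)
Definition solution_path (lam : R -> R) (b : R -> 'cV[R]_p) : Prop :=
  [/\ {within `[0, +oo[, continuous lam},
      forall j, {within `[0, +oo[, continuous (fun x => b x j 0)},
      forall x, 0 <= x -> estimating_equation (lam x) (b x),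
      b 0 = 0 &
      lam x @[x --> +oo] --> (0 : R)].

Definition path_selector (lam : R -> R) (b : R -> 'cV[R]_p) (l : R) : 'cV[R]_p :=
  b (inf [set x | 0 <= x /\ lam x <= l]).

End Paths.

Definition mcp (gamma lam t : R) : R :=
  lam * \int[lebesgue_measure]_(x in `[0, t]) Num.max 0 (1 - x / (gamma * lam)).

(* Product rule over the full family; taking some B i = setT gives it for
   every subfamily. *)
Definition mutually_independent d (T : measurableType d) (P : probability T R)
    n (Z : 'I_n -> {RV P >-> R}) : Prop :=
  forall B : 'I_n -> set R, (forall i, measurable (B i)) ->
    P [set w | forall i, B i (Z i w)] = (\prod_(i < n) P (Z i @^-1` B i))%E.

(* The second parameter of normal_prob is the standard deviation. *)
Definition gaussian_noise d (T : measurableType d) (P : probability T R)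
    n (sigma : R) (Z : 'I_n -> {RV P >-> R}) : Prop :=
  mutually_independent Z /\
  forall i (B : set R), measurable B ->
    distribution P (Z i) B = normal_prob 0 sigma B.

End LinearModel.

(* One regression problem together with its tuning constants, a random
   penalty level and the resulting estimator. *)
Record problem (R : realType) := Problem {
  pb_n : nat;
  pb_p : nat;
  pb_X : 'M[R]_(pb_n, pb_p);
  pb_beta : 'cV[R]_pb_p;
  pb_sigma : R;
  pb_disp : measure_display;
  pb_Omega : measurableType pb_disp;
  pb_Pr : probability pb_Omega R;
  pb_noise : 'I_pb_n -> {RV pb_Pr >-> R};
  pb_dstar : nat;
  pb_clo : R;
  pb_chi : R;
  pb_eps : R;
  pb_lam2 : R;
  pb_gamma : R;
  pb_lamhat : {RV pb_Pr >-> R};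
  pb_bhat : 'I_pb_p -> {RV pb_Pr >-> R}
}.

Section Problem.
Context {R : realType}.
Variable D : problem R.

Local Notation n := (pb_n D).
Local Notation p := (pb_p D).
Local Notation X := (pb_X D).
Local Notation beta := (pb_beta D).
Local Notation sigma := (pb_sigma D).
Local Notation dstar := (pb_dstar D).
Local Notation clo := (pb_clo D).
Local Notation chi := (pb_chi D).
Local Notation eps := (pb_eps D).
Local Notation lam2 := (pb_lam2 D).
Local Notation gamma := (pb_gamma D).

Definition response (w : pb_Omega D) : 'cV[R]_n :=
  X *m beta + \col_i pb_noise i w.

Definition true_support : {set 'I_p} := active_set beta.
Definition true_size : nat := #|true_support|.

Definition estimator (w : pb_Omega D) : 'cV[R]_p := \col_j pb_bhat j w.

Definition oracle (w : pb_Omega D) : 'cV[R]_p :=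
  restricted_lse X (response w) true_support.

Definition ptilde_at (e : R) : R :=
  ptilde (p - true_size)%N (dstar - true_size)%N e.

Definition lam1 : R :=
  sigma * Num.sqrt (2 / n%:R * ln ((p - true_size)%N%:R / eps)).

Definition w_oracle : R := max_diag_inv_gram X true_support.

Definition is_mcp_selector : Prop :=
  {ae pb_Pr D, forall w, exists (lam : R -> R) (b : R -> 'cV[R]_p),
     solution_path (mcp gamma) X (response w) lam b /\
     estimator w = path_selector lam b (pb_lamhat D w)}.

(* dstar <= p makes m = dstar - true_size admissible in ptilde. *)
Definition assumptions : Prop :=
  [/\ 0 < sigma, gaussian_noise sigma (@pb_noise R D)
    & forall j, sqnorm (col j X) = n%:R] /\
  [/\ (0 < dstar <= p)%N, 0 < clo <= chi, sparse_riesz X dstar clo chi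
    & true_size%:R <= dstar%:R / (chi / clo + 1 / 2)] /\
  [/\ 0 < eps <= 1,
      Num.max (2 * Num.sqrt chi * sigma *
                 Num.sqrt (2 / n%:R * ln (ptilde_at eps)))
              lam1 <= lam2,
      clo^-1 * Num.sqrt (4 + clo / chi) <= gamma
    & is_mcp_selector].

Definition beta_min_condition : Prop :=
  ((sigma * Num.sqrt (w_oracle * (2 / n%:R) * ln (true_size%:R / eps))
     + gamma * lam2)%:E <= min_abs_coef beta)%E.

(* sqrt (n / w_oracle) (beta_* - gamma lam2) / sigma, and +oo when
   beta = 0, in line with min_abs_coef 0 = +oo *)
Definition signal_strength : \bar R :=
  if true_support == finset.set0 then +oo%E
  else ((Num.sqrt (n%:R / w_oracle) / sigma)%:E *
        (min_abs_coef beta - (gamma * lam2)%:E))%E.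

Definition lamhat_in_range : set (pb_Omega D) :=
  [set w | lam1 <= pb_lamhat D w <= lam2].

End Problem.

Arguments lamhat_in_range {R} D _.

(* The estimators coincide with the oracles with probability tending to one,
   and the total variation distance between their laws tends to 0; the sets
   B k are arbitrary, so any normalization of the errors is covered. *)
Definition oracle_efficient (R : realType) (D : nat -> problem R) : Prop :=
  (pb_Pr (D k) [set w | estimator w = oracle w] @[k --> \oo] --> 1%E) /\
  (forall B : forall k, set 'cV[R]_(pb_p (D k)),
     (forall k, measurable [set w : pb_Omega (D k) | B k (estimator w)]) ->
     (forall k, measurable [set w : pb_Omega (D k) | B k (oracle w)]) ->
     (pb_Pr (D k) [set w | B k (estimator w)] -
      pb_Pr (D k) [set w | B k (oracle w)])%E @[k --> \oo] --> 0%E).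

(* Main.v *)
Require Import Defs.
From HB Require Import structures.
From mathcomp Require Import all_boot all_order all_algebra.
From mathcomp Require Import all_classical all_reals all_analysis.
From mathcomp Require Import measurable_realfun.
From mathcomp Require Import ring lra.

Set Implicit Arguments.
Unset Strict Implicit.
Unset Printing Implicit Defensive.

Import Order.TTheory GRing.Theory Num.Theory.
Import numFieldNormedType.Exports.

Local Open Scope classical_set_scope.
Local Open Scope ring_scope.

(* Let B be the true support, m = d^* - d^o and K = c^*/c_*.

   Sparsity. A solution of the estimating equation satisfies |g_j| <= lambda for the scores
   g_j, b_j g_j >= 0, and |g_j| + |b_j| / gamma >= lambda when b_j <> 0. Suppose that this last
   inequality holds on a set C of exactly m variables off B and that b vanishes outside of
   the union A of B and C. Writing X(b - b^o) as the gap W between the least squares fits on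
   A and on B, minus the fits of the scores, the sparse Riesz condition turns these relations
   into quadratic inequalities which contradict each other as soon as
   |W|^2 / n <= m lambda^2 / (4 c^* ).

   Path. Hence along the part of the path where lambda >= lambda_1, the number of nonzero
   coefficients off B stays below m: the set of x where it is at most m contains 0, is closed,
   and is open because there the activity inequality in fact holds at fewer than m indices.
   Solutions that sparse are unique for lambda in [lambda_1, lambda_2], by strong convexity
   (1 / gamma < c_* ), so they are equal to the oracle, which is a solution there when its
   coefficients on B exceed gamma lambda_2 and its scores off B are below lambda_1.

   Probability. These two conditions are linear in the noise and normal tails apply.
   For a given C, |W|^2 = <W, e> with W in a fixed space of dimension m; rotating the
   noise so that this space depends on m coordinates only bounds |W|^2 by sigma^2 times a
   chi-square variable with m degrees of freedom, and p~_eps is defined so that the union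
   bound over C costs eps. *)

(** Two features of the probability bound shape the proof. With [v] a lower bound for the
    standardized levels, the two-sided noise condition and the one-sided signal condition together
    cost 3 eps / (2 v), and the gap condition costs eps. Either c eps >= 1 for c = 3/2 + 1/sqrt 2,
    and there is nothing to prove, or eps^-1 > c, which makes these levels large enough for 3 / (2
    v) + 1 <= c. In the limit eps may stay equal to 1, and the Chernoff bound, which costs exactly
    eps, is too weak: the chi-square tail needs a further factor of order 1 / sqrt t. It comes from
    treating one of the squares by the Gaussian tail and only the others by their exponential
    moment.

    Independence of the noise is given on rectangles only. No multivariate normal law is formed:
    rotations act on two coordinates at a time, and a chi-square sum grows by one square at a time,
    always by Fubini in the plane.

    On the path, the gap bound is available from lambda_2 upwards only. Between lambda_1 and
    lambda_2 the number of nonzero coefficients is controlled by uniqueness instead. *)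

Section rayleigh.
Context {R : realType}.

Definition dotv n (u v : 'cV[R]_n) : R := \sum_i u i 0 * v i 0.

Lemma dotvC n (u v : 'cV[R]_n) : dotv u v = dotv v u.
Proof. by apply: eq_bigr => i _; rewrite mulrC. Qed.

Lemma dotvE n (u v : 'cV[R]_n) : dotv u v = (u^T *m v) 0 0.
Proof. by rewrite mxE; apply: eq_bigr => i _; rewrite mxE. Qed.

Lemma dotvDl n (u v w : 'cV[R]_n) : dotv (u + v) w = dotv u w + dotv v w.
Proof. by rewrite -big_split; apply: eq_bigr => i _; rewrite mxE mulrDl. Qed.

Lemma dotvDr n (u v w : 'cV[R]_n) : dotv w (u + v) = dotv w u + dotv w v.
Proof. by rewrite dotvC dotvDl !(dotvC w). Qed.

Lemma dotvZl n a (u v : 'cV[R]_n) : dotv (a *: u) v = a * dotv u v.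
Proof. by rewrite mulr_sumr; apply: eq_bigr => i _; rewrite mxE mulrA. Qed.

Lemma dotvZr n a (u v : 'cV[R]_n) : dotv u (a *: v) = a * dotv u v.
Proof. by rewrite dotvC dotvZl dotvC. Qed.

Lemma dotvNl n (u v : 'cV[R]_n) : dotv (- u) v = - dotv u v.
Proof. by rewrite -scaleN1r dotvZl mulN1r. Qed.

Lemma dotvNr n (u v : 'cV[R]_n) : dotv u (- v) = - dotv u v.
Proof. by rewrite dotvC dotvNl dotvC. Qed.

Lemma dotvBl n (u v w : 'cV[R]_n) : dotv (u - v) w = dotv u w - dotv v w.
Proof. by rewrite dotvDl dotvNl. Qed.

Lemma dotvBr n (u v w : 'cV[R]_n) : dotv w (u - v) = dotv w u - dotv w v.
Proof. by rewrite dotvDr dotvNr. Qed.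

Lemma dotv0l n (v : 'cV[R]_n) : dotv 0 v = 0.
Proof. by rewrite -(scale0r 0) dotvZl mul0r. Qed.

Lemma dotvv_ge0 n (u : 'cV[R]_n) : 0 <= dotv u u.
Proof. by apply: sumr_ge0 => i _; rewrite -expr2 sqr_ge0. Qed.

Lemma dotvv_eq0 n (u : 'cV[R]_n) : (dotv u u == 0) = (u == 0).
Proof.
apply/eqP/eqP => [/eqP|->]; last by rewrite dotv0l.
rewrite psumr_eq0 => [/allP h|i _]; last by rewrite -expr2 sqr_ge0.
apply/colP => i; rewrite mxE; have := h i (mem_index_enum _).
by rewrite mulf_eq0 orbb => /eqP.
Qed.

Lemma dotvv_gt0 n (u : 'cV[R]_n) : (0 < dotv u u) = (u != 0).
Proof. by rewrite lt_def dotvv_ge0 andbT dotvv_eq0. Qed.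

Lemma sqnormE n (u : 'cV[R]_n) : sqnorm u = dotv u u.
Proof. by apply: eq_bigr => i _; rewrite expr2. Qed.

Lemma dotv_mulmx m n (A : 'M[R]_(m, n)) u v : dotv (A *m u) v = dotv u (A^T *m v).
Proof. by rewrite !dotvE trmx_mul -mulmxA. Qed.

Lemma dotv_CS n (u v : 'cV[R]_n) : dotv u v ^+ 2 <= dotv u u * dotv v v.
Proof.
have [->|v0] := eqVneq v 0; first by rewrite dotvC !dotv0l expr0n mulr0.
have vv : 0 < dotv v v by rewrite dotvv_gt0.
have := dotvv_ge0 (dotv v v *: u - dotv u v *: v).
rewrite dotvBl !dotvBr !dotvZl !dotvZr (dotvC v u) => h.
have : 0 <= dotv v v * (dotv u u * dotv v v - dotv u v ^+ 2).
  by apply: le_trans h _; rewrite le_eqVlt; apply/orP; left; apply/eqP; ring.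
by rewrite pmulr_rge0// subr_ge0.
Qed.

Lemma linear_term_eq0 (b c : R) : (forall t, 0 <= t * b + t ^+ 2 * c) -> b = 0.
Proof.
move=> h; have [c0|c0] := leP c 0.
  by have := h 1; have := h (-1); nra.
have := h (- b / (2 * c)).
have -> : - b / (2 * c) * b + (- b / (2 * c)) ^+ 2 * c = - (b ^+ 2 / (4 * c)).
  by field; rewrite gt_eqF.
rewrite oppr_ge0 pmulr_lle0 ?invr_gt0 ?mulr_gt0// => b2.
by apply/eqP; rewrite -sqrf_eq0 eq_le b2 sqr_ge0.
Qed.

Lemma cvg_bigsum (T I : Type) (F : set_system T) {FF : Filter F} (r : seq I)
    (f : I -> T -> R) (a : I -> R) : (forall i, f i x @[x --> F] --> a i) ->
  \sum_(i <- r) f i x @[x --> F] --> \sum_(i <- r) a i.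
Proof.
move=> fa; elim: r => [|i r IH].
  by rewrite big_nil; under eq_fun do rewrite big_nil; exact: cvg_cst.
by rewrite big_cons; under eq_fun do rewrite big_cons; exact: cvgD.
Qed.

(** The quadratic form attains its minimum on the compact unit sphere, and a minimizer is an
    eigenvector because the first variation vanishes there. *)
Lemma exists_min_eigenvalue n (M : 'M[R]_n) : (0 < n)%N -> M^T = M ->
  exists2 a, eigenvalue M a & forall u, a * dotv u u <= dotv u (M *m u).
Proof.
move=> n0 MT.
pose q (v : 'rV[R]_n) := dotv v^T (M *m v^T).
pose S := [set v : 'rV[R]_n | dotv v^T v^T = 1].
have cdot (f g : 'rV[R]_n -> 'cV[R]_n) :
    (forall i, continuous (fun v => f v i 0)) -> (forall i, continuous (fun v => g v i 0)) ->
    continuous (fun v => dotv (f v) (g v)).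
  move=> cf cg; rewrite /dotv.
  by move=> x; apply: (@cvg_bigsum _ _ (nbhs x)) => i; apply: cvgM; [exact: cf|exact: cg].
have cid i : continuous (fun v : 'rV[R]_n => v^T i 0).
  rewrite (_ : (fun v : 'rV_n => v^T i 0) = (fun v => v 0 i)).
    exact: coord_continuous.
  by apply/funext => v; rewrite mxE.
have cM i : continuous (fun v : 'rV[R]_n => (M *m v^T) i 0).
  rewrite (_ : (fun v : 'rV_n => (M *m v^T) i 0) = (fun v => \sum_j M i j * v^T j 0)).
    move=> x; apply: (@cvg_bigsum _ _ (nbhs x)) => j; apply: cvgM; [exact: cvg_cst|exact: cid].
  by apply/funext => v; rewrite mxE.
have cS : compact S.
  apply: bounded_closed_compact.
    exists 1; split=> // y y1 v Sv; apply: le_trans (ltW y1).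
    rewrite [leLHS]/Num.norm /= mx_normrE; apply/bigmax_leP; split=> // -[i j] _ /=.
    rewrite (ord1 i) -ler_sqr ?nnegrE// expr1n real_normK ?num_real//.
    move: Sv; rewrite /S/= => <-; rewrite /dotv (bigD1 j)//= !mxE -expr2 lerDl.
    by apply: sumr_ge0 => k _; rewrite -expr2 sqr_ge0.
  have := (continuous_closedP _).1 (cdot _ _ cid cid) _ (@closed_eq R 1).
  by [].
have [S0|S0] := pselect (S !=set0); last first.
  exfalso; apply: S0; exists (delta_mx 0 (Ordinal n0)).
  rewrite /S/= /dotv (bigD1 (Ordinal n0))//= !mxE !eqxx mulr1.
  by rewrite big1 ?addr0// => i /negbTE i0; rewrite !mxE i0 mulr0.
have [v Sv vmin] := EVT_min_rV S0 cS (continuous_subspaceT (cdot _ _ cid cM)).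
set a := dotv _ _ in vmin.
have {}Sv : dotv v^T v^T = 1 by move: Sv; rewrite inE.
have amin u : a * dotv u u <= dotv u (M *m u).
  have [->|u0] := eqVneq u 0; first by rewrite !dotv0l mulr0.
  have uu : 0 < dotv u u by rewrite dotvv_gt0.
  pose r := Num.sqrt (dotv u u).
  have r0 : 0 < r by rewrite sqrtr_gt0.
  have r2 : dotv u u = r ^+ 2 by rewrite sqr_sqrtr// ltW.
  have := vmin ((r^-1 *: u)^T); rewrite trmxK inE /S/= trmxK.
  rewrite -scalemxAr !dotvZl !dotvZr.
  have -> : r^-1 * (r^-1 * dotv u u) = 1.
    by rewrite r2; field; rewrite gt_eqF.
  move=> /(_ erefl); rewrite r2 -ler_pdivlMr ?exprn_gt0// => /le_trans; apply.
  by rewrite le_eqVlt; apply/orP; left; apply/eqP; field; rewrite gt_eqF.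
(* The direction of variation is the residual u = M v - a v itself: the linear coefficient is then 2
   |u|^2, which [linear_term_eq0] forces to vanish. *)
have Ma : M *m v^T = a *: v^T.
  apply/eqP; rewrite -subr_eq0 -dotvv_eq0; apply/eqP; set u := M *m v^T - _.
  have uuE : dotv u u = dotv u (M *m v^T) - a * dotv u v^T.
    by rewrite {2}/u dotvBr dotvZr.
  clearbody u; have := @linear_term_eq0 (2 * dotv u u) (dotv u (M *m u) - a * dotv u u).
  move=> h; suff : 2 * dotv u u = 0 by lra.
  apply: h => t; have := amin (v^T + t *: u).
  rewrite mulmxDr -scalemxAr !dotvDl !dotvDr !dotvZl !dotvZr Sv -/a.
  have -> : dotv v^T (M *m u) = dotv u (M *m v^T).
    by rewrite dotvC dotv_mulmx MT.
  rewrite (dotvC v^T u) [in X in _ -> X]uuE => {}h; rewrite uuE in h; move: h.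
  move: (dotv u (M *m u)) (dotv u (M *m v^T)) (dotv u v^T) => x y z.
  by clearbody a; nra.
exists a => //; apply/eigenvalueP; exists v.
  by rewrite -[v *m M]trmxK trmx_mul MT Ma linearZ/= trmxK.
apply: contraTneq (oner_neq0 R) => v0.
by rewrite -Sv v0 trmx0 dotv0l eqxx.
Qed.

(** The minimal Rayleigh value [a] is itself an eigenvalue, and it bounds all eigenvalues from
    below, which [ge_inf] requires. *)
Lemma c_min_le n (M : 'M[R]_n) u : (0 < n)%N -> M^T = M ->
  c_min M * dotv u u <= dotv u (M *m u).
Proof.
move=> n0 MT; have [a Ma amin] := exists_min_eigenvalue n0 MT.
apply: le_trans (amin u); apply: ler_wpM2r; first exact: dotvv_ge0.
apply: ge_inf => //; exists a => b /eigenvalueP[v vM v0].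
have vv : 0 < dotv v^T v^T.
  by rewrite dotvv_gt0; apply: contraNneq v0 => vT0; rewrite -(trmxK v) vT0 trmx0.
have := amin v^T.
have -> : M *m v^T = b *: v^T.
  by rewrite -[M in M *m _]MT -trmx_mul vM linearZ.
by rewrite dotvZr ler_pM2r.
Qed.

Lemma eigenvalueN n (M : 'M[R]_n) a : eigenvalue (- M) a = eigenvalue M (- a).
Proof.
apply/eigenvalueP/eigenvalueP => -[v vM v0]; exists v => //.
  by rewrite scaleNr -vM mulmxN opprK.
by rewrite mulmxN vM scaleNr opprK.
Qed.

Lemma c_max_ge n (M : 'M[R]_n) u : (0 < n)%N -> M^T = M ->
  dotv u (M *m u) <= c_max M * dotv u u.
Proof.
move=> n0 MT.
have MNT : (- M)^T = - M by rewrite linearN/= MT.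
have := c_min_le u n0 MNT; rewrite mulNmx dotvNr.
suff -> : c_min (- M) = - c_max M by rewrite mulNr lerN2.
rewrite /c_min /c_max /inf; congr (- sup _).
apply/seteqP; split => x /=.
  by move=> [y]; rewrite /= eigenvalueN => My <-.
by move=> Mx; exists (- x); rewrite /= ?opprK// eigenvalueN opprK.
Qed.

End rayleigh.

(** * Sparse vectors, the Riesz condition and restricted least squares *)

Section sparse_vectors.
Context {R : realType}.
Variables (n p : nat) (X : 'M[R]_(n, p)).

Definition supported (A : {set 'I_p}) (h : 'cV[R]_p) : Prop :=
  forall j, j \notin A -> h j 0 = 0.

Lemma supportedB (A : {set 'I_p}) h h' :
  supported A h -> supported A h' -> supported A (h - h').
Proof. by move=> hA h'A j jA; rewrite !mxE hA// h'A// subr0. Qed.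

Lemma supportedS (A B : {set 'I_p}) h : A \subset B -> supported A h -> supported B h.
Proof. by move=> /fintype.subsetP AB hA j jB; apply: hA; apply: contra jB => /AB. Qed.

(** Inclusion of R^A into R^p. It allows all later statements to live in R^p with a support
    condition, so that different sets [A] can be compared without changing index types. *)
Definition emb (A : {set 'I_p}) : 'M[R]_(p, #|A|) :=
  \matrix_(j, i) (j == enum_val i)%:R.

Lemma mul_emb A : X *m emb A = colsub (fun i : 'I_#|A| => enum_val i) X.
Proof.
apply/matrixP => i j; rewrite !mxE (bigD1 (enum_val j))//= !mxE eqxx mulr1.
by rewrite big1 ?addr0// => k /negbTE kj; rewrite mxE kj mulr0.
Qed.

Lemma tr_emb_mul A (h : 'cV[R]_p) i : ((emb A)^T *m h) i 0 = h (enum_val i) 0.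
Proof.
rewrite !mxE (bigD1 (enum_val i))//= !mxE eqxx mul1r.
by rewrite big1 ?addr0// => k /negbTE kj; rewrite !mxE kj mul0r.
Qed.

Lemma supported_emb A v : supported A (emb A *m v).
Proof.
move=> j jA; rewrite mxE big1// => i _; rewrite mxE.
have [ji|] := eqVneq j (enum_val i); last by rewrite mul0r.
by move: jA; rewrite ji enum_valP.
Qed.

Lemma emb_mul_val (A : {set 'I_p}) (v : 'cV[R]_#|A|) (i : 'I_#|A|) :
  (emb A *m v) (enum_val i) 0 = v i 0.
Proof.
rewrite mxE (bigD1 i)//= mxE eqxx mul1r big1 ?addr0// => k ki.
by rewrite mxE (inj_eq enum_val_inj) eq_sym (negbTE ki) mul0r.
Qed.

Lemma emb_tr_emb A (h : 'cV[R]_p) : supported A h -> emb A *m ((emb A)^T *m h) = h.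
Proof.
move=> hA; apply/colP => j; have [jA|jA] := boolP (j \in A); last first.
  by rewrite (supported_emb _ jA) hA.
by rewrite -[j](enum_rankK_in jA jA) emb_mul_val tr_emb_mul.
Qed.

Lemma gramE A : gram X A = n%:R^-1 *: ((X *m emb A)^T *m (X *m emb A)).
Proof. by rewrite /gram mul_emb. Qed.

Lemma gram_sym A : (gram X A)^T = gram X A.
Proof. by rewrite gramE linearZ/= trmx_mul trmxK. Qed.

Lemma dotv_gram A u v :
  dotv u (gram X A *m v) = n%:R^-1 * dotv (X *m (emb A *m u)) (X *m (emb A *m v)).
Proof. by rewrite gramE -scalemxAl dotvZr (mulmxA X) dotv_mulmx !mulmxA. Qed.

Lemma dotv_emb A u v : dotv (emb A *m u) (emb A *m v) = dotv u v.
Proof.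
rewrite dotv_mulmx; congr dotv; apply/colP => i.
by rewrite tr_emb_mul emb_mul_val.
Qed.

Variables (d : nat) (clo chi : R).
Hypotheses (clo0 : 0 < clo) (SRC : sparse_riesz X d clo chi).

(** Form in which the Riesz condition is used from here on. For empty [A], which [sparse_riesz]
    leaves out, h = 0. *)
Lemma sparse_riesz_bounds (A : {set 'I_p}) (h : 'cV[R]_p) : (#|A| <= d)%N -> supported A h ->
  clo * dotv h h <= n%:R^-1 * dotv (X *m h) (X *m h) <= chi * dotv h h.
Proof.
move=> Ad hA; have [A0|A0] := posnP #|A|.
  have -> : h = 0.
    by apply/colP => j; rewrite mxE hA// (cards0_eq A0) inE.
  by rewrite mulmx0 !dotv0l !mulr0 lexx.
have [lo hi] : clo <= c_min (gram X A) /\ c_max (gram X A) <= chi.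
  by apply: SRC; rewrite A0.
have := c_min_le ((emb A)^T *m h) A0 (gram_sym A).
have := c_max_ge ((emb A)^T *m h) A0 (gram_sym A).
rewrite dotv_gram -(dotv_emb _ ((emb A)^T *m h)) !emb_tr_emb// => h1 h2.
have := dotvv_ge0 h => h0; apply/andP; split.
  by apply: le_trans h2; rewrite ler_wpM2r.
by apply: (le_trans h1); rewrite ler_wpM2r.
Qed.

(** For n = 0 the factor [n%:R^-1] is 0, and the lower Riesz bound fails at a coordinate vector. *)
Lemma sample_size_gt0 : (0 < d <= p)%N -> (0 < n)%N.
Proof.
move=> /andP[d0 dp]; rewrite lt0n; apply/negP => /eqP n0.
have j : 'I_p by exists 0%N; exact: leq_trans dp.
have hj : supported [set j]%SET (delta_mx j 0).
  by move=> k; rewrite inE mxE => /negbTE ->.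
have := @sparse_riesz_bounds [set j]%SET (delta_mx j 0).
rewrite cards1 => /(_ d0 hj)/andP[+ _].
have -> : n%:R = 0 :> R by rewrite n0.
rewrite invr0 mul0r leNgt mulr_gt0// dotvv_gt0.
by apply/eqP => /colP/(_ j)/eqP; rewrite !mxE !eqxx oner_eq0.
Qed.

Lemma gram_unit (A : {set 'I_p}) : (#|A| <= d)%N -> gram X A \in unitmx.
Proof.
move=> Ad; rewrite -row_free_unit -kermx_eq0.
apply/negPn/negP => /rowV0Pn[v /sub_kermxP vM /negP v0]; apply: v0.
have Mv : gram X A *m v^T = 0 by rewrite -gram_sym -trmx_mul vM trmx0.
have := @sparse_riesz_bounds A (emb A *m v^T) Ad (@supported_emb _ _).
rewrite -dotv_gram Mv dotvC dotv0l dotv_emb => /andP[+ _].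
rewrite pmulr_rle0// => v0.
have : dotv v^T v^T == 0 by rewrite eq_le v0 dotvv_ge0.
by rewrite dotvv_eq0 => /eqP vT0; rewrite -(trmxK v) vT0 trmx0.
Qed.

(** Solution, supported on [A], of the normal equations with right-hand side [c] on [A]. The
    argument is not fixed to X^T y because scores and coordinate vectors are inserted as well. *)
Definition restricted_solve A (c : 'cV[R]_p) : 'cV[R]_p :=
  emb A *m (invmx (gram X A) *m (n%:R^-1 *: ((emb A)^T *m c))).

Lemma supported_restricted_solve A c : supported A (restricted_solve A c).
Proof. exact: supported_emb. Qed.

Lemma restricted_solveP (A : {set 'I_p}) c j : (0 < n)%N -> (#|A| <= d)%N -> j \in A ->
  (X^T *m (X *m restricted_solve A c)) j 0 = c j 0.
Proof.
move=> n0 Ad jA; rewrite -[j](enum_rankK_in jA jA); set i := enum_rank_in jA j.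
rewrite -!tr_emb_mul.
have nn0 : n%:R != 0 :> R by rewrite pnatr_eq0 -lt0n.
transitivity ((n%:R *: (gram X A *m (invmx (gram X A) *m (n%:R^-1 *: ((emb A)^T *m c))))) i 0).
  congr (_ _ _).
  rewrite /restricted_solve; set v := invmx _ *m _.
  by rewrite gramE -scalemxAl scalerA divff// scale1r trmx_mul !mulmxA.
by rewrite mulKVmx ?gram_unit// scalerA divff// scale1r.
Qed.

Lemma supported_orth_eq0 (A : {set 'I_p}) (h : 'cV[R]_p) :
  (0 < n)%N -> (#|A| <= d)%N -> supported A h ->
  (forall j, j \in A -> (X^T *m (X *m h)) j 0 = 0) -> h = 0.
Proof.
move=> n0 Ad hA hX.
have := sparse_riesz_bounds Ad hA => /andP[+ _].
have -> : dotv (X *m h) (X *m h) = 0.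
  rewrite dotv_mulmx /dotv big1// => j _.
  have [jA|jA] := boolP (j \in A); first by rewrite hX// mulr0.
  by rewrite hA// mul0r.
rewrite mulr0 pmulr_rle0// => h0; apply/eqP; rewrite -dotvv_eq0.
by rewrite eq_le h0 dotvv_ge0.
Qed.

(** By Pythagoras the solution of the normal equations is a minimizer, and another minimizer has the
    same fit, hence by the Riesz bound the same coefficients. So [xget] has a single choice. *)
Lemma restricted_lse_eq y (A : {set 'I_p}) : (0 < n)%N -> (#|A| <= d)%N ->
  restricted_lse X y A = restricted_solve A (X^T *m y).
Proof.
move=> n0 Ad; pose b := restricted_solve A (X^T *m y); rewrite -/b.
have bA : supported A b by exact: supported_restricted_solve.
have ort h : supported A h -> dotv (X *m h) (y - X *m b) = 0.
  move=> hA; rewrite dotv_mulmx /dotv big1// => j _.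
  have [jA|jA] := boolP (j \in A); last by rewrite hA// mul0r.
  rewrite mulmxBr.
  have -> (u v : 'cV[R]_p) : (u - v) j 0 = u j 0 - v j 0 by rewrite !mxE.
  by rewrite restricted_solveP// subrr mulr0.
clearbody b.
have pyth b' : supported A b' -> sqnorm (y - X *m b') =
    sqnorm (y - X *m b) + dotv (X *m (b - b')) (X *m (b - b')).
  move=> b'A; have hA : supported A (b - b').
    exact: supportedB.
  have -> : y - X *m b' = (y - X *m b) + X *m (b - b').
    by rewrite mulmxBr addrA subrK.
  have := ort _ hA; move: (y - X *m b) (X *m (b - b')) => e f fe.
  by rewrite !sqnormE !dotvDl !dotvDr (dotvC e f) fe addr0 add0r.
have blse : is_restricted_lse X y A b.
  split=> // b' b'A; rewrite [leRHS]pyth// lerDl; exact: dotvv_ge0.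
rewrite /restricted_lse; case: xgetP => [b' _ [b'A b'min]|/(_ b)//].
have := b'min b bA; rewrite pyth// gerDl => h0.
have e0 : X *m (b - b') = 0.
  by apply/eqP; rewrite -dotvv_eq0 eq_le h0 dotvv_ge0.
apply/eqP; rewrite eq_sym -subr_eq0; apply/eqP; apply: (supported_orth_eq0 n0 Ad).
  exact: supportedB.
by move=> j jA; rewrite e0 mulmx0 mxE.
Qed.

End sparse_vectors.

(** * Rotation of Gaussian families *)

Section affine.
Context {R : realType}.
Notation mu := (@lebesgue_measure R).

Lemma measurable_affine (a b : R) :
  measurable_fun [set: R] (fun x : R => a * x + b : measurableTypeR R).
Proof. by apply: measurable_funD => //; exact: measurable_funM. Qed.

(** Multiplied by |a|, the image measure gives half-open intervals their length, which characterizes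
    Lebesgue measure. For a < 0 the preimage is half-open on the other side, with the same
    length. *)
Lemma lebesgue_measure_affine (a b : R) (A : set R) : a != 0 -> measurable A ->
  pushforward mu (fun x : R => a * x + b : measurableTypeR R) A
    = (`|a|^-1%:E * mu A)%E.
Proof.
move=> a0 mA.
have na0 : 0 < `|a| by rewrite normr_gt0.
pose phi := fun x : R => a * x + b : measurableTypeR R.
have mphi : measurable_fun [set: R] phi by exact: measurable_affine.
pose m' : {measure set _ -> \bar R} := mscale (NngNum (ltW na0)) (pushforward mu phi).
suff -> : mu A = m' mphi A.
  by rewrite /m' /mscale/= muleA -EFinM mulVf ?mul1e// gt_eqF.
apply: lebesgue_measure_unique => // _ [[u v]] _ <-/=.
rewrite /m' /mscale /=.
rewrite (_ : pushforward _ _ _ = mu [set x : R | u < a * x + b <= v]); last first.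
  by congr (mu _); apply/seteqP; split=> x; rewrite /= in_itv.
case: (ltgtP a 0) a0 => // a0 _.
- have -> : [set x : R | u < a * x + b <= v] = `[(v - b) / a, (u - b) / a[%classic.
    apply/seteqP; split=> x; rewrite /= in_itv/=.
      move=> /andP[h1 h2]; rewrite ler_ndivrMr // ltr_ndivlMr //.
      by apply/andP; split; lra.
    rewrite ler_ndivrMr // ltr_ndivlMr // => /andP[h1 h2].
    by apply/andP; split; lra.
  rewrite !lebesgue_measure_itv/= !lte_fin.
  rewrite ltr_ndivrMr // divfK ?lt_eqF// ltrD2r.
  case: ifPn => uv; last by rewrite mule0.
  rewrite -!EFinD -!EFinM; congr (_%:E); rewrite ltr0_norm//.
  by field; rewrite lt_eqF.
- have -> : [set x : R | u < a * x + b <= v] = `](u - b) / a, (v - b) / a]%classic.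
    apply/seteqP; split=> x; rewrite /= in_itv/=.
      move=> /andP[h1 h2]; rewrite ler_pdivlMr // ltr_pdivrMr //.
      by apply/andP; split; lra.
    rewrite ler_pdivlMr // ltr_pdivrMr // => /andP[h1 h2].
    by apply/andP; split; lra.
  rewrite !lebesgue_measure_itv/= !lte_fin.
  rewrite ltr_pdivrMr // divfK ?gt_eqF// ltrD2r.
  case: ifPn => uv; last by rewrite mule0.
  rewrite -!EFinD -!EFinM; congr (_%:E); rewrite gtr0_norm//.
  by field; rewrite gt_eqF.
Qed.

Lemma ge0_integral_affine (a b : R) (f : R -> \bar R) : a != 0 ->
  measurable_fun setT f -> (forall x, 0 <= f x)%E ->
  (\int[mu]_x f (a * x + b)%R = `|a|^-1%:E * \int[mu]_x f x)%E.
Proof.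
move=> a0 mf f0.
have na0 : 0 <= `|a|^-1 by rewrite invr_ge0.
pose phi := fun x : R => a * x + b : measurableTypeR R.
have mphi : measurable_fun [set: R] phi by exact: measurable_affine.
transitivity (\int[pushforward mu phi]_x f x)%E.
  by rewrite ge0_integral_pushforward// => x _; exact: f0.
rewrite -(ge0_integral_mscale mu measurableT (NngNum na0))//.
apply: eq_measure_integral => //= A mA _.
exact: lebesgue_measure_affine.
Qed.

End affine.

Section density.
Local Open Scope ereal_scope.
Context d (T : measurableType d) (R : realType).
Variables (mu nu : {measure set T -> \bar R}) (g : T -> R).
Hypotheses (mg : measurable_fun setT g) (g0 : forall x, (0 <= g x)%R)
  (nuE : forall A, measurable A -> nu A = \int[mu]_(x in A) (g x)%:E).

Import HBNNSimple.

Let ge0_integral_density_nnsfun (f : {nnsfun T >-> R}) :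
  \int[nu]_x (f x)%:E = \int[mu]_x ((f x)%:E * (g x)%:E).
Proof.
under [LHS]eq_integral do rewrite fimfunE -fsumEFin//.
rewrite [LHS]ge0_integral_fsum//; last 2 first.
  - by move=> r; exact/measurable_EFinP/measurableT_comp.
  - by move=> n x _; rewrite EFinM nnfun_muleindic_ge0.
under [RHS]eq_integral.
  move=> x xD; rewrite fimfunE -fsumEFin// ge0_mule_fsuml; last first.
    by move=> r; rewrite EFinM nnfun_muleindic_ge0.
  over.
rewrite [RHS]ge0_integral_fsum//; last 2 first.
  - move=> r; apply: emeasurable_funM; last exact/measurable_EFinP.
    by apply/measurable_EFinP; do 2 apply/measurableT_comp => //.
  - move=> n x _; rewrite mule_ge0//; last by rewrite lee_fin.
    by rewrite EFinM nnfun_muleindic_ge0.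
apply: eq_fsbigr => r _.
rewrite integralZl_indic_nnsfun//= integral_indic//= setIT nuE//; last first.
have [r0|r0] := ltP r 0%R.
  rewrite preimage_nnfun0// integral_set0 mule0 integral0_eq// => x _.
  by rewrite indicE in_set0 mulr0 mul0e.
rewrite -ge0_integralZl//=; last 2 first.
- exact/measurable_EFinP/measurable_funTS.
- by move=> x _; rewrite lee_fin.
rewrite integral_mkcond; apply: eq_integral => x _.
rewrite patchE; case: ifPn => [xr|/negbTE xr]; rewrite indicE xr ?mulr1//.
by rewrite mulr0 mul0e.
Qed.

(** Simple functions first, then monotone convergence along [nnsfun_approx]. *)
Lemma ge0_integral_density (f : T -> \bar R) :
  measurable_fun setT f -> (forall x, 0 <= f x) ->
  \int[nu]_x f x = \int[mu]_x (f x * (g x)%:E).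
Proof.
move=> mf f0.
pose f_ := nnsfun_approx measurableT mf.
transitivity (lim (\int[nu]_x (f_ n x)%:E @[n --> \oo])).
  rewrite -monotone_convergence//=.
  - apply: eq_integral => ? /[!inE] xD; apply/esym/cvg_lim => //=.
    exact: cvg_nnsfun_approx.
  - by move=> n; exact/measurable_EFinP/measurable_funTS.
  - by move=> n ? _; rewrite lee_fin.
  - by move=> ? _ ? ? mn; rewrite lee_fin; exact/lefP/nd_nnsfun_approx.
transitivity (lim (\int[mu]_x ((f_ n x)%:E * (g x)%:E) @[n --> \oo])).
  by under eq_fun do rewrite ge0_integral_density_nnsfun.
rewrite -monotone_convergence//=.
- apply: eq_integral => x _; apply/cvg_lim => //.
  by apply: cvgeZr => //; exact: cvg_nnsfun_approx.
- move=> n; apply: emeasurable_funM; last exact/measurable_EFinP.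
  exact/measurable_EFinP/measurable_funTS.
- by move=> n x _; rewrite mule_ge0 ?lee_fin.
- move=> x _ a b ab; rewrite -!EFinM lee_fin ler_wpM2r//.
  exact/lefP/nd_nnsfun_approx.
Qed.

End density.

Section rotation.
Context {R : realType}.
Variables (s : R) (s0 : s != 0).
Notation mu := (@lebesgue_measure R).
Notation N := (normal_prob 0 s).
Notation g := (normal_pdf 0 s).

Lemma ge0_integral_normal (f : R -> \bar R) :
  measurable_fun setT f -> (forall x, 0 <= f x)%E ->
  (\int[N]_x f x = \int[mu]_x (f x * (g x)%:E))%E.
Proof.
move=> mf f0; apply: ge0_integral_density => //.
- exact: measurable_normal_pdf.
- by move=> x; exact: normal_pdf_ge0.
Qed.

Lemma normal_pdf_rotation (c t u v : R) : c ^+ 2 + t ^+ 2 = 1 ->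
  g (c * u - t * v) * g (t * u + c * v) = g u * g v.
Proof.
move=> ct; rewrite !normal_pdfE// mulrACA [RHS]mulrACA /normal_fun -!expRD -!mulrDl !subr0.
have -> : - (c * u - t * v) ^+ 2 - (t * u + c * v) ^+ 2 =
  - ((c ^+ 2 + t ^+ 2) * (u ^+ 2 + v ^+ 2)) by ring.
by rewrite ct mul1r opprD.
Qed.

(** The rotation (x, y) -> (u, v) factors through (u, y), so that each step changes one coordinate
    affinely and one-dimensional substitution with Tonelli suffices. Both steps divide by [c], hence
    the assumption on it. *)
Lemma normal_prob_rotation (c t : R) (A B : set R) : c != 0 ->
  c ^+ 2 + t ^+ 2 = 1 -> measurable A -> measurable B ->
  (N \x N)%E [set z | A (c * z.1 + t * z.2) /\ B (- t * z.1 + c * z.2)] =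
    (N A * N B)%E.
Proof.
move=> c0 ct mA mB.
pose F (z : R * R) : R := \1_A (c * z.1 + t * z.2) * \1_B (- t * z.1 + c * z.2).
have lin (a b : R) : measurable_fun setT (fun z : R * R => a * z.1 + b * z.2).
  by apply: measurable_funD; apply: measurable_funM => //.
have mg : measurable_fun setT g by exact: measurable_normal_pdf.
have m1A : measurable_fun setT (\1_A : R -> R) by exact: measurable_indic.
have m1B : measurable_fun setT (\1_B : R -> R) by exact: measurable_indic.
have mF : measurable_fun setT F.
  apply: measurable_funM; first exact: (measurableT_comp m1A (lin c t)).
  exact: (measurableT_comp m1B (lin (- t) c)).
have F0 z : 0 <= F z by rewrite /F !indicE mulr_ge0.
pose S := [set z : R * R | A (c * z.1 + t * z.2) /\ B (- t * z.1 + c * z.2)].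
have mS : measurable S.
  have := measurableI _ _ (lin c t measurableT _ mA) (lin (- t) c measurableT _ mB).
  by rewrite !setTI.
have -> : (N \x N)%E S = (\int[N \x N]_z (F z)%:E)%E.
  transitivity (\int[N \x N]_z (\1_S z)%:E)%E.
    by have := integral_indic (N \x N)%E measurableT mS; rewrite setIT => ->.
  apply: eq_integral => z _; congr (_%:E).
  rewrite /F !indicE -natrM mulnb; congr (_%:R); congr nat_of_bool.
  by apply/idP/andP; rewrite !inE.
(* Integrand in the mixed coordinates (u, y), where u = c x + t y is new and y is old. *)
pose H (z : R * R) : R := \1_A z.1 * \1_B (- (t / c) * z.1 + c^-1 * z.2) *
  (g (c^-1 * z.1 + - (t / c) * z.2) * g z.2).
have mH : measurable_fun setT H.
  apply: measurable_funM.
    apply: measurable_funM; first exact: (measurableT_comp m1A).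
    exact: (measurableT_comp m1B).
  apply: measurable_funM; first exact: (measurableT_comp mg).
  exact: (measurableT_comp mg).
have H0 z : 0 <= H z by rewrite /H !indicE !mulr_ge0// normal_pdf_ge0.
have FH x y : H (c * x + t * y, y) = F (x, y) * (g x * g y).
  rewrite /F /H/=; congr (_ * \1_B _ * (g _ * _)).
  - have -> : c^-1 * y = c^-1 * (c ^+ 2 + t ^+ 2) * y by rewrite ct mulr1.
    by field.
  - by field.
have HG u v : H (u, c * v + t * u) = (\1_A u * g u) * (\1_B v * g v).
  rewrite mulrACA -(normal_pdf_rotation u v ct) /H/=.
  congr (_ * \1_B _ * (g _ * g _)); first by field.
    have -> : c^-1 * u = c^-1 * (c ^+ 2 + t ^+ 2) * u by rewrite ct mulr1.
    by field.
  by rewrite addrC.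
have nc0 : 0 <= `|c|^-1 by rewrite invr_ge0.
rewrite fubini_tonelli2//=; last exact/measurable_EFinP.
transitivity (\int[mu]_y \int[mu]_x (H (c * x + t * y, y)%R)%:E)%E.
  rewrite /fubini_G ge0_integral_normal; last 2 first.
  - have mFE : measurable_fun setT
        (fun z : measurableTypeR R * measurableTypeR R => (F z)%:E) by exact/measurable_EFinP.
    have FE0 : (forall z : measurableTypeR R * measurableTypeR R, 0 <= (F z)%:E)%E.
      by move=> z; rewrite lee_fin.
    exact: (@measurable_fun_fubini_tonelli_G _ _ _ _ _ N _ mFE FE0).
  - by move=> y; apply: integral_ge0 => x _; rewrite lee_fin.
  apply: eq_integral => y _.
  rewrite ge0_integral_normal; last 2 first.
  - by apply/measurable_EFinP; apply: (measurableT_comp mF).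
  - by move=> x; rewrite lee_fin.
  rewrite -ge0_integralZr//; last 3 first.
  - apply: emeasurable_funM; apply/measurable_EFinP => //.
    by apply: (measurableT_comp mF).
  - by move=> x _; rewrite -EFinM lee_fin mulr_ge0// normal_pdf_ge0.
  - by rewrite lee_fin normal_pdf_ge0.
  by apply: eq_integral => x _; rewrite FH -!EFinM mulrA.
transitivity (\int[mu]_y \int[mu]_u (`|c|^-1 * H (u, y))%:E)%E.
  apply: eq_integral => y _.
  rewrite (@ge0_integral_affine _ c (t * y) (fun u => (H (u, y))%:E))//; last 2 first.
  - by apply/measurable_EFinP; apply: (measurableT_comp mH).
  - by move=> x; rewrite lee_fin.
  rewrite -ge0_integralZl//.
  - by apply/measurable_EFinP; apply: (measurableT_comp mH).
  - by move=> x _; rewrite lee_fin.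
pose cH (z : measurableTypeR R * measurableTypeR R) := (`|c|^-1 * H z)%:E.
have mcH : measurable_fun setT cH.
  by apply/measurable_EFinP; apply: measurable_funM.
have cH0 z : (0 <= cH z)%E by rewrite lee_fin mulr_ge0.
transitivity (\int[mu]_u \int[mu]_y (`|c|^-1 * H (u, y))%:E)%E.
  exact/esym/(@fubini_tonelli _ _ _ _ _ mu mu _ mcH cH0).
(* At fixed u, the substitution y = c v + t u uses up the factor |c|^-1 left by the first one, and
   the rotated densities recombine into a product. *)
transitivity (\int[mu]_u ((\1_A u * g u)%:E * N B))%E.
  apply: eq_integral => u _.
  under eq_integral do rewrite EFinM.
  rewrite ge0_integralZl//; last 2 first.
  - by apply/measurable_EFinP; apply: (measurableT_comp mH).
  - by move=> x _; rewrite lee_fin.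
  rewrite -(@ge0_integral_affine _ c (t * u) (fun y => (H (u, y))%:E))//; last 2 first.
  - by apply/measurable_EFinP; apply: (measurableT_comp mH).
  - by move=> x; rewrite lee_fin.
  under eq_integral do rewrite HG EFinM.
  rewrite ge0_integralZl//; last 3 first.
  - by apply/measurable_EFinP; apply: measurable_funM.
  - by move=> x _; rewrite lee_fin mulr_ge0// ?normal_pdf_ge0// indicE.
  - by rewrite lee_fin mulr_ge0// ?normal_pdf_ge0// indicE.
  congr (_ * _)%E.
  rewrite [RHS]integral_mkcond; apply: eq_integral => x _.
  by rewrite patchE indicE; case: ifPn => _; rewrite ?mul1r ?mul0r.
rewrite ge0_integralZr//; last 2 first.
- by apply/measurable_EFinP; apply: measurable_funM.
- by move=> x _; rewrite lee_fin mulr_ge0// ?normal_pdf_ge0// indicE.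
congr (_ * _)%E.
rewrite [RHS]integral_mkcond; apply: eq_integral => x _.
by rewrite patchE indicE; case: ifPn => _; rewrite ?mul1r ?mul0r.
Qed.

End rotation.

Section pairing.
Local Open Scope ereal_scope.
Context d (T : measurableType d) (R : realType) (P : probability T R).

(** Extends independence from rectangles to arbitrary planar sets, such as rotated ones, while the
    event [E] carries the conditions on all other coordinates. Uniqueness of the product measure is
    applied to the law restricted to [E] and divided by [e], so e = 0 is separate. *)
Lemma joint_law_restr (mu1 mu2 : probability (measurableTypeR R) R)
    (U V : {RV P >-> R}) (E : set T) (e : R) :
  measurable E ->
  (forall A B, measurable A -> measurable B ->
     P (U @^-1` A `&` V @^-1` B `&` E) = mu1 A * mu2 B * e%:E) ->
  forall S : set (measurableTypeR R * measurableTypeR R), measurable S ->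
    P ([set w | S (U w, V w)] `&` E) = (mu1 \x mu2) S * e%:E.
Proof.
move=> mE UVE S mS.
pose UV : T -> measurableTypeR R * measurableTypeR R := fun w => (U w, V w).
have mUV : measurable_fun setT UV.
  by apply: (@measurable_fun_pair _ _ _ T (measurableTypeR R) (measurableTypeR R));
    [exact: (measurable_funP U)|exact: (measurable_funP V)].
have eE : P E = e%:E.
  have := UVE setT setT measurableT measurableT.
  by rewrite !preimage_setT !setTI !probability_setT !mul1e.
have e0 : (0 <= e)%R by rewrite -lee_fin -eE.
have [e00|en0] := eqVneq e 0%R.
  rewrite e00 mule0; apply/eqP; rewrite eq_le measure_ge0 andbT.
  apply: (@le_trans _ _ (P E)); last by rewrite eE e00.
  apply: le_measure; rewrite ?inE//.
  by apply: measurableI => //; rewrite -[X in measurable X]setTI; exact: mUV.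
have ei0 : (0 <= e^-1)%R by rewrite invr_ge0.
pose m' :
    {measure set (measurableTypeR R * measurableTypeR R) -> \bar R} :=
  mscale (NngNum ei0) (pushforward (mrestr P mE) UV).
have := @product_measure_unique _ _ _ _ _ mu1 mu2 (m' mUV) _ S mS.
move=> ->; last first.
  move=> A B mA mB.
  rewrite /m' /mscale/=.
  transitivity (e^-1%:E * P (U @^-1` A `&` V @^-1` B `&` E)); first by [].
  by rewrite UVE// muleCA -EFinM mulVf// mule1.
rewrite /m' /mscale/= muleAC -EFinM mulVf// mul1e.
by [].
Qed.

End pairing.

Section iid_families.
Local Open Scope ereal_scope.
Context d (T : measurableType d) (R : realType) (P : probability T R).
Variables (s : R) (s0 : s != 0%R).
Notation N := (normal_prob 0 s).

Definition iid_normal n (Z : 'I_n -> {RV P >-> R}) : Prop :=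
  forall B : 'I_n -> set R, (forall i, measurable (B i)) ->
    P [set w | forall i, B i (Z i w)] = \prod_(i < n) N (B i).

Definition mkRV (f : T -> R) (mf : measurable_fun setT f) : {RV P >-> R} :=
  HB.pack f (isMeasurableFun.Build _ _ _ _ f mf).

Lemma measurable_forall_preimage n (Z : 'I_n -> {RV P >-> R})
    (Q : pred 'I_n) (B : 'I_n -> set R) : (forall i, measurable (B i)) ->
  measurable [set w | forall i, Q i -> B i (Z i w)].
Proof.
move=> mB.
rewrite (_ : [set w | _] = \bigcap_(i in [set` Q]) (Z i @^-1` B i)); last first.
  by apply/seteqP; split=> w /= h i; exact: h.
apply: fin_bigcap_measurable; first exact: finite_finset.
by move=> i _; exact: measurable_funPTI.
Qed.

Lemma iid_normal_pair n (Z : 'I_n -> {RV P >-> R}) (i j : 'I_n) (B : 'I_n -> set R)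
    (S : set (measurableTypeR R * measurableTypeR R)) : iid_normal Z -> i != j ->
  (forall k, measurable (B k)) -> measurable S ->
  P ([set w | S (Z i w, Z j w)] `&`
     [set w | forall k, (k != i) && (k != j) -> B k (Z k w)]) =
  (N \x N) S * \prod_(k < n | (k != i) && (k != j)) N (B k).
Proof.
move=> iZ ij mB mS.
have fe : \prod_(k < n | (k != i) && (k != j)) N (B k) \is a fin_num.
  elim/big_rec : _ => // k x _ xf.
  by rewrite fin_numM//; apply: fin_num_measure; exact: mB.
rewrite -(fineK fe).
apply: joint_law_restr => //; first exact: measurable_forall_preimage.
move=> A1 A2 mA1 mA2.
pose B' k := if k == i then A1 else if k == j then A2 else B k.
have mB' k : measurable (B' k) by rewrite /B'; case: ifP => // _; case: ifP.
rewrite fineK//.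
have := iZ B' mB'.
rewrite (bigD1 i)//= (bigD1 j)//=; last by rewrite eq_sym.
have B'i : B' i = A1 by rewrite /B' eqxx.
have B'j : B' j = A2 by rewrite /B' [j == i]eq_sym (negbTE ij) eqxx.
rewrite B'i B'j muleA.
rewrite (_ : \prod_(k < n | (k != i) && (k != j)) N (B' k) =
    \prod_(k < n | (k != i) && (k != j)) N (B k)); last first.
  by apply: eq_bigr => k /andP[ki kj]; rewrite /B' (negbTE ki) (negbTE kj).
move=> <-; congr (P _); apply/seteqP; split => w /=.
  move=> [[h1 h2] h3] k; rewrite /B'; case: eqP => [->//|/eqP ki].
  by case: eqP => [->//|/eqP kj]; apply: h3; rewrite ki.
move=> h; split; first split.
- by have := h i; rewrite B'i.
- by have := h j; rewrite B'j.
- by move=> k /andP[ki kj]; have := h k; rewrite /B' (negbTE ki) (negbTE kj).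
Qed.

(** Only the coordinates [i] and [j] change: the constraints on the others go into the spectator
    event of [iid_normal_pair], and the planar rotation invariance does the rest. *)
Lemma iid_normal_rotation n (Z : 'I_n -> {RV P >-> R}) (i j : 'I_n) (c t : R) :
  iid_normal Z -> i != j -> c != 0%R -> (c ^+ 2 + t ^+ 2 = 1)%R ->
  exists Z' : 'I_n -> {RV P >-> R}, iid_normal Z' /\
    forall w, [/\ Z' i w = (c * Z i w + t * Z j w)%R,
                  Z' j w = (- t * Z i w + c * Z j w)%R &
                  forall k, k != i -> k != j -> Z' k w = Z k w].
Proof.
move=> iZ ij c0 ct.
have mlin a b : measurable_fun setT (fun w => a * Z i w + b * Z j w)%R.
  by apply: measurable_funD; apply: measurable_funM.
pose Z' k := if k == i then mkRV (mlin c t) else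
  if k == j then mkRV (mlin (- t)%R c) else Z k.
have Z'i w : Z' i w = (c * Z i w + t * Z j w)%R by rewrite /Z' eqxx.
have Z'j w : Z' j w = (- t * Z i w + c * Z j w)%R.
  by rewrite /Z' [j == i]eq_sym (negbTE ij) eqxx.
have Z'k k w : k != i -> k != j -> Z' k w = Z k w.
  by move=> ki kj; rewrite /Z' (negbTE ki) (negbTE kj).
exists Z'; split=> [B mB|w]; last by split => // k; exact: Z'k.
pose S : set (measurableTypeR R * measurableTypeR R) :=
  [set z | B i (c * z.1 + t * z.2)%R /\ B j (- t * z.1 + c * z.2)%R].
have mS : measurable S.
  have lin (a b : R) : measurable_fun setT
      (fun z : measurableTypeR R * measurableTypeR R => a * z.1 + b * z.2)%R.
    by apply: measurable_funD; apply: measurable_funM => //.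
  have := measurableI _ _ (lin c t measurableT _ (mB i)) (lin (- t)%R c measurableT _ (mB j)).
  by rewrite !setTI.
transitivity (P ([set w | S (Z i w, Z j w)] `&`
     [set w | forall k, (k != i) && (k != j) -> B k (Z k w)])).
  congr (P _); apply/seteqP; split=> w /=.
    move=> h; split; first by rewrite /S/= -Z'i -Z'j.
    by move=> k /andP[ki kj]; rewrite -Z'k.
  rewrite /S/= -Z'i -Z'j => -[[hi hj] h] k.
  have [->//|ki] := eqVneq k i; have [->//|kj] := eqVneq k j.
  by rewrite Z'k//; apply: h; rewrite ki.
rewrite iid_normal_pair// normal_prob_rotation//.
by rewrite [RHS](bigD1 i)//= [in RHS](bigD1 j)/= 1?eq_sym// muleA.
Qed.

Lemma iid_normal_drop n (Z : 'I_n.+1 -> {RV P >-> R}) (j : 'I_n.+1) :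
  iid_normal Z -> iid_normal (fun k => Z (lift j k)).
Proof.
move=> iZ B mB.
pose B' k := if unlift j k is Some l then B l else setT.
have mB' k : measurable (B' k) by rewrite /B'; case: unlift.
have := iZ B' mB'.
have B'j : B' j = setT by rewrite /B' unlift_none.
have B'l k : B' (lift j k) = B k by rewrite /B' liftK.
rewrite (bigD1_ord j)//= B'j probability_setT mul1e.
under eq_bigr do rewrite B'l.
move=> <-; congr (P _); apply/seteqP; split => w /=.
  by move=> h k; rewrite /B'; case: unliftP => // l ->.
by move=> h k; have := h (lift j k); rewrite B'l.
Qed.

End iid_families.

Section elimination.
Context d (T : measurableType d) (R : realType) (P : probability T R).
Variables (s : R) (s0 : s != 0).

Definition plane_rot n (i j : 'I_n) (c t : R) (x : 'I_n -> R) (k : 'I_n) : R :=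
  if k == i then c * x i + t * x j else
  if k == j then - t * x i + c * x j else x k.

Lemma dot_plane_rot n (i j : 'I_n) (c t : R) (x y : 'I_n -> R) :
  i != j -> c ^+ 2 + t ^+ 2 = 1 ->
  \sum_k plane_rot i j c t x k * plane_rot i j c t y k = \sum_k x k * y k.
Proof.
move=> ij ct; have ji : j != i by rewrite eq_sym.
rewrite (bigD1 i)//= [RHS](bigD1 i)//= (bigD1 j)//= [in RHS](bigD1 j)//= !addrA.
rewrite /plane_rot !eqxx (negbTE ji).
congr (_ + _); last by apply: eq_bigr => k /andP[/negbTE -> /negbTE ->].
transitivity ((c ^+ 2 + t ^+ 2) * (x i * y i + x j * y j)); first by ring.
by rewrite ct mul1r.
Qed.

Lemma exists_left_kernel m n (V : 'I_n -> 'I_m -> R) : (m < n)%N ->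
  exists2 u : 'I_n -> R, exists i, u i != 0 & forall a, \sum_k u k * V k a = 0.
Proof.
move=> mn; pose M := \matrix_(k, a) V k a.
have /rowV0Pn[v /sub_kermxP vM v0] : kermx M != 0.
  rewrite kermx_eq0 /row_free; apply: contraL mn => /eqP <-.
  by rewrite -leqNgt rank_leq_col.
exists (fun k => v 0 k).
  apply/existsP; apply: contraNT v0; rewrite negb_exists => /forallP h.
  by apply/eqP/rowP => k; have := h k; rewrite negbK mxE => /eqP.
move=> a; have /matrixP/(_ 0 a) := vM; rewrite !mxE => h; rewrite -[RHS]h.
by apply: eq_bigr => k _; rewrite !mxE.
Qed.

(** Plane rotations concentrate the vector [u], orthogonal to the columns of [V], on a single
    coordinate. The corresponding row of [V] is then 0 and can be deleted together with its noise
    variable; scalar products are preserved throughout. The induction is on the number of nonzero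
    entries of [u]. *)
Lemma iid_normal_drop_kernel m n (Z : 'I_n.+1 -> {RV P >-> R})
    (V : 'I_n.+1 -> 'I_m -> R) (u : 'I_n.+1 -> R) r :
  iid_normal s Z -> (exists i, u i != 0) ->
  (forall a, \sum_k u k * V k a = 0) -> (#|[pred k | u k != 0%R]| <= r)%N ->
  exists (Z' : 'I_n -> {RV P >-> R}) (V' : 'I_n -> 'I_m -> R),
    [/\ iid_normal s Z',
        forall a b, \sum_k V' k a * V' k b = \sum_k V k a * V k b &
        forall a w, \sum_k V' k a * Z' k w = \sum_k V k a * Z k w].
Proof.
elim: r Z V u => [|r IH] Z V u iZ [i ui] uV ur.
  by move: ur; rewrite leqn0 => /eqP/card0_eq/(_ i); rewrite !inE ui.
have [/existsP[j /andP[ji uj]]|/existsPn noj] :=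
    boolP [exists j, (j != i) && (u j != 0)].
  pose rho := Num.sqrt (u i ^+ 2 + u j ^+ 2).
  have rho2 : rho ^+ 2 = u i ^+ 2 + u j ^+ 2.
    by rewrite sqr_sqrtr// addr_ge0 ?sqr_ge0.
  have rho0 : rho != 0.
    apply: contraNneq ui => r0; move: rho2; rewrite r0 expr0n/= => /esym/eqP.
    by rewrite paddr_eq0 ?sqr_ge0// sqrf_eq0 => /andP[].
  (* This rotation sends (u_i, u_j) to (rho, 0), so [j] leaves the support of [u] while [i] stays in
     it. *)
  pose c := u i / rho; pose t := u j / rho.
  have ct : c ^+ 2 + t ^+ 2 = 1.
    by rewrite /c /t !expr_div_n -mulrDl -rho2 divff// sqrf_eq0.
  have c0 : c != 0 by rewrite /c mulf_neq0// invr_eq0.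
  have ij : i != j by rewrite eq_sym.
  have [Z' [iZ' Z'E]] := iid_normal_rotation s0 iZ ij c0 ct.
  have Z'rot w k : Z' k w = plane_rot i j c t (fun k => Z k w) k.
    have [hi hj hk] := Z'E w; rewrite /plane_rot.
    by have [->//|ki] := eqVneq k i; have [->//|kj] := eqVneq k j; exact: hk.
  pose V' k a := plane_rot i j c t (fun k => V k a) k.
  pose u' := plane_rot i j c t u.
  have u'j : u' j = 0.
    rewrite /u' /plane_rot (negbTE ji) eqxx /t /c; field.
    exact: rho0.
  have u'i : u' i = rho.
    rewrite /u' /plane_rot eqxx /t /c.
    transitivity (rho ^+ 2 / rho); first by rewrite rho2; field.
    by rewrite expr2 mulfK.
  have [] := IH Z' V' u' iZ'.
  - by exists i; rewrite u'i.
  - by move=> a; rewrite -[RHS](uV a) -[RHS](dot_plane_rot _ _ ij ct).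
  - rewrite -ltnS (leq_trans _ ur)//; apply: proper_card; apply/properP; split.
      apply/fintype.subsetP => k; rewrite !inE.
      have [->|ki] := eqVneq k i; first by rewrite ui.
      have [->|kj] := eqVneq k j; first by rewrite uj.
      by rewrite /u' /plane_rot (negbTE ki) (negbTE kj).
    by exists j; rewrite !inE ?uj// u'j eqxx.
  move=> Z'' [V'' [iZ'' VV VZ]]; exists Z'', V''; split => //.
    by move=> a b; rewrite VV -[RHS](dot_plane_rot _ _ ij ct).
  move=> a w; rewrite VZ -[RHS](dot_plane_rot _ _ ij ct).
  by apply: eq_bigr => k _; rewrite Z'rot.
(* Here [u] lives on [i] alone, so orthogonality says that row [i] of [V] is 0. *)
have Vi a : V i a = 0.
  have := uV a; rewrite (bigD1 i)//= big1 ?addr0; last first.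
    by move=> k ki; have := noj k; rewrite ki/= negbK => /eqP ->; rewrite mul0r.
  by move/eqP; rewrite mulf_eq0 (negbTE ui)/= => /eqP.
exists (fun k => Z (lift i k)), (fun k => V (lift i k)); split.
- exact: iid_normal_drop.
- by move=> a b; rewrite [RHS](bigD1_ord i)//= Vi mul0r add0r.
- by move=> a w; rewrite [RHS](bigD1_ord i)//= Vi mul0r add0r.
Qed.

(** As long as there are more rows than columns, some nonzero vector is orthogonal to the columns
    and one noise variable can be removed. The preserved Gram matrix and linear forms are all that
    projections onto the columns depend on. *)
Lemma iid_normal_reduce m n (Z : 'I_n -> {RV P >-> R}) (V : 'I_n -> 'I_m -> R) :
  iid_normal s Z -> (m <= n)%N ->
  exists (Z' : 'I_m -> {RV P >-> R}) (V' : 'I_m -> 'I_m -> R),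
    [/\ iid_normal s Z',
        forall a b, \sum_k V' k a * V' k b = \sum_k V k a * V k b &
        forall a w, \sum_k V' k a * Z' k w = \sum_k V k a * Z k w].
Proof.
elim: n Z V => [|n IH] Z V iZ.
  rewrite leqn0 => /eqP m0; move: V; rewrite m0 => V.
  by exists Z, V.
rewrite leq_eqVlt => /orP[/eqP mn|mn].
  by move: V; rewrite mn => V; exists Z, V.
have [u u0 uV] := exists_left_kernel V mn.
have [Z' [V' [iZ' VV VZ]]] := iid_normal_drop_kernel iZ u0 uV (leqnn _).
have [Z'' [V'' [iZ'' VV' VZ']]] := IH Z' V' iZ' mn.
exists Z'', V''; split => //.
- by move=> a b; rewrite VV'.
- by move=> a w; rewrite VZ'.
Qed.

End elimination.

(** * Gaussian and chi-square tails *)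

Section normal_tails.
Context {R : realType}.
Variables (s : R) (s0 : 0 < s).
Notation mu := (@lebesgue_measure R).
Notation N := (normal_prob 0 s).
Notation g := (normal_pdf 0 s).
Let sn0 : s != 0. Proof. by rewrite gt_eqF. Qed.

Lemma normal_pdfN (x : R) : g (- x) = g x.
Proof. by rewrite !normal_pdfE// /normal_fun !subr0 sqrrN. Qed.

Lemma normal_probN (A : set R) : measurable A -> N (-%R @^-1` A) = N A.
Proof.
move=> mA.
have mg : measurable_fun setT g by exact: measurable_normal_pdf.
have m1A : measurable_fun setT (\1_A : R -> R) by exact: measurable_indic.
have e (B : set R) : N B = (\int[mu]_x (\1_B x * g x)%:E)%E.
  rewrite /normal_prob integral_mkcond; apply: eq_integral => x _.
  by rewrite patchE indicE; case: ifPn => _; rewrite ?mul1r ?mul0r.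
rewrite !e.
transitivity (\int[mu]_x (\1_A (-1 * x + 0) * g (-1 * x + 0))%:E)%E.
  apply: eq_integral => x _; rewrite mulN1r addr0 normal_pdfN.
  by congr ((_ * _)%:E); rewrite !indicE.
have n10 : -1 != 0 :> R by rewrite oppr_eq0 oner_eq0.
rewrite (ge0_integral_affine 0 (f := fun x => (\1_A x * g x)%:E) n10).
- by rewrite normrN1 invr1 mul1e.
- by apply/measurable_EFinP; apply: measurable_funM.
- by move=> x; rewrite lee_fin mulr_ge0 ?normal_pdf_ge0// indicE.
Qed.

Lemma is_derive_normal_pdf (x : R) : is_derive x 1 g (- (x / s ^+ 2) * g x).
Proof.
have -> : g = (fun y => normal_peak s * expR (- (s ^+ 2 *+ 2)^-1 * y ^+ 2)).
  apply/funext => y; rewrite normal_pdfE// /normal_fun subr0.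
  by congr (_ * expR _); rewrite mulNr mulrC mulNr.
apply: is_derive_eq.
rewrite /GRing.scale/= !mulr1.
by field.
Qed.

Lemma normal_tail (u : R) : 0 < u ->
  (N `[(u * s)%R, +oo[ <= (expR (- u ^+ 2 / 2) / (2 * u))%:E)%E.
Proof.
move=> u0.
have us0 : 0 < u * s by rewrite mulr_gt0.
have un0 : u != 0 by rewrite gt_eqF.
have mg : measurable_fun setT g by exact: measurable_normal_pdf.
(* The factor x / (u s) is at least 1 on the ray and turns the integrand into the derivative of - (s
   / u) g. *)
apply: (@le_trans _ _ (\int[mu]_(x in `[(u * s)%R, +oo[) (x / (u * s) * g x)%:E)%E).
  apply: ge0_le_integral => //=.
  - by move=> x _; rewrite lee_fin normal_pdf_ge0.
  - by apply/measurable_EFinP; exact: measurable_funTS.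
  - apply/measurable_EFinP/measurable_funTS; apply: measurable_funM => //.
    exact: measurable_funM.
  - move=> x; rewrite /= in_itv/= andbT => xus; rewrite lee_fin ler_peMl ?normal_pdf_ge0//.
    by rewrite ler_pdivlMr ?mul1r.
rewrite (@ge0_continuous_FTC2y _ (fun x => x / (u * s) * g x) (fun x => - (s / u) * g x) _ 0).
- rewrite sub0e -EFinN lee_fin mulNr opprK normal_pdfE// /normal_fun subr0.
  have -> : - (u * s) ^+ 2 / (s ^+ 2 *+ 2) = - u ^+ 2 / 2 by field.
  rewrite mulrA [X in _ <= X]mulrC ler_wpM2r ?expR_ge0//.
  rewrite mulrAC invfM ler_wpM2r ?invr_ge0 ?(ltW u0)//.
  rewrite /normal_peak ler_pdivrMr ?sqrtr_gt0; last first.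
    by rewrite mulrn_wgt0// mulr_gt0 ?pi_gt0// exprn_gt0.
  (* [s] times the peak is 1 / sqrt (2 pi), which is at most 1/2 because pi >= 2; this is the 2 in
     the denominator of the bound. *)
  have h : s = 2^-1 * Num.sqrt ((2 * s) ^+ 2).
    by rewrite sqrtr_sqr gtr0_norm ?mulr_gt0// mulrA mulVf ?mul1r.
  rewrite [X in X <= _]h.
  rewrite ler_wpM2l// ?invr_ge0// ler_wsqrtr//.
  have := @pi_ge2 R; have := exprn_gt0 2 s0.
  rewrite exprMn -mulr_natr; nra.
- by move=> x xus; rewrite mulr_ge0 ?normal_pdf_ge0// divr_ge0 ?(le_trans _ xus)// ltW.
- apply: continuous_subspaceT => x; apply: cvgM; last exact: continuous_normal_pdf.
  by apply: cvgM; [exact: cvg_id | exact: cvg_cst].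
- rewrite -[X in _ --> X](mulr0 (- (s / u))); apply: cvgM; first exact: cvg_cst.
  have -> : g = (fun x => normal_peak s * gauss_fun ((Num.sqrt (s ^+ 2 *+ 2))^-1 * x)).
    apply/funext => y; rewrite normal_pdfE// /normal_fun subr0 /gauss_fun.
    rewrite exprMn exprVn sqr_sqrtr ?mulrn_wge0 ?sqr_ge0//.
    by congr (_ * expR _); rewrite mulNr mulrC.
  rewrite -[X in _ --> X](mulr0 (normal_peak s)); apply: cvgM; first exact: cvg_cst.
  apply: (cvg_comp _ _ _ (@cvg_gauss_fun R)).
  apply: gt0_cvgMry; last exact: cvg_id.
  by rewrite invr_gt0 sqrtr_gt0 mulrn_wgt0// exprn_gt0.
- move=> x _; apply: derivableM; first exact: derivable_cst.
  by have [] := is_derive_normal_pdf x.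
- apply: cvg_at_right_filter; apply: cvgM; first exact: cvg_cst.
  exact: continuous_normal_pdf.
- move=> x _; rewrite derive1E.
  have := is_derive_normal_pdf x => dg.
  rewrite (@derive_val _ _ _ _ _ _ _ (is_deriveZ (- (s / u)) dg)).
  rewrite /GRing.scale/=; field.
  by rewrite sn0.
Qed.

Lemma normal_tailN (u : R) : 0 < u ->
  (N `]-oo, (- (u * s))%R] <= (expR (- u ^+ 2 / 2) / (2 * u))%:E)%E.
Proof.
move=> u0; apply: le_trans (normal_tail u0).
by rewrite -[leRHS]normal_probN// (@opp_preimage_itvbndy _ true (u * s)).
Qed.

(** For v <= 1 the right-hand side is at least 1, since exp (- v / 2) >= 1 - v / 2; beyond that the
    two one-sided tails are added, at a level u >= 1. *)
Lemma normal_prob_sqr_ge (v : R) :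
  (N [set x | v * s ^+ 2 <= x ^+ 2]%R <= (2 * expR (- v / 2))%:E)%E.
Proof.
have mS : measurable [set x : R | v * s ^+ 2 <= x ^+ 2].
  have /(_ measurableT _ (measurable_itv `[v * s ^+ 2, +oo[)) :=
    measurable_funX 2 (@measurable_id _ _ setT : measurable_fun setT (@idfun R)).
  rewrite setTI; congr measurable; apply/seteqP.
  by split => x /=; rewrite in_itv/= andbT.
have [v1|v1] := leP v 1.
  rewrite (@le_trans _ _ 1%E)//; first exact: probability_le1.
  by rewrite lee_fin; have := expR_ge1Dx (- v / 2); lra.
set u := Num.sqrt v.
have u2 : u ^+ 2 = v by rewrite sqr_sqrtr// ltW// (lt_trans _ v1).
have u0 : 0 < u by rewrite sqrtr_gt0 (lt_trans _ v1).
have u1 : 1 <= u by rewrite -sqrtr1 ler_wsqrtr// ltW.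
have -> : [set x : R | v * s ^+ 2 <= x ^+ 2] =
    `]-oo, (- (u * s))%R] `|` `[u * s, +oo[.
  apply/seteqP; split => x /=; rewrite !in_itv/= andbT -u2 -exprMn.
    rewrite -ler_sqrt ?sqr_ge0// !sqrtr_sqr gtr0_norm ?mulr_gt0// ler_normr.
    by case/orP => h; [right|left]; lra.
  by move: (mulr_gt0 u0 s0); move: (u * s) => k k0 [h|h]; nra.
apply: (le_trans (measureU2 _ _ _)) => //.
have := normal_tail u0; have := normal_tailN u0; rewrite u2 => h1 h2.
apply: (le_trans (leeD h1 h2)).
have e0 := expR_ge0 (- v / 2).
have : expR (- v / 2) / (2 * u) <= expR (- v / 2).
  by rewrite ler_pdivrMr ?mulr_gt0//; nra.
by rewrite -EFinD lee_fin; lra.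
Qed.

(** The tilted density is again normal up to the factor 1 / r, with standard deviation s / r for r^2
    = 1 - 2 theta. *)
Lemma ge0_integral_normal_expR_sqr (theta : R) : theta < 2^-1 ->
  (\int[N]_x (expR (theta * x ^+ 2 / s ^+ 2))%:E =
    ((Num.sqrt (1 - 2 * theta))^-1)%:E)%E.
Proof.
move=> t2.
have t0 : 0 < 1 - 2 * theta by lra.
set r := Num.sqrt (1 - 2 * theta).
have r0 : 0 < r by rewrite sqrtr_gt0.
have rn0 : r != 0 by rewrite gt_eqF.
have r2 : r ^+ 2 = 1 - 2 * theta by rewrite sqr_sqrtr// ltW.
clearbody r.
have sr0 : s / r != 0 by rewrite mulf_neq0// invr_eq0.
have me : measurable_fun setT (fun x : R => (expR (theta * x ^+ 2 / s ^+ 2))%:E).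
  apply/measurable_EFinP; apply: measurableT_comp => //.
  by apply: measurable_funM => //; apply: measurable_funM => //; exact: measurable_funX.
rewrite ge0_integral_normal//.
have peakE : normal_peak s = r^-1 * normal_peak (s / r).
  rewrite /normal_peak -invfM; congr (_^-1).
  rewrite -[X in _ = X * _](ger0_norm (ltW r0)) -sqrtr_sqr -sqrtrM ?sqr_ge0//.
  have e (k : R) : s ^+ 2 * k *+ 2 = r ^+ 2 * ((s / r) ^+ 2 * k *+ 2).
    by field; rewrite ?sn0 ?rn0.
  by rewrite (e pi).
have pdfE (x : R) : expR (theta * x ^+ 2 / s ^+ 2) * g x = r^-1 * normal_pdf 0 (s / r) x.
  rewrite !normal_pdfE// /normal_fun !subr0 peakE mulrCA -expRD.
  have -> : theta * x ^+ 2 / s ^+ 2 + - x ^+ 2 / (s ^+ 2 *+ 2) =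
      - x ^+ 2 / ((s / r) ^+ 2 *+ 2).

    have -> : theta = (1 - r ^+ 2) / 2 by rewrite r2; field.
    by field; rewrite ?sn0 ?rn0.
  by rewrite mulrA.
transitivity (\int[mu]_x (r^-1%:E * (normal_pdf 0 (s / r) x)%:E))%E.
  by apply: eq_integral => x _; rewrite -!EFinM pdfE.
rewrite ge0_integralZl//; last 3 first.
- by apply/measurable_EFinP; exact: measurable_normal_pdf.
- by move=> x _; rewrite lee_fin normal_pdf_ge0.
- by rewrite lee_fin invr_ge0 ltW.
by rewrite integral_normal_pdf mule1.
Qed.

End normal_tails.

Lemma measure_le_integral d (T : measurableType d) (R : realType)
    (mu : {measure set T -> \bar R}) (A : set T) (f : T -> \bar R) :
  measurable A -> measurable_fun setT f -> (forall x, 0 <= f x)%E ->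
  (forall x, A x -> 1 <= f x)%E -> (mu A <= \int[mu]_x f x)%E.
Proof.
move=> mA mf f0 f1.
rewrite -[A]setIT -integral_indic//; apply: ge0_le_integral => //.
- exact/measurable_EFinP/measurable_indic.
- move=> x _; rewrite indicE; case: (boolP (x \in A)) => [xA|_]; last exact: f0.
  by apply: f1; rewrite inE in xA.
Qed.

Section chi_square.
Context d (T : measurableType d) (R : realType) (P : probability T R).
Variables (s : R) (s0 : 0 < s) (n : nat) (Z : 'I_n -> {RV P >-> R}).
Hypothesis iZ : iid_normal s Z.
Notation N := (normal_prob 0 s).

Definition sum_sqr (k : nat) (w : T) : R := \sum_(i < n | (i < k)%N) Z i w ^+ 2.

Lemma measurable_sum_sqr k : measurable_fun setT (sum_sqr k).
Proof.
rewrite (_ : sum_sqr k = fun w =>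
  \sum_(i <- [seq i : 'I_n <- index_enum 'I_n | (i < k)%N]) Z i w ^+ 2); last first.
  by apply/funext => w; rewrite /sum_sqr big_filter.
by apply: measurable_sum => i; exact: measurable_funX.
Qed.

Definition sum_sqr_RV k : {RV P >-> R} := mkRV P (measurable_sum_sqr k).

Definition sum_sqr_dist k : probability (measurableTypeR R) R :=
  distribution P (HB.pack (sum_sqr k : T -> measurableTypeR R)
    (isMeasurableFun.Build _ _ T (measurableTypeR R) (sum_sqr k)
      (@measurable_sum_sqr k)) : {mfun T >-> measurableTypeR R}).

Lemma sum_sqrS k (kn : (k < n)%N) w :
  sum_sqr k.+1 w = sum_sqr k w + Z (Ordinal kn) w ^+ 2.
Proof.
rewrite /sum_sqr (bigD1 (Ordinal kn))/= ?ltnSn// addrC; congr (_ + _).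
by apply: eq_bigl => i; rewrite ltnS ltn_neqAle andbC -val_eqE.
Qed.

Let tail_prod (B : 'I_n -> set R) k : \bar R := (\prod_(i < n | (k <= i)%N) N (B i))%E.

Let tail_prod_fin B k : (forall i, measurable (B i)) -> tail_prod B k \is a fin_num.
Proof.
move=> mB; rewrite /tail_prod; elim/big_rec : _ => // i x _ xf.
by rewrite fin_numM//; apply: fin_num_measure; exact: mB.
Qed.

(** Independence of the first [k] squares' sum from all later coordinates jointly: one of these is
    absorbed into the sum at each step of the induction. *)
Let indep_at k := forall (A : set R) (B : 'I_n -> set R), measurable A ->
  (forall i, measurable (B i)) ->
  (P (sum_sqr_RV k @^-1` A `&` [set w | forall i : 'I_n, (k <= i)%N -> B i (Z i w)]) =
   P (sum_sqr_RV k @^-1` A) * tail_prod B k)%E.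

Let joint_at k (kn : (k < n)%N) : indep_at k ->
  forall (S : set (measurableTypeR R * measurableTypeR R)) (B : 'I_n -> set R),
  measurable S -> (forall i, measurable (B i)) ->
  (P ([set w | S (sum_sqr_RV k w, Z (Ordinal kn) w)] `&`
     [set w | forall i : 'I_n, (k < i)%N -> B i (Z i w)]) =
   (sum_sqr_dist k \x N)%E S * tail_prod B k.+1)%E.
Proof.
move=> hk S B mS mB.
rewrite -(fineK (tail_prod_fin k.+1 mB)).
apply: joint_law_restr => //.
  exact: (@measurable_forall_preimage _ _ _ P n Z (fun i : 'I_n => (k < i)%N) B mB).
move=> A1 A2 mA1 mA2; rewrite fineK ?tail_prod_fin//.
pose B' i := if i == Ordinal kn then A2 else B i.
have mB' i : measurable (B' i) by rewrite /B'; case: ifP.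
have B'k : B' (Ordinal kn) = A2 by rewrite /B' eqxx.
have B'i (i : 'I_n) : (k < i)%N -> B' i = B i.
  by move=> ki; rewrite /B'; case: eqP => // ik; move: ki; rewrite ik ltnn.
have := hk A1 B' mA1 mB'.
rewrite {1}/tail_prod (bigD1 (Ordinal kn))//= B'k muleA.
rewrite (_ : (\prod_(i < n | (k <= i)%N && (i != Ordinal kn)) N (B' i))%E = tail_prod B k.+1).
  move=> <-; congr (P _); apply/seteqP; split=> w /=.
    move=> [[h1 h2] h3]; split=> // i; rewrite leq_eqVlt => /orP[/eqP ki|ki].
      have -> : i = Ordinal kn by apply: val_inj.
      by rewrite B'k.
    by rewrite B'i//; exact: h3.
  move=> [h1 h2]; split; first split => //.
    by have := h2 (Ordinal kn); rewrite B'k; exact.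
  by move=> i ki; rewrite -B'i//; apply: h2; exact: ltnW.
rewrite /tail_prod; apply: eq_big => [i|i /andP[ki ik]].
  by rewrite ltn_neqAle andbC -val_eqE eq_sym.
by rewrite B'i// ltn_neqAle ki andbT eq_sym.
Qed.

Let image_set A := [set z : measurableTypeR R * measurableTypeR R | A (z.1 + z.2 ^+ 2)].

Let measurable_image_fun : measurable_fun setT
  (fun z : measurableTypeR R * measurableTypeR R => z.1 + z.2 ^+ 2).
Proof. by apply: measurable_funD => //; exact: measurable_funX. Qed.

Let measurable_image_set (A : set R) : measurable A -> measurable (image_set A).
Proof. by move=> mA; have := measurable_image_fun measurableT mA; rewrite setTI. Qed.

Let preimage_sum_sqr k (kn : (k < n)%N) A :
  sum_sqr_RV k.+1 @^-1` A = [set w | image_set A (sum_sqr_RV k w, Z (Ordinal kn) w)].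
Proof. by apply/seteqP; split=> w /=; rewrite /image_set/= sum_sqrS. Qed.

Let law_step k (kn : (k < n)%N) : indep_at k -> forall A : set R, measurable A ->
  P (sum_sqr_RV k.+1 @^-1` A) =
  (sum_sqr_dist k \x N)%E (image_set A).
Proof.
move=> hk A mA.
have := joint_at kn hk (measurable_image_set mA) (fun=> measurableT).
rewrite -preimage_sum_sqr.
rewrite (_ : [set w | _] = setT); last by apply/seteqP; split.
rewrite setIT => ->; rewrite /tail_prod big1 ?mule1// => i _.
by rewrite probability_setT.
Qed.

Let indepP k : (k <= n)%N -> indep_at k.
Proof.
elim: k => [_|k IH kn].
  move=> A B mA mB.
  have S0 w : sum_sqr 0 w = 0 by rewrite /sum_sqr big_pred0.
  have [A0|A0] := pselect (A 0).
    rewrite (_ : sum_sqr_RV 0 @^-1` A = setT); last first.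
      by apply/seteqP; split => w //= _; rewrite S0.
    rewrite setTI probability_setT mul1e /tail_prod.
    have := iZ mB; rewrite (eq_bigl xpredT)// => <-.
    by congr (P _); apply/seteqP; split => w /= h i; [|move=> _]; exact: h.
  rewrite (_ : sum_sqr_RV 0 @^-1` A = set0); last first.
    by apply/seteqP; split => w //=; rewrite S0.
  by rewrite set0I measure0 mul0e.
move=> A B mA mB; have hk := IH (ltnW kn).
rewrite (law_step kn hk mA) (preimage_sum_sqr kn).
exact: (joint_at kn hk (measurable_image_set mA) mB).
Qed.

Lemma sum_sqr_law k (kn : (k < n)%N) (A : set R) : measurable A ->
  P (sum_sqr_RV k.+1 @^-1` A) =
  (sum_sqr_dist k \x N)%E
    [set z : measurableTypeR R * measurableTypeR R | A (z.1 + z.2 ^+ 2)].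
Proof. by move=> mA; apply: law_step => //; exact: indepP (ltnW kn). Qed.

Lemma ge0_integral_sum_sqr k (kn : (k < n)%N) (f : R -> \bar R) :
  measurable_fun setT f -> (forall x, 0 <= f x)%E ->
  (\int[sum_sqr_dist k.+1]_x f x =
   \int[sum_sqr_dist k]_x \int[N]_z f (x + z ^+ 2)%R)%E.
Proof.
move=> mf f0.
pose h : measurableTypeR R * measurableTypeR R -> measurableTypeR R :=
  fun z => z.1 + z.2 ^+ 2.
have mh : measurable_fun setT h by exact: measurable_image_fun.
transitivity (\int[pushforward (sum_sqr_dist k \x N)%E h]_x f x)%E.
  by apply: eq_measure_integral => A mA _; rewrite -[RHS](sum_sqr_law kn).
rewrite ge0_integral_pushforward//.
rewrite preimage_setT fubini_tonelli1//.
  exact: (measurableT_comp mf mh).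
by move=> z; exact: f0.
Qed.

Let measurable_expR_scale (c e : R) :
  measurable_fun setT (fun x : R => (expR (c * x / e))%:E).
Proof.
by apply/measurable_EFinP; apply: measurableT_comp => //; do 2 apply: measurable_funM => //.
Qed.

Lemma ge0_integral_expR_sum_sqr (theta : R) k : theta < 2^-1 -> (k <= n)%N ->
  (\int[sum_sqr_dist k]_x (expR (theta * x / s ^+ 2))%:E =
   ((Num.sqrt (1 - 2 * theta))^-1 ^+ k)%:E)%E.
Proof.
move=> t2; elim: k => [_|k IH kn].
  rewrite /sum_sqr_dist ge0_integral_distribution//.
  rewrite (eq_integral (cst 1%E)); last first.
    by move=> w _; rewrite /= /sum_sqr big_pred0// mulr0 mul0r expR0.
    by rewrite integral_cst//= mul1e expr0 probability_setT.
  exact: measurable_expR_scale.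
rewrite (ge0_integral_sum_sqr kn)//.
transitivity (\int[sum_sqr_dist k]_x ((expR (theta * x / s ^+ 2))%:E *
    ((Num.sqrt (1 - 2 * theta))^-1)%:E))%E.
  apply: eq_integral => x _.
  under eq_integral do rewrite mulrDr mulrDl expRD EFinM.
  rewrite ge0_integralZl//.
    by rewrite (ge0_integral_normal_expR_sqr s0 t2).
  apply/measurable_EFinP; apply: measurableT_comp => //.
  by do 2 apply: measurable_funM => //; exact: measurable_funX.
rewrite ge0_integralZr//; last exact: measurable_expR_scale.
by rewrite IH ?(ltnW kn)// exprSr EFinM.
Qed.

Let measurable_ray (a : R) : measurable [set x : R | a <= x].
Proof.
rewrite (_ : [set x : R | _] = [set` `[a, +oo[])//.
by apply/seteqP; split => x /=; rewrite in_itv/= andbT.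
Qed.

Lemma sum_sqr_chernoff (theta a : R) k : 0 <= theta -> theta < 2^-1 -> (k <= n)%N ->
  (P [set w | a * s ^+ 2 <= sum_sqr k w]%R <=
   (expR (- (theta * a)) * (Num.sqrt (1 - 2 * theta))^-1 ^+ k)%:E)%E.
Proof.
move=> t0 t2 kn.
have s20 : 0 < s ^+ 2 by rewrite exprn_gt0.
rewrite EFinM -(ge0_integral_expR_sum_sqr t2 kn) -ge0_integralZl//; last first.
  exact: measurable_expR_scale.
rewrite (_ : P _ = sum_sqr_dist k [set x : R | a * s ^+ 2 <= x])//.
apply: measure_le_integral => //.
- exact: measurable_ray.
- by apply: measurable_funeM; exact: measurable_expR_scale.
- move=> x ax; rewrite -EFinM lee_fin -expRD -expR0 ler_expR.
  rewrite -mulrA -mulrN -mulrDr mulr_ge0//.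
  by rewrite addrC subr_ge0 ler_pdivlMr.
Qed.

(** Sharper than Chernoff: given the other [k] squares, the last one is bounded by its Gaussian
    tail, so that one factor (1 - 2 theta)^(-1/2) is replaced by 2. For a missing amount v >= 0 this
    uses exp (- v / 2) <= exp (- theta v); for v < 0 the bound exceeds 1. *)
Lemma sum_sqr_tail (theta a : R) k : 0 <= theta -> theta < 2^-1 -> (k < n)%N ->
  (P [set w | a * s ^+ 2 <= sum_sqr k.+1 w]%R <=
   (2 * expR (- (theta * a)) * (Num.sqrt (1 - 2 * theta))^-1 ^+ k)%:E)%E.
Proof.
move=> t0 t2 kn.
have s20 : 0 < s ^+ 2 by rewrite exprn_gt0.
rewrite EFinM -(ge0_integral_expR_sum_sqr t2 (ltnW kn)) -ge0_integralZl//; last first.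
  exact: measurable_expR_scale.
rewrite (_ : P _ = P (sum_sqr_RV k.+1 @^-1` [set x : R | a * s ^+ 2 <= x]))//.
rewrite (sum_sqr_law kn); last exact: measurable_ray.
set S := [set z | _].
have mS : measurable S by apply: measurable_image_set; exact: measurable_ray.
rewrite /product_measure1; apply: ge0_le_integral => //.
- exact: measurable_fun_xsection.
- by apply: measurable_funeM; exact: measurable_expR_scale.
move=> x _ /=.
rewrite (_ : xsection S x = [set z : R | (a - x / s ^+ 2) * s ^+ 2 <= z ^+ 2]); last first.
  apply/seteqP; split => z; rewrite /xsection/= inE /S/=.
    by rewrite mulrBl divfK ?gt_eqF// lerBlDl.
  by rewrite mulrBl divfK ?gt_eqF// lerBlDl.
rewrite -EFinM.
have -> : 2 * expR (- (theta * a)) * expR (theta * x / s ^+ 2) =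
    2 * expR (- (theta * (a - x / s ^+ 2))).
  by rewrite -mulrA -expRD mulrBr opprB mulrA addrC.
move: (a - x / s ^+ 2) => v.
have [v0|v0] := leP 0 v.
  apply: (le_trans (normal_prob_sqr_ge s0 v)).
  by rewrite lee_fin ler_pM2l// ler_expR; nra.
apply: (@le_trans _ _ 1%E).
  apply: probability_le1.
  rewrite (_ : [set z : R | _] = setT)//; apply/seteqP; split => z //= _.
  by rewrite (le_trans _ (sqr_ge0 _))//; nra.
rewrite lee_fin.
have : 1 <= expR (- (theta * v)) by rewrite -expR0 ler_expR; nra.
lra.
Qed.

End chi_square.

Section gaussian_tails.
Context d (T : measurableType d) (R : realType) (P : probability T R).
Variables (s : R) (s0 : 0 < s).
Let sn0 : s != 0. Proof. by rewrite gt_eqF. Qed.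

Lemma sqrtr_expR_ln (t : R) : 0 < t -> Num.sqrt t = expR (ln t / 2).
Proof.
move=> t0; have := expR_ge0 (ln t / 2).
rewrite -[in LHS](@lnK _ t) ?posrE// => h.
have {1}-> : ln t = ln t / 2 *+ 2 by rewrite mulr2n; field.
by rewrite mulr2n expRD -expr2 sqrtr_sqr ger0_norm.
Qed.

Lemma iid_normal_sum_sqr_tail m (Z : 'I_m -> {RV P >-> R}) (t : R) :
  iid_normal s Z -> (0 < m)%N -> 1 <= t ->
  (P [set w | m%:R * t * s ^+ 2 <= \sum_i Z i w ^+ 2]%R <=
   (Num.min 1 (2 / Num.sqrt t) * expR (- (m%:R / 2 * (t - 1 - ln t))))%:E)%E.
Proof.
move=> iZ m0 t1; have t0 : 0 < t by rewrite (lt_le_trans _ t1).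
(* The minimizer of the Chernoff bound: 1 - 2 theta = 1 / t, and the exponential moment of each
   square is sqrt t. The two arguments of the minimum come from [sum_sqr_chernoff] and
   [sum_sqr_tail]. *)
pose theta := (1 - t^-1) / 2.
have ti1 : t^-1 <= 1 by rewrite invf_le1.
have ti0 : 0 < t^-1 by rewrite invr_gt0.
have th0 : 0 <= theta by rewrite /theta; lra.
have th2 : theta < 2^-1 by rewrite /theta; lra.
have r1 : (Num.sqrt (1 - 2 * theta))^-1 = Num.sqrt t.
  have -> : 1 - 2 * theta = t^-1 by rewrite /theta; field; rewrite gt_eqF.
  by rewrite sqrtrV ?invrK// ltW.
have expE : expR (- (m%:R / 2 * (t - 1 - ln t))) =
    expR (- (theta * (m%:R * t))) * Num.sqrt t ^+ m.
  rewrite sqrtr_expR_ln// -expRM_natl -expRD; congr expR.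
  by rewrite /theta; field; rewrite gt_eqF.
have st0 : 0 < Num.sqrt t by rewrite sqrtr_gt0.
have sumE w : \sum_i Z i w ^+ 2 = sum_sqr Z m w.
  by apply: eq_bigl => i; rewrite ltn_ord.
have -> : [set w | m%:R * t * s ^+ 2 <= \sum_i Z i w ^+ 2] =
    [set w | m%:R * t * s ^+ 2 <= sum_sqr Z m w].
  by apply/seteqP; split=> w /=; rewrite sumE.
rewrite expE minEle; case: ifP => _.
  by rewrite mul1r; have := sum_sqr_chernoff s0 iZ (m%:R * t) th0 th2 (leqnn m); rewrite r1.
move: m0 Z iZ {sumE expE} => /prednK <-; set k := m.-1 => Z iZ.
have := sum_sqr_tail s0 iZ (k.+1%:R * t) th0 th2 (ltnSn k).
rewrite r1 => /le_trans; apply; rewrite lee_fin exprS !mulrA.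
by rewrite ler_wpM2r ?exprn_ge0 ?sqrtr_ge0// [leRHS]mulrAC divfK ?gt_eqF.
Qed.

(** The reduction to m coordinates, for m = 1. The sign of the remaining coefficient [alpha] is not
    controlled. *)
Lemma linear_form_normal n (Z : 'I_n -> {RV P >-> R}) (a : 'I_n -> R) :
  iid_normal s Z -> (0 < n)%N ->
  exists (V : {RV P >-> R}) (alpha : R),
    [/\ forall B, measurable B -> P (V @^-1` B) = normal_prob 0 s B,
        alpha ^+ 2 = \sum_k a k ^+ 2 &
        forall w, \sum_k a k * Z k w = alpha * V w].
Proof.
move=> iZ n0.
have [Z' [V' [iZ' VV VZ]]] := iid_normal_reduce sn0 (fun k (_ : 'I_1) => a k) iZ n0.
exists (Z' ord0), (V' ord0 ord0); split.
- move=> B mB; have := iZ' (fun=> B) (fun=> mB).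
  rewrite big_ord1 => <-; congr (P _); apply/seteqP; split=> w /=.
    by move=> h i; rewrite ord1.
  exact.
- by have := VV ord0 ord0; rewrite big_ord1 expr2.
- by move=> w; rewrite -(VZ ord0) big_ord1.
Qed.

Let scaled_tail (al c k v : R) : 0 <= al -> al <= c -> 0 < c -> 0 < k ->
  al * v <= - (c * k) -> v <= - k.
Proof.
move=> al0 alc c0 k0 h; rewrite leNgt; apply/negP => vk.
have ck0 : 0 < c * k by rewrite mulr_gt0.
have : al != 0 by apply: contraTneq h => ->; rewrite mul0r -ltNge oppr_lt0.
move=> aln0; have alp : 0 < al by rewrite lt_def aln0.
have vk' : 0 < v + k by lra.
have := mulr_gt0 alp vk'; have : 0 <= (c - al) * k by rewrite mulr_ge0 ?subr_ge0// ltW.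
by move=> h1 h2; nra.
Qed.

Lemma linear_form_le_tail n (Z : 'I_n -> {RV P >-> R}) (a : 'I_n -> R) (c u : R) :
  iid_normal s Z -> (0 < n)%N -> 0 < c -> 0 < u -> \sum_k a k ^+ 2 <= c ^+ 2 ->
  (P [set w | (\sum_k a k * Z k w <= - (c * (u * s)))%R] <=
    (expR (- u ^+ 2 / 2) / (2 * u))%:E)%E.
Proof.
move=> iZ n0 c0 u0 ac.
have [V [al [VN al2 VE]]] := linear_form_normal a iZ n0.
rewrite -al2 in ac.
have us0 : 0 < u * s by rewrite mulr_gt0.
have mS (B : set R) : measurable B -> measurable (V @^-1` B).
  by move=> mB; exact: measurable_funPTI.
have mE : measurable [set w | \sum_k a k * Z k w <= - (c * (u * s))].
  have mf : measurable_fun setT (fun w => al * V w) by exact: measurable_funM.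
  have := mf measurableT _ (measurable_itv `]-oo, - (c * (u * s))]).
  rewrite setTI; congr measurable; apply/seteqP; split=> w /=.
    by rewrite in_itv/= VE.
  by rewrite in_itv/= VE.
have nal : `|al| <= c by rewrite -(ger0_norm (ltW c0)) -ler_sqr ?nnegrE// !real_normK ?num_real.
(* For negative [al] the event lies in the upper tail of [V], which has the same bound. *)
have [al0|al0] := leP 0 al.
  apply: (@le_trans _ _ (P (V @^-1` `]-oo, - (u * s)]))).
    apply: le_measure; rewrite ?inE//; first exact: mS.
    move=> w /=; rewrite VE in_itv/=; rewrite ger0_norm// in nal.
    exact: scaled_tail.
  rewrite VN//; exact: normal_tailN.
apply: (@le_trans _ _ (P (V @^-1` `[u * s, +oo[))).
  apply: le_measure; rewrite ?inE//; first exact: mS.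
  move=> w /=; rewrite VE in_itv/= andbT; rewrite ltr0_norm// in nal.
  move=> h; rewrite -lerN2; apply: (@scaled_tail (- al) c) => //.
    by rewrite oppr_ge0 ltW.
  by rewrite mulrNN.
rewrite VN//; exact: normal_tail.
Qed.

Let dot_comb m n (V : 'I_n -> 'I_m -> R) (c : 'I_m -> R) (x : 'I_n -> R) :
  \sum_k (\sum_a V k a * c a) * x k = \sum_a c a * \sum_k V k a * x k.
Proof.
under eq_bigr do rewrite mulr_suml.
rewrite exchange_big/=; apply: eq_bigr => a _.
by rewrite mulr_sumr; apply: eq_bigr => k _; rewrite mulrCA mulrA.
Qed.

(* The equation |W|^2 = <W, Z> holds when W is the projection of Z on a subspace of the
   column space of V. *)
Lemma projection_le_sum_sqr m n (Z : 'I_n -> {RV P >-> R}) (V : 'I_n -> 'I_m -> R) :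
  iid_normal s Z -> (m <= n)%N ->
  exists2 Z' : 'I_m -> {RV P >-> R}, iid_normal s Z' &
    forall w (c : 'I_m -> R), let W k := \sum_a V k a * c a in
      \sum_k W k * W k = \sum_k W k * Z k w ->
      \sum_k W k * W k <= \sum_k Z' k w ^+ 2.
Proof.
move=> iZ mn; have [Z' [V' [iZ' VV VZ]]] := iid_normal_reduce sn0 V iZ mn.
exists Z' => // w c /= WZ; pose W' k := \sum_a V' k a * c a.
have dotVW (b : 'I_m) k (U : 'I_k -> 'I_m -> R) :
    \sum_i U i b * (\sum_a U i a * c a) = \sum_a c a * \sum_i U i a * U i b.
  rewrite -dot_comb.
  by apply: eq_bigr => i _; rewrite mulrC.
have WW : \sum_k W' k * W' k = \sum_k (\sum_a V k a * c a) * (\sum_a V k a * c a).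
  rewrite !dot_comb; apply: eq_bigr => b _; rewrite !dotVW.
  by congr (_ * _); apply: eq_bigr => a _; rewrite VV.
have WZ' : \sum_k W' k * Z' k w = \sum_k (\sum_a V k a * c a) * Z k w.
  by rewrite !dot_comb; apply: eq_bigr => a _; rewrite VZ.
(* Since <W', Z'> = |W'|^2, the expansion is |Z'|^2 - |W'|^2. The coefficients [c] may depend on
   [w], because the reduction holds column by column. *)
have : 0 <= \sum_k (W' k - Z' k w) ^+ 2 by apply: sumr_ge0 => k _; exact: sqr_ge0.
have -> : \sum_k (W' k - Z' k w) ^+ 2 =
    \sum_k W' k * W' k - 2 * (\sum_k W' k * Z' k w) + \sum_k Z' k w ^+ 2.
  rewrite mulr_sumr -sumrN -!big_split/=; apply: eq_bigr => k _.
  by rewrite sqrrB mulr2n; ring.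
by rewrite WZ' -WZ WW; lra.
Qed.

End gaussian_tails.

(** * Sparsity and uniqueness of the MCP solutions *)

Section sparsity_arithmetic.
Context {R : realType}.

(** What is left after maximizing over [a]. The left side tends to 1 as D tends to 0, so the
    estimates have little room there; after clearing denominators, the difference is D times a
    quartic with constant term 32. *)
Let final_bound (D s : R) : 0 < D -> D <= 1 -> 0 <= s -> s ^+ 2 <= 1 + D ->
  (8 - D) / 12 * (1 - D) + ((8 - D) / 12) ^+ 2 / (4 * ((1 - D / 2) / 3 + D / (2 + 3 * D)))
    + D / (2 + 3 * D) * (2^-1 + s) ^+ 2 < 1.
Proof.
move=> D0 D1 s0 sD.
(* A polynomial upper bound of sqrt (1 + D): its square exceeds 1 + D by D^2 (1 - D + D^2 / 12) /
   12. *)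
have s1 : s <= 1 + D / 2 - D ^+ 2 / 12.
  rewrite -ler_sqr ?nnegrE//; last by nra.
  apply: (le_trans sD).
  suff : 0 <= D ^+ 2 * (1 - D + D ^+ 2 / 12) by nra.
  by rewrite mulr_ge0 ?sqr_ge0//; nra.
set Q := 4 + 10 * D - 3 * D ^+ 2; set W := 2 + 3 * D.
have Q0 : 0 < Q by rewrite /Q; nra.
have W0 : 0 < W by rewrite /W; nra.
(* In (1/2 + s)^2 = 1/4 + s + s^2, the polynomial bound serves for s and the hypothesis for s^2. *)
apply: (@le_lt_trans _ _ ((8 - D) / 12 * (1 - D) + (8 - D) ^+ 2 * W / (96 * Q) +
    D / W * (9 / 4 + 3 / 2 * D - D ^+ 2 / 12))).
  apply: lerD; last first.
    by apply: ler_wpM2l; [rewrite divr_ge0// ltW | nra].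
  rewrite lerD2l le_eqVlt; apply/orP; left; apply/eqP; rewrite /Q /W.
  by field; rewrite ?gt_eqF//; rewrite -/Q -/W; nra.
have QE : Q = 4 + 10 * D - 3 * D ^+ 2 by [].
have WE : W = 2 + 3 * D by [].
clearbody Q W.
have QW : 0 < 96 * Q * W by rewrite !mulr_gt0.
have [Qn0 Wn0] : Q != 0 /\ W != 0 by rewrite !gt_eqF.
rewrite -(ltr_pM2r QW) mul1r.
have -> : ((8 - D) / 12 * (1 - D) + (8 - D) ^+ 2 * W / (96 * Q) +
    D / W * (9 / 4 + 3 / 2 * D - D ^+ 2 / 12)) * (96 * Q * W) =
    8 * Q * W * (8 - D) * (1 - D) + (8 - D) ^+ 2 * W ^+ 2 +
    8 * Q * D * (27 + 18 * D - D ^+ 2) by field; rewrite ?Qn0 ?Wn0.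
rewrite QE WE -subr_gt0.
have : 0 <= D ^+ 2 * (1 - D) by rewrite mulr_ge0 ?sqr_ge0// subr_ge0.
have : 0 <= D ^+ 4 by rewrite exprn_ge0// ltW.
move=> h4 h3; have h : 0 < 32 - 116 * D + 556 * D ^+ 2 - 337 * D ^+ 3 + 48 * D ^+ 4 by nra.
have := mulr_gt0 D0 h; congr (_ < _); ring.
Qed.

(* In units where m lambda^2 = c^*, with K = c^*/c_*, G2 and H2 are the squared Euclidean
   norms of the scores and of the coefficients on m extra variables, a^2 is the squared
   length of the fit of these scores, q their pairing with the coefficients, theta = 1 / gamma.
   With D = 1 / (2 K - 1), the quadratic hypotheses enter with weights (8 - D) / 12 and
   1 / (4 K + 1), and the resulting concave quadratic in a is maximized. *)
Lemma sparsity_arith (K a G2 q H2 d s theta : R) :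
  1 <= K -> 0 <= q -> 0 <= G2 -> G2 <= a ^+ 2 -> 0 <= s -> 0 <= theta <= 2^-1 ->
  a ^+ 2 + G2 + 2 * q <= (K - 1) * d + a ->
  (4 * K + 1) * H2 <= (2^-1 + s) ^+ 2 - a ^+ 2 - 2 * q ->
  s ^+ 2 <= K * d -> d <= 2 / (2 * K - 1) ->
  G2 + 2 * theta * q + H2 < 1.
Proof.
move=> K1 q0 G20 G2a s0 /andP[t0 t2] h2 h3 sd dK.
pose D := (2 * K - 1)^-1.
have K10 : 0 < 2 * K - 1 by lra.
have D0 : 0 < D by rewrite invr_gt0.
have D1 : D <= 1 by rewrite invf_le1//; lra.
have KE : K = (1 + D) / (2 * D) by rewrite /D; field; rewrite gt_eqF.
have W0 : 0 < 2 + 3 * D by lra.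
have Kd1 : K * d <= 1 + D.
  apply: (@le_trans _ _ (K * (2 / (2 * K - 1)))); first by rewrite ler_wpM2l//; lra.
  by rewrite le_eqVlt; apply/orP; left; apply/eqP; rewrite /D; field; rewrite gt_eqF.
have Kd2 : (K - 1) * d <= 1 - D.
  apply: (@le_trans _ _ ((K - 1) * (2 / (2 * K - 1)))); first by rewrite ler_wpM2l//; lra.
  by rewrite le_eqVlt; apply/orP; left; apply/eqP; rewrite /D; field; rewrite gt_eqF.
pose eta := D / (2 + 3 * D).
have eta0 : 0 < eta by rewrite divr_gt0.
have H2eta : H2 <= eta * ((2^-1 + s) ^+ 2 - a ^+ 2 - 2 * q).
  have -> : eta = (4 * K + 1)^-1.
    by rewrite /eta KE; field; rewrite ?gt_eqF//; lra.
  by rewrite -ler_pdivrMl ?invr_gt0 ?invrK//; lra.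
pose mu := (8 - D) / 12.
(* [A] is the coefficient of - a^2 in the weighted sum: [mu] and [eta] from the two quadratic
   hypotheses, less the 1 - mu spent on (1 - mu) G2 <= (1 - mu) a^2. *)
pose A := (1 - D / 2) / 3 + eta.
have AE : A = 2 * mu - 1 + eta by rewrite /A /mu; lra.
have A0 : 0 < A by rewrite /A; lra.
have amax : mu * a - A * a ^+ 2 <= mu ^+ 2 / (4 * A).
  rewrite -subr_ge0.
  have -> : mu ^+ 2 / (4 * A) - (mu * a - A * a ^+ 2) = (mu - 2 * A * a) ^+ 2 / (4 * A).
    by field; rewrite gt_eqF.
  by rewrite divr_ge0 ?sqr_ge0// mulr_ge0// ltW.
have sD : s ^+ 2 <= 1 + D by lra.
have := final_bound D0 D1 s0 sD; rewrite -/mu -/eta -/A => fb.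
apply: le_lt_trans fb.
have mu1 : 2^-1 <= mu by rewrite /mu; lra.
have mu2 : mu <= 1 by rewrite /mu; lra.
have h2' : a ^+ 2 + G2 + 2 * q <= 1 - D + a by lra.
have e1 : mu * (a ^+ 2 + G2 + 2 * q) <= mu * (1 - D + a).
  by rewrite ler_wpM2l//; lra.
have e2 : (1 - mu) * G2 <= (1 - mu) * a ^+ 2 by rewrite ler_wpM2l//; lra.
have e3 : 2 * theta * q <= 2 * mu * q.
  by rewrite ler_wpM2r//; lra.
have e4 : 0 <= eta * q by rewrite mulr_ge0// ltW.
move: amax; rewrite AE; nra.
Qed.

End sparsity_arithmetic.

Section mcp.
Context {R : realType}.
Notation mu := (@lebesgue_measure R).

Lemma derive1_mcp (gamma lam t : R) : 0 < gamma -> 0 < lam -> 0 < t ->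
  derive1 (mcp gamma lam) t = Num.max 0 (lam - t / gamma).
Proof.
move=> g0 l0 t0.
pose f (x : R) := Num.max 0 (1 - x / (gamma * lam)).
have cf : continuous f.
  move=> x; have := @continuous_max R R (cst 0) (fun x => 1 - x / (gamma * lam)) x.
  apply; first exact: cvg_cst.
  apply: cvgB; first exact: cvg_cst.
  by apply: cvgM; [exact: cvg_id|exact: cvg_cst].
have intf : mu.-integrable `[0, t + 1] (EFin \o f).
  apply: continuous_compact_integrable; first exact: segment_compact.
  exact: continuous_subspaceT.
have tt1 : t < t + 1 by rewrite ltrDl.
have [dF FE] := continuous_FTC1_closed tt1 intf t0 (cf t).
rewrite derive1E.
have -> : mcp gamma lam = fun x => lam * (\int[mu]_(s in `[0, x]) f s)%R by [].
rewrite deriveZ//= -derive1E FE /GRing.scale/= /f.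
rewrite maxr_pMr ?ltW// mulr0 mulrBr mulr1; congr (Num.max _ (_ - _)).
by field; rewrite !gt_eqF.
Qed.

Definition mcp_eq (gamma lam u g : R) : Prop :=
  (u != 0 -> g = Num.sg u * Num.max 0 (lam - `|u| / gamma)) /\ (u = 0 -> `|g| <= lam).

Lemma mcp_estimating n p (X : 'M[R]_(n, p)) y gamma lam b : 0 < gamma -> 0 < lam ->
  estimating_equation (mcp gamma) X y lam b ->
  forall j, mcp_eq gamma lam (b j 0) (score X y b j).
Proof.
move=> g0 l0 h j; have [h1 h2] := h j; split=> // bj; rewrite h1//.
by rewrite derive1_mcp// normr_gt0.
Qed.

Variables (gamma lam : R) (gamma0 : 0 < gamma) (lam0 : 0 < lam).

Lemma mcp_eq_norm_le u g : mcp_eq gamma lam u g -> `|g| <= lam.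
Proof.
move=> [h1 h2]; have [u0|u0] := eqVneq u 0; first exact: h2.
rewrite h1// normrM normr_sg u0 mul1r ger0_norm ?le_max ?lexx//.
by rewrite ge_max ltW//= gerBl divr_ge0// ltW.
Qed.

Lemma mcp_eq_sign u g : mcp_eq gamma lam u g -> 0 <= u * g.
Proof.
move=> [h1 h2]; have [->|u0] := eqVneq u 0; first by rewrite mul0r.
by rewrite h1// mulrCA mulrA -normrEsg mulr_ge0// le_max lexx.
Qed.

Lemma mcp_eq_active u g : mcp_eq gamma lam u g -> u != 0 -> lam <= `|g| + `|u| / gamma.
Proof.
move=> [h1 h2] u0; rewrite h1// normrM normr_sg u0 mul1r ger0_norm ?le_max ?lexx//.
by rewrite -lerBlDr le_max lexx orbT.
Qed.

Lemma mcp_eqN u g : mcp_eq gamma lam u g -> mcp_eq gamma lam (- u) (- g).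
Proof.
move=> [h1 h2]; split; rewrite ?oppr_eq0 normrN.
  by move=> u0; rewrite h1// sgrN mulNr.
by move/eqP; rewrite oppr_eq0 => /eqP; exact: h2.
Qed.

Let mcp_eq_pos u g : mcp_eq gamma lam u g -> 0 < u ->
  0 <= g /\ gamma * g = Num.max 0 (gamma * lam - u).
Proof.
move=> [h1 _] u0; rewrite h1 ?gt_eqF// gtr0_sg// mul1r gtr0_norm//; split.
  by rewrite le_max lexx.
rewrite maxr_pMr ?ltW// mulr0 mulrBr; congr (Num.max _ (_ - _)).
by rewrite mulrC divfK// gt_eqF.
Qed.

Let mcp_eq_monotone_pos u g v : mcp_eq gamma lam u g -> gamma * lam <= v ->
  - (u - v) ^+ 2 <= (u - v) * g * gamma.
Proof.
move=> ug vl; have gl0 : 0 < gamma * lam by rewrite mulr_gt0.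
have [u0|u0|u0] := ltgtP u 0.
- have := mcp_eq_sign ug; rewrite nmulr_rge0// => gle0.
  have : 0 <= (u - v) * g by rewrite mulr_le0//; lra.
  by move=> h; have := mulr_ge0 h (ltW gamma0); nra.
- have [g0] := mcp_eq_pos ug u0; have [uv|uv] := leP v u.
    move=> _; have : 0 <= (u - v) * g by rewrite mulr_ge0 ?subr_ge0.
    by move=> h; have := mulr_ge0 h (ltW gamma0); nra.
  rewrite -mulrA [g * _]mulrC => ->.
  have : Num.max 0 (gamma * lam - u) <= v - u by rewrite ge_max; apply/andP; split; lra.
  by move: (Num.max _ _) => k kv; nra.
- have gl := mcp_eq_norm_le ug; rewrite u0 sub0r sqrrN -mulrA mulNr lerN2.
  rewrite expr2 ler_wpM2l//; first lra.
  rewrite mulrC (le_trans _ vl)// ler_wpM2l ?(ltW gamma0)//.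
  exact: le_trans (ler_norm g) gl.
Qed.

(** Adding u^2 / (2 gamma) makes the MCP convex, so g + u / gamma is monotone in u. The comparison
    point (v, g') is either in the flat part of the penalty or at 0, the two cases met by the
    oracle. *)
Lemma mcp_eq_monotone u g v g' : mcp_eq gamma lam u g ->
  (gamma * lam <= `|v| /\ g' = 0) \/ (v = 0 /\ `|g'| <= lam) ->
  - (u - v) ^+ 2 / gamma <= (u - v) * (g - g').
Proof.
move=> ug h; rewrite ler_pdivrMr//; case: h => [[gv ->]|[-> g'l]].
  rewrite subr0; have [v0|v0] := leP 0 v.
    by apply: mcp_eq_monotone_pos => //; rewrite ger0_norm in gv.
  have := @mcp_eq_monotone_pos (- u) (- g) (- v) (mcp_eqN ug).
  rewrite ltr0_norm// in gv; move=> /(_ gv).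
  by rewrite -opprD sqrrN mulrNN.
rewrite subr0; move: g'l; rewrite ler_norml => /andP[g'1 g'2].
have [u0|u0|->] := ltgtP u 0; last by rewrite expr0n oppr0 !mul0r.
  have Nu0 : 0 < - u by lra.
  have [_ h] := mcp_eq_pos (mcp_eqN ug) Nu0.
  have : gamma * lam + u <= gamma * - g by rewrite h le_max opprK lexx orbT.
  have : gamma * - g' <= gamma * lam by rewrite ler_wpM2l ?(ltW gamma0)//; lra.
  by nra.
have [_ h] := mcp_eq_pos ug u0.
have : gamma * lam - u <= gamma * g by rewrite h le_max lexx orbT.
have : gamma * g' <= gamma * lam by rewrite ler_wpM2l ?(ltW gamma0)//; lra.
by nra.
Qed.

End mcp.

Section sparsity_quadratic.
Context {R : realType}.

(* a2, b2, w2, cw, bw, bc are the Gram entries of three vectors, the fits of the scores off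
   and on the true support and the gap between two least squares fits. *)
Lemma sparsity_quadratic (m d clo chi gamma lam a2 b2 w2 cw bw bc G2 B2 H2 : R) :
  0 < m -> 0 < clo -> clo <= chi -> 0 < lam -> 0 < gamma ->
  4 * chi + clo <= gamma ^+ 2 * clo ^+ 2 * chi ->
  0 <= a2 -> 0 <= b2 -> 0 <= w2 -> cw ^+ 2 <= a2 * w2 -> bw ^+ 2 <= b2 * w2 ->
  0 <= G2 -> 0 <= H2 -> G2 <= chi * a2 -> G2 + B2 <= chi * (a2 + 2 * bc + b2) ->
  clo * b2 <= B2 -> B2 <= d * lam ^+ 2 -> d * (2 * chi - clo) <= 2 * m * clo ->
  w2 <= m * lam ^+ 2 / (4 * chi) -> 0 <= cw - bc - a2 ->
  clo * H2 <= w2 + a2 + b2 - 2 * cw - 2 * bw + 2 * bc ->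
  G2 + 2 * (cw - bc - a2) / gamma + H2 / gamma ^+ 2 < m * lam ^+ 2.
Proof.
move=> m0 clo0 cc l0 g0 gam a20 b20 w20 cwle bwle G20 H20 Ga GB bB Bd dm wm q0 HN.
have chi0 : 0 < chi by exact: lt_le_trans cc.
(* Division by [k] normalizes to the units of [sparsity_arith]; [a] and [s] become the lengths of
   the fits of the scores off and on the true support. *)
pose k := m * lam ^+ 2 / chi.
have k0 : 0 < k by rewrite divr_gt0// mulr_gt0// exprn_gt0.
have kn0 : k != 0 by rewrite gt_eqF.
have [chin clon gamn] : [/\ chi != 0, clo != 0 & gamma != 0] by rewrite !gt_eqF.
set q := cw - bc - a2 in q0 *.
have kchi : k * chi = m * lam ^+ 2 by rewrite /k divfK.
have kc0 : 0 < k * chi by rewrite mulr_gt0.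
rewrite -kchi -[X in _ < X]mul1r -(ltr_pdivrMr _ _ kc0).
pose K := chi / clo.
have KE : chi = K * clo by rewrite /K divfK.
have K1 : 1 <= K by rewrite /K ler_pdivlMr// mul1r.
pose a := Num.sqrt (a2 / k); pose s := Num.sqrt (b2 / k).
have a2E : a ^+ 2 = a2 / k by rewrite sqr_sqrtr// divr_ge0// ltW.
have s2E : s ^+ 2 = b2 / k by rewrite sqr_sqrtr// divr_ge0// ltW.
have a0 : 0 <= a by exact: sqrtr_ge0.
have s0 : 0 <= s by exact: sqrtr_ge0.
(* The gap has normalized length at most 1/2, so Cauchy-Schwarz bounds 2 cw / k by [a] and - 2 bw /
   k by [s]. *)
have wk : w2 / k <= 4^-1.
  rewrite ler_pdivrMr// (le_trans wm)// /k le_eqVlt; apply/orP; left; apply/eqP.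
  by field.
clearbody k a s.
have cwk : 2 * (cw / k) <= a.
  have : (2 * (cw / k)) ^+ 2 <= a ^+ 2.
    rewrite a2E.
    have -> : (2 * (cw / k)) ^+ 2 = 4 * (cw ^+ 2 / k ^+ 2) by field.
    have : cw ^+ 2 / k ^+ 2 <= a2 / k * (w2 / k).
      have -> : a2 / k * (w2 / k) = (a2 * w2) / k ^+ 2 by field.
      by rewrite ler_wpM2r// invr_ge0 exprn_ge0// ltW.
    have : a2 / k * (w2 / k) <= a2 / k * 4^-1 by rewrite ler_wpM2l// divr_ge0// ltW.
    by lra.
  have [c0|c0] := leP 0 (2 * (cw / k)); first by rewrite ler_sqr ?nnegrE.
  by move=> _; apply: le_trans (ltW c0) a0.
have bwk : - (2 * (bw / k)) <= s.
  have : (- (2 * (bw / k))) ^+ 2 <= s ^+ 2.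
    rewrite s2E.
    have -> : (- (2 * (bw / k))) ^+ 2 = 4 * (bw ^+ 2 / k ^+ 2) by field.
    have : bw ^+ 2 / k ^+ 2 <= b2 / k * (w2 / k).
      have -> : b2 / k * (w2 / k) = (b2 * w2) / k ^+ 2 by field.
      by rewrite ler_wpM2r// invr_ge0 exprn_ge0// ltW.
    have : b2 / k * (w2 / k) <= b2 / k * 4^-1 by rewrite ler_wpM2l// divr_ge0// ltW.
    by lra.
  have [c0|c0] := leP 0 (- (2 * (bw / k))); first by rewrite ler_sqr ?nnegrE.
  by move=> _; apply: le_trans (ltW c0) s0.
have gchi : 2 <= gamma * chi.
  have gc : 2 <= gamma * clo.
    rewrite -ler_sqr ?nnegrE ?mulr_ge0 ?(ltW g0) ?(ltW clo0)// exprMn.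
    rewrite -(ler_pM2r chi0); apply: le_trans gam; lra.
  by apply: (le_trans gc); rewrite ler_wpM2l// ltW.
pose G2' := G2 / (chi * k); pose d' := B2 / (chi * k).
pose H2' := H2 / (gamma ^+ 2 * chi * k); pose q' := q / k; pose th := (gamma * chi)^-1.
have ck0 : 0 < chi * k by rewrite mulr_gt0.
have -> : (G2 + 2 * q / gamma + H2 / gamma ^+ 2) / (k * chi) =
    G2' + 2 * th * q' + H2'.
  by rewrite /G2' /th /q' /H2'; field; rewrite ?gamn ?chin ?kn0.
have q'0 : 0 <= q' by rewrite divr_ge0// ltW.
have qE : q' = cw / k - bc / k - a2 / k by rewrite /q' /q; field.
have b2d : s ^+ 2 <= K * d'.
  rewrite s2E /K /d'.
  have -> : chi / clo * (B2 / (chi * k)) = B2 / clo / k.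
    by field; rewrite ?chin ?kn0 ?clon.
  rewrite ler_wpM2r ?invr_ge0 ?(ltW k0)// ler_pdivlMr// mulrC; exact: bB.
apply: (@sparsity_arith _ K a G2' q' H2' d' s th) => //.
- by rewrite divr_ge0// ltW.
- rewrite a2E /G2' ler_pdivrMr//.
  by have -> : a2 / k * (chi * k) = chi * a2 by field.
- rewrite invr_ge0 mulr_ge0 ?(ltW g0) ?(ltW chi0)//= lef_pV2 ?posrE//.
  by rewrite mulr_gt0.
- have : G2' + d' <= a2 / k + 2 * (bc / k) + b2 / k.
    rewrite /G2' /d' -mulrDl ler_pdivrMr//.
    have -> : (a2 / k + 2 * (bc / k) + b2 / k) * (chi * k) = chi * (a2 + 2 * bc + b2) by field.
    exact: GB.
  rewrite a2E qE -s2E; lra.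
- have h : clo * H2 / k <= w2 / k + a2 / k + b2 / k - 2 * (cw / k) - 2 * (bw / k) + 2 * (bc / k).
    rewrite ler_pdivrMr//.
    have -> : (w2 / k + a2 / k + b2 / k - 2 * (cw / k) - 2 * (bw / k) + 2 * (bc / k)) * k =
      w2 + a2 + b2 - 2 * cw - 2 * bw + 2 * bc by field.
    exact: HN.
  apply: (@le_trans _ _ (clo * H2 / k)); last first.
    by move: h; rewrite a2E qE sqrrD s2E; lra.
  have -> : (4 * K + 1) * H2' = (4 * chi + clo) * (H2 / (clo * gamma ^+ 2 * chi * k)).
    by rewrite /K /H2'; field; rewrite ?gamn ?chin ?kn0 ?clon.
  have -> : clo * H2 / k = gamma ^+ 2 * clo ^+ 2 * chi * (H2 / (clo * gamma ^+ 2 * chi * k)).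
    by field; rewrite ?gamn ?chin ?kn0 ?clon.
  by rewrite ler_wpM2r// divr_ge0// !mulr_ge0 ?exprn_ge0// ltW.
- rewrite /d' ler_pdivrMr//; apply: (le_trans Bd).
  have c2 : 0 < 2 * chi - clo by lra.
  have -> : 2 / (2 * K - 1) * (chi * k) = 2 * m * clo / (2 * chi - clo) * lam ^+ 2.
    rewrite [chi * k]mulrC kchi /K; field; rewrite clon gt_eqF//=.
  by rewrite ler_wpM2r ?exprn_ge0 ?(ltW l0)// ler_pdivlMr.
Qed.

End sparsity_quadratic.

Section mcp_solutions.
Context {R : realType}.
Variables (n p : nat) (X : 'M[R]_(n, p)) (y : 'cV[R]_n) (d : nat) (clo chi gamma : R).
Hypotheses (n0 : (0 < n)%N) (clo0 : 0 < clo) (cc : clo <= chi) (SRC : sparse_riesz X d clo chi).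
Hypotheses (gamma0 : 0 < gamma) (gam : 4 * chi + clo <= gamma ^+ 2 * clo ^+ 2 * chi).

Let chi0 : 0 < chi. Proof. exact: lt_le_trans cc. Qed.
Let nn0 : 0 < n%:R :> R. Proof. by rewrite ltr0n. Qed.
Let ni0 : 0 <= n%:R^-1 :> R. Proof. by rewrite invr_ge0 ltW. Qed.

Lemma dotv_supported (A : {set 'I_p}) (u v : 'cV[R]_p) : supported A u ->
  dotv u v = \sum_(j in A) u j 0 * v j 0.
Proof.
move=> uA; rewrite /dotv [RHS]big_mkcond/=; apply: eq_bigr => j _.
by case: ifPn => // jA; rewrite uA// mul0r.
Qed.

Let cvB (u v : 'cV[R]_p) j : (u - v) j 0 = u j 0 - v j 0.
Proof. by rewrite !mxE. Qed.

Let solve (A : {set 'I_p}) (c : 'cV[R]_p) := restricted_solve X A c.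

Let dotv_solve (A : {set 'I_p}) (c h : 'cV[R]_p) : (#|A| <= d)%N -> supported A h ->
  dotv (X *m h) (X *m solve A c) = \sum_(j in A) h j 0 * c j 0.
Proof.
move=> Ad hA; rewrite dotv_mulmx (dotv_supported _ hA).
by apply: eq_bigr => j jA; rewrite (restricted_solveP clo0 SRC).
Qed.

(** The energy of the fit is the quadratic form of the inverse Gram matrix at c / n. Both bounds
    follow by Cauchy-Schwarz from |X u|^2 = <u, c> and <c, c> = <X c, X u>, where u solves the
    normal equations for c. *)
Lemma energy_bounds (A : {set 'I_p}) (c : 'cV[R]_p) : (#|A| <= d)%N -> supported A c ->
  clo * (n%:R^-1 * dotv (X *m solve A c) (X *m solve A c)) <=
    n%:R^-1 ^+ 2 * dotv c c <= chi * (n%:R^-1 * dotv (X *m solve A c) (X *m solve A c)).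
Proof.
move=> Ad cA; set u := solve A c.
have uA : supported A u by exact: supported_restricted_solve.
set e := n%:R^-1 * _.
have e0 : 0 <= e by rewrite mulr_ge0// dotvv_ge0.
have /andP[u1 _] := sparse_riesz_bounds SRC Ad uA; rewrite -/e in u1.
have /andP[_ c2] := sparse_riesz_bounds SRC Ad cA.
have eE : dotv (X *m u) (X *m u) = dotv u c.
  by rewrite [LHS]dotv_solve// (dotv_supported _ uA).
have ccE : dotv c c = dotv (X *m c) (X *m u) by rewrite [RHS]dotv_solve// (dotv_supported _ cA).
apply/andP; split.
  have [->|en0] := eqVneq e 0; first by rewrite mulr0 mulr_ge0 ?sqr_ge0 ?dotvv_ge0.
  have ep : 0 < e by rewrite lt_def en0.
  rewrite -(ler_pM2r ep).
  have : e ^+ 2 <= n%:R^-1 ^+ 2 * (dotv u u * dotv c c).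
    by rewrite /e eE exprMn ler_wpM2l ?sqr_ge0// dotv_CS.
  move=> h; apply: (@le_trans _ _ (clo * (n%:R^-1 ^+ 2 * (dotv u u * dotv c c)))).
    by rewrite -mulrA -expr2 ler_wpM2l// ltW.
  rewrite [leLHS](_ : _ = n%:R^-1 ^+ 2 * dotv c c * (clo * dotv u u)); last by ring.
  by rewrite ler_wpM2l// mulr_ge0 ?sqr_ge0 ?dotvv_ge0.
have [->|cn0] := eqVneq (dotv c c) 0; first by rewrite mulr0 mulr_ge0// ltW.
have cp : 0 < dotv c c by rewrite lt_def cn0 dotvv_ge0.
rewrite -(ler_pM2r cp).
have : dotv c c ^+ 2 <= dotv (X *m c) (X *m c) * dotv (X *m u) (X *m u).
  by rewrite {1}ccE dotv_CS.
move=> h; apply: (@le_trans _ _ (n%:R^-1 ^+ 2 * (dotv (X *m c) (X *m c) * dotv (X *m u) (X *m u)))).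
  by rewrite -mulrA -expr2 ler_wpM2l// sqr_ge0.
rewrite [leLHS](_ : _ = e * (n%:R^-1 * dotv (X *m c) (X *m c))); last by rewrite /e; ring.
rewrite [leRHS](_ : _ = e * (chi * dotv c c)); last by ring.
by rewrite ler_wpM2l.
Qed.

Variable B : {set 'I_p}.
Hypothesis Bd : (#|B| < d)%N.
Hypothesis dB : #|B|%:R * (2 * chi - clo) <= 2 * (d - #|B|)%N%:R * clo.
Local Notation m := (d - #|B|)%N.

Definition lse_gap (A : {set 'I_p}) : 'cV[R]_n :=
  X *m (restricted_solve X A (X^T *m y) - restricted_solve X B (X^T *m y)).

Local Notation b0 := (restricted_solve X B (X^T *m y)).

(** Squaring the activity inequality and summing over [C] gives at least m lam^2, while
    [sparsity_quadratic] gives strictly less for the same sum. *)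
Lemma no_active_set (lam : R) (b : 'cV[R]_p) (C : {set 'I_p}) : 0 < lam ->
  (forall j, mcp_eq gamma lam (b j 0) (score X y b j)) ->
  (forall j, j \in B -> j \notin C) -> #|C| = m -> supported (B :|: C) b ->
  n%:R^-1 * dotv (lse_gap (B :|: C)) (lse_gap (B :|: C)) <= m%:R * lam ^+ 2 / (4 * chi) ->
  (forall j, j \in C -> lam <= `|score X y b j| + `|b j 0| / gamma) -> False.
Proof.
move=> lam0 beq BC Cm bA; set W := lse_gap _ => Wle act.
set A := B :|: C in bA W Wle *.
have Ad : (#|A| <= d)%N.
  have BC0 : #|B :&: C| = 0%N.
    apply/eqP; rewrite cards_eq0; apply/eqP/setP => j; rewrite !inE.
    by apply/negP => /andP[/BC/negP].
  by rewrite /A cardsU BC0 subn0 Cm (subnKC (ltnW Bd)).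
pose r := X^T *m (y - X *m b).
have scE j : score X y b j = n%:R^-1 * r j 0 by rewrite /score mulrC.
have rE : r = X^T *m y - X^T *m (X *m b) by rewrite /r mulmxBr.
clearbody r.
pose cB : 'cV[R]_p := \col_j (if j \in B then r j 0 else 0).
pose cC : 'cV[R]_p := \col_j (if j \in C then r j 0 else 0).
have cBE j : j \in B -> cB j 0 = r j 0 by move=> jB; rewrite mxE jB.
have cB0 j : j \notin B -> cB j 0 = 0 by move=> /negbTE jB; rewrite mxE jB.
have cCE j : j \in C -> cC j 0 = r j 0 by move=> jC; rewrite mxE jC.
have cC0 j : j \in B -> cC j 0 = 0 by move=> /BC/negbTE jC; rewrite mxE jC.
have inA j : (j \in A) = (j \in B) || (j \in C) by rewrite inE.
have cBA : supported A cB.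
  by move=> j; rewrite inA negb_or mxE => /andP[/negbTE ->].
have cCA : supported A cC.
  by move=> j; rewrite inA negb_or mxE => /andP[_ /negbTE ->].
have BCf j : j \in B -> j \in C = false.
  by move=> jB; exact/negbTE/BC.
have BCs (F : 'I_p -> R) : \sum_(j in A) F j = \sum_(j in B) F j + \sum_(j in C) F j.
  rewrite [LHS](bigID [in B])/=; congr (_ + _); apply: eq_bigl => j; rewrite inA.
    by case: (j \in B); rewrite ?andbF.
  by have [jB|] := boolP (j \in B); rewrite ?andbT ?andbF//= (BCf _ jB).
pose GB := X *m solve A cB; pose GC := X *m solve A cC.
pose h := b - b0.
have b0A : supported A b0.
  apply: (@supportedS _ _ B A); last exact: supported_restricted_solve.
  exact: finset.subsetUl.
have hA : supported A h by exact: supportedB.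
(* On [A] the solution satisfies X^T X b = X^T y - r, and the scores split into their parts [cB] and
   [cC]; by uniqueness [b] is the corresponding combination of restricted solutions. *)
have XhE : X *m h = W - GB - GC.
  rewrite /W /lse_gap /GB /GC -!mulmxBr.
  have z0 : b - solve A (X^T *m y) + solve A cB + solve A cC = 0.
    apply: (supported_orth_eq0 clo0 SRC n0 Ad).
      move=> j jA; have sA c : solve A c j 0 = 0 by exact: supported_restricted_solve.
      have -> (u1 u2 u3 u4 : 'cV[R]_p) :
        (u1 - u2 + u3 + u4) j 0 = u1 j 0 - u2 j 0 + u3 j 0 + u4 j 0 by rewrite !mxE.
      by rewrite !sA bA// subr0 !addr0.
    move=> j jA; rewrite !mulmxDr !mulmxN.
    have -> (u1 u2 u3 u4 : 'cV[R]_p) :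
      (u1 - u2 + u3 + u4) j 0 = u1 j 0 - u2 j 0 + u3 j 0 + u4 j 0 by rewrite !mxE.
    rewrite !(restricted_solveP clo0 SRC)//.
    have -> : (X^T *m (X *m b)) j 0 = (X^T *m y) j 0 - r j 0.
      by rewrite rE cvB; ring.
    rewrite !mxE; move: jA; rewrite inA; have [jB|jB] := boolP (j \in B).
      by move=> _; rewrite (BCf _ jB); lra.
    by move=> /= ->; lra.
  congr (X *m _); apply/eqP; rewrite -subr_eq0 -z0 /h /solve.
  move: (restricted_solve _ _ _) (restricted_solve _ _ _).
  move: (restricted_solve _ _ _) (restricted_solve _ _ _) => u1 u2 u3 u4.
  by apply/eqP/colP => j; rewrite !mxE; ring.
pose B2 := \sum_(j in B) score X y b j ^+ 2.
pose G2 := \sum_(j in C) score X y b j ^+ 2.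
pose H2 := \sum_(j in C) b j 0 ^+ 2.
have cB2 : n%:R^-1 ^+ 2 * dotv cB cB = B2.
  rewrite (dotv_supported _ cBA) BCs [X in _ + X]big1 ?addr0; last first.
    move=> j jC; rewrite mxE; case: ifPn; rewrite ?mul0r// => jB.
    by have := BCf _ jB; rewrite jC.
  rewrite /B2 mulr_sumr; apply: eq_bigr => j jB.
  by rewrite mxE jB scE exprMn -expr2.
have cC2 : n%:R^-1 ^+ 2 * dotv cC cC = G2.
  rewrite (dotv_supported _ cCA) BCs [X in X + _]big1 ?add0r; last first.
    by move=> j jB; rewrite mxE BCf// mul0r.
  rewrite /G2 mulr_sumr; apply: eq_bigr => j jC.
  by rewrite mxE jC scE exprMn -expr2.
have cBC : dotv cB cC = 0.
  rewrite /dotv big1// => j _; rewrite !mxE; case: ifPn => jB; last by rewrite mul0r.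
  by rewrite BCf// mulr0.
pose a2 := n%:R^-1 * dotv GC GC; pose b2 := n%:R^-1 * dotv GB GB.
pose w2 := n%:R^-1 * dotv W W; pose bc := n%:R^-1 * dotv GB GC.
pose cw := n%:R^-1 * dotv GC W; pose bw := n%:R^-1 * dotv GB W.
have CSn (u v : 'cV[R]_n) : (n%:R^-1 * dotv u v) ^+ 2 <= n%:R^-1 * dotv u u * (n%:R^-1 * dotv v v).
  by rewrite [leRHS]mulrACA -expr2 exprMn ler_wpM2l ?sqr_ge0// dotv_CS.
have G20 : 0 <= G2 by apply: sumr_ge0 => j _; exact: sqr_ge0.
have H20 : 0 <= H2 by apply: sumr_ge0 => j _; exact: sqr_ge0.
have hC j : j \in C -> h j 0 = b j 0.
  move=> jC; rewrite /h.
  have b0j : b0 j 0 = 0.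
    apply: supported_restricted_solve; apply/negP => jB.
    by have := BCf _ jB; rewrite jC.
  by rewrite cvB b0j subr0.
have qE : cw - bc - a2 = \sum_(j in C) b j 0 * score X y b j.
  transitivity (n%:R^-1 * dotv (X *m h) GC).
    by rewrite XhE !dotvBl /cw /bc /a2 (dotvC GC W); ring.
  rewrite /GC dotv_solve// BCs [X in X + _]big1 ?add0r; last first.
    by move=> j jB; rewrite cC0// mulr0.
  rewrite mulr_sumr; apply: eq_bigr => j jC.
  by rewrite cCE// hC// scE mulrCA.
have q0 : 0 <= cw - bc - a2.
  by rewrite qE; apply: sumr_ge0 => j _; exact: mcp_eq_sign (beq j).
have := @sparsity_quadratic R m%:R #|B|%:R clo chi gamma lam a2 b2 w2 cw bw bc G2 B2 H2.
(* The cross term is the pairing of scores and coefficients on [C]; each of its summands is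
   nonnegative, hence a product of absolute values. *)
have -> : G2 + 2 * (cw - bc - a2) / gamma + H2 / gamma ^+ 2 =
    \sum_(j in C) (`|score X y b j| + `|b j 0| / gamma) ^+ 2.
  rewrite qE /G2 /H2 mulr_sumr !mulr_suml -!big_split/=; apply: eq_bigr => j _.
  have -> : b j 0 * score X y b j = `|score X y b j| * `|b j 0|.
    by rewrite -normrM ger0_norm 1?mulrC//; exact: mcp_eq_sign (beq j).
  rewrite -[in LHS](real_normK (num_real (score X y b j))).
  rewrite -[in LHS](real_normK (num_real (b j 0))) -exprVn.
  move: (`|_|) (`|_|) (gamma^-1) => u v g; ring.
have mlam : m%:R * lam ^+ 2 <= \sum_(j in C) (`|score X y b j| + `|b j 0| / gamma) ^+ 2.
  rewrite -Cm -sum1_card natr_sum mulr_suml; apply: ler_sum => j jC.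
  rewrite mul1r ler_sqr ?nnegrE ?(ltW lam0)//; first exact: act.
  by rewrite addr_ge0// divr_ge0// ltW.
move=> H; suff : m%:R * lam ^+ 2 < m%:R * lam ^+ 2 by rewrite ltxx.
apply: (le_lt_trans mlam); apply: H => //.
- by rewrite ltr0n subn_gt0.
- by rewrite mulr_ge0// dotvv_ge0.
- by rewrite mulr_ge0// dotvv_ge0.
- by rewrite mulr_ge0// dotvv_ge0.
- exact: CSn.
- exact: CSn.
- by rewrite -cC2; have /andP[] := energy_bounds Ad cCA.
- have cBCA : supported A (cB + cC) by move=> j jA; rewrite mxE cBA// cCA// addr0.
  have /andP[_] := energy_bounds Ad cBCA.
  have -> : solve A (cB + cC) = solve A cB + solve A cC.
    by rewrite /solve /restricted_solve mulmxDr scalerDr !mulmxDr.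
  rewrite mulmxDr -/GB -/GC !dotvDl !dotvDr (dotvC cC cB) cBC (dotvC GC GB) addr0 add0r.
  rewrite mulrDr cB2 cC2 [G2 + _]addrC => /le_trans; apply.
  by rewrite le_eqVlt; apply/orP; left; apply/eqP; rewrite /a2 /b2 /bc; ring.
- by rewrite -cB2; have /andP[] := energy_bounds Ad cBA.
- rewrite -sum1_card natr_sum mulr_suml; apply: ler_sum => j _.
  rewrite mul1r -real_normK ?num_real// ler_sqr ?nnegrE ?(ltW lam0)//.
  exact: mcp_eq_norm_le (beq j).
- have /andP[+ _] := sparse_riesz_bounds SRC Ad hA.
  have -> : n%:R^-1 * dotv (X *m h) (X *m h) = w2 + a2 + b2 - 2 * cw - 2 * bw + 2 * bc.
    rewrite XhE !dotvBl !dotvBr /w2 /a2 /b2 /cw /bw /bc.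
    by rewrite (dotvC W GB) (dotvC W GC) (dotvC GC GB); ring.
  apply: le_trans; rewrite ler_wpM2l ?(ltW clo0)//.
  rewrite (dotv_supported _ hA) BCs /H2 -[leLHS]add0r; apply: lerD.
    by apply: sumr_ge0 => j _; rewrite -expr2 sqr_ge0.
  by apply: ler_sum => j jC; rewrite hC// expr2.
Qed.

(** For h = b - b0, pairing h with the difference of scores gives - |X h|^2 / n <= - clo |h|^2, and
    coordinatewise monotonicity gives at least - |h|^2 / gamma. As 1 / gamma < clo, h = 0. *)
Lemma mcp_solution_eq_lse (lam : R) (b : 'cV[R]_p) (A : {set 'I_p}) : 0 < lam ->
  (#|A| <= d)%N -> B \subset A -> supported A b ->
  (forall j, mcp_eq gamma lam (b j 0) (score X y b j)) ->
  (forall j, j \in B -> gamma * lam <= `|b0 j 0|) ->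
  (forall j, j \notin B -> `|score X y b0 j| <= lam) -> b = b0.
Proof.
move=> lam0 Ad BA bA beq Bl Bs.
have b0B : supported B b0 by exact: supported_restricted_solve.
have hA : supported A (b - b0) by apply: supportedB => //; exact: supportedS b0B.
apply/eqP; rewrite -subr_eq0 -dotvv_eq0 eq_le dotvv_ge0 andbT.
have s0 j : j \in B -> score X y b0 j = 0.
  move=> jB; rewrite /score mulmxBr.
  rewrite cvB.
  by rewrite (restricted_solveP clo0 SRC)// ?subrr ?mul0r// ltnW.
have /andP[h1 _] := sparse_riesz_bounds SRC Ad hA.
have : - (gamma^-1 * dotv (b - b0) (b - b0)) <= - (clo * dotv (b - b0) (b - b0)).
  apply: (@le_trans _ _ (- (n%:R^-1 * dotv (X *m (b - b0)) (X *m (b - b0))))); last first.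
    by rewrite lerN2.
  rewrite dotv_mulmx /dotv !mulr_sumr -!sumrN; apply: ler_sum => j _.
  have -> : - (n%:R^-1 * ((b - b0) j 0 * (X^T *m (X *m (b - b0))) j 0)) =
     (b j 0 - b0 j 0) * (score X y b j - score X y b0 j).
    rewrite /score -mulrBl.
    have -> : X^T *m (y - X *m b) = X^T *m (y - X *m b0) - X^T *m (X *m (b - b0)).
      by rewrite !mulmxBr opprB addrA subrK.
    by rewrite !cvB; ring.
  have -> : - (gamma^-1 * ((b - b0) j 0 * (b - b0) j 0)) = - (b j 0 - b0 j 0) ^+ 2 / gamma.
    by rewrite !cvB expr2 mulNr mulrC.
  apply: (mcp_eq_monotone gamma0 lam0 (beq j)).
  have [jB|jB] := boolP (j \in B); [left|right].
    by split; [exact: Bl|exact: s0].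
  by split; [exact: b0B|exact: Bs].
have gc : gamma^-1 < clo.
  rewrite -[gamma^-1]mul1r ltr_pdivrMr// mulrC; apply: (@lt_le_trans _ _ 2); first lra.
  rewrite -ler_sqr ?nnegrE ?mulr_ge0 ?(ltW gamma0) ?(ltW clo0)// exprMn.
  rewrite -(ler_pM2r chi0); apply: le_trans gam.
  have -> : 2 ^+ 2 = 4 :> R by ring.
  by rewrite lerDl ltW.
rewrite lerN2 -subr_ge0 -mulrBl; have := dotvv_ge0 (b - b0).
move: (dotv _ _) => D D0; have : 0 < clo - gamma^-1 by rewrite subr_gt0.
move: (gamma^-1) => g gc0 hD; rewrite leNgt; apply/negP => Dp.
have := mulr_gt0 gc0 Dp; nra.
Qed.

End mcp_solutions.

(** Clamping to [0, a] extends path functions to the whole line, where openness and connectedness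
    need no subspace topology. *)
Lemma cvg_clamp_within (R : realType) (f : R -> R) (a : R) : 0 <= a ->
  {within `[0, +oo[, continuous f} -> continuous (fun x : R => f (Num.min a (Num.max 0 x))).
Proof.
move=> a0 /subspace_continuousP fc x; set c := fun z : R => Num.min a (Num.max 0 z).
have cA z : `[0, +oo[%classic (c z).
  by rewrite /= in_itv/= andbT /c le_min a0 le_max lexx.
have cc : c z @[z --> x] --> c x.
  apply: continuous_min; first exact: cvg_cst.
  by apply: continuous_max; [exact: cvg_cst|exact: cvg_id].
apply: cvg_trans (fc _ (cA x)).
move=> U /= /cc h; apply: (@filterS _ (nbhs x) _ _ _ _ h) => z.
by apply; exact: cA.
Qed.

(** * Sparsity along the path and the selected point *)

Section path.
Context {R : realType}.
Variables (n p : nat) (X : 'M[R]_(n, p)) (y : 'cV[R]_n) (d : nat) (clo chi gamma : R).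
Hypotheses (n0 : (0 < n)%N) (clo0 : 0 < clo) (cc : clo <= chi) (SRC : sparse_riesz X d clo chi).
Hypotheses (gamma0 : 0 < gamma) (gam : 4 * chi + clo <= gamma ^+ 2 * clo ^+ 2 * chi).
Variable B : {set 'I_p}.
Hypothesis Bd : (#|B| < d)%N.
Hypothesis dB : #|B|%:R * (2 * chi - clo) <= 2 * (d - #|B|)%N%:R * clo.
Local Notation m := (d - #|B|)%N.
Local Notation b0 := (restricted_solve X B (X^T *m y)).
Variables lam1 lam2 : R.
Hypotheses (lam1_gt0 : 0 < lam1) (lam12 : lam1 <= lam2).
Hypothesis signal : forall j, j \in B -> gamma * lam2 < `|b0 j 0|.
Hypothesis noise : forall j, j \notin B -> `|score X y b0 j| < lam1.
Hypothesis gap : forall C : {set 'I_p}, (forall j, j \in B -> j \notin C) -> #|C| = m ->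
  n%:R^-1 * dotv (lse_gap X y B (B :|: C)) (lse_gap X y B (B :|: C)) <=
    m%:R * lam2 ^+ 2 / (4 * chi).

Let supp (b : 'cV[R]_p) := [set j | (j \notin B) && (b j 0 != 0)]%SET.
(** Unlike membership in the support, this is a closed condition in (lam, b): an index that fails it
    keeps failing it nearby, and so cannot enter the support of a nearby solution. *)
Let near_active lam (b : 'cV[R]_p) :=
  [set j | (j \notin B) && (lam <= `|score X y b j| + `|b j 0| / gamma)]%SET.

Let eq_lse lam (b : 'cV[R]_p) : lam1 <= lam <= lam2 ->
  (forall j, mcp_eq gamma lam (b j 0) (score X y b j)) -> (#|supp b| <= m)%N -> b = b0.
Proof.
move=> /andP[l1 l2] beq bm.
apply: (@mcp_solution_eq_lse R n p X y d clo chi gamma n0 clo0 cc SRC gamma0 gam B Bd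
  lam b (B :|: supp b)) => //.
- exact: lt_le_trans l1.
- apply: leq_trans (leq_card_setU _ _) _.
  by rewrite -(subnKC (ltnW Bd)) leq_add2l.
- exact: finset.subsetUl.
- by move=> j; rewrite !inE negb_or negb_and => /andP[/negbTE -> /=]; rewrite negbK => /eqP.
- by move=> j jB; apply: le_trans (ltW (signal jB)); rewrite ler_pM2l.
- by move=> j jB; exact: le_trans (ltW (noise jB)) l1.
Qed.

(** Up to [lam2] uniqueness makes [b] the oracle, which has no such index because its scores off [B]
    are below [lam1]. Above [lam2] the gap bound applies and [no_active_set] excludes m indices. *)
Lemma card_near_active_lt lam (b : 'cV[R]_p) : lam1 <= lam ->
  (forall j, mcp_eq gamma lam (b j 0) (score X y b j)) -> (#|supp b| <= m)%N ->
  (#|near_active lam b| < m)%N.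
Proof.
move=> l1 beq bm; have lam0 : 0 < lam by exact: lt_le_trans l1.
have m0 : (0 < m)%N by rewrite subn_gt0.
have [l2|l2] := leP lam lam2.
  have bE : b = b0 by apply: (@eq_lse lam) => //; rewrite l1 l2.
  rewrite [near_active _ _](_ : _ = finset.set0) ?cards0//.
  apply/setP => j; rewrite !inE; apply/negbTE/negP => /andP[jB].
  have -> : b j 0 = 0 by rewrite bE; exact: supported_restricted_solve.
  rewrite normr0 mul0r addr0 bE leNgt (lt_le_trans _ l1)//.
  exact: noise.
rewrite ltnNge; apply/negP => mS.
have SS : supp b \subset near_active lam b.
  apply/fintype.subsetP => j; rewrite !inE => /andP[-> bj] /=.
  exact: mcp_eq_active bj.
(* [C] must contain the whole support off [B], have exactly m elements, and consist of near-active
   indices: the support is enlarged within [near_active]. *)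
have [C [SC CS Cm]] : exists C : {set 'I_p},
    [/\ supp b \subset C, C \subset near_active lam b & #|C| = m].
  have [s [sS us sz]] : exists s : seq 'I_p,
      [/\ {subset s <= near_active lam b :\: supp b}%SET, uniq s & size s = (m - #|supp b|)%N].
    exists (take (m - #|supp b|) (enum (near_active lam b :\: supp b)%SET)); split.
    - by move=> j /mem_take; rewrite mem_enum.
    - by rewrite take_uniq// enum_uniq.
    - rewrite size_take -cardE cardsD (finset.setIidPr SS) ltn_neqAle leq_sub2r// andbT.
      by case: eqP.
  exists (supp b :|: [set j in s])%SET; split.
  - exact: finset.subsetUl.
  - rewrite finset.subUset SS/=; apply/fintype.subsetP => j; rewrite inE => /sS.
    by rewrite inE => /andP[].
  - rewrite cardsU (_ : supp b :&: _ = finset.set0)%SET; last first.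
      apply/setP => j; rewrite !inE; apply/negbTE/negP => /andP[jb /sS].
      by rewrite !inE jb.
    have -> : #|[set j in s]%SET| = size s by rewrite cardsE; exact/card_uniqP.
    by rewrite cards0 subn0 sz subnKC.
have BC j : j \in B -> j \notin C.
  by move=> jB; apply/negP => /(fintype.subsetP CS); rewrite inE jB.
apply: (@no_active_set R n p X y d clo chi gamma n0 clo0 cc SRC gamma0 gam B Bd dB lam b C) => //.
- move=> j; rewrite inE negb_or => /andP[jB jC]; apply/eqP; apply: contraNT jC => bj.
  by apply: (fintype.subsetP SC); rewrite inE jB.
- apply: le_trans (gap BC Cm) _.
  rewrite ler_pM2r ?invr_gt0 ?mulr_gt0//; last exact: lt_le_trans cc.
  rewrite ler_wpM2l// ler_sqr ?nnegrE ?(ltW lam0) ?(ltW l2)//.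
  by rewrite (le_trans (ltW lam1_gt0)).
- by move=> j /(fintype.subsetP CS); rewrite inE => /andP[].
Qed.

Variables (lam : R -> R) (b : R -> 'cV[R]_p).
Hypothesis pathb : solution_path (mcp gamma) X y lam b.

Let pathb_eq x : 0 <= x -> 0 < lam x ->
  forall j, mcp_eq gamma (lam x) (b x j 0) (score X y (b x) j).
Proof. by case: pathb => _ _ h _ _ x0 l0; exact: mcp_estimating (h _ x0). Qed.

Lemma path_card_supp (a : R) : 0 <= a -> (forall x, 0 <= x <= a -> lam1 <= lam x) ->
  forall x, 0 <= x <= a -> (#|supp (b x)| <= m)%N.
Proof.
move=> a0 al; case: pathb => lamc bc _ b00 _.
pose c (z : R) := Num.min a (Num.max 0 z).
have c0 z : 0 <= c z <= a by rewrite le_min a0 le_max lexx/= ge_min lexx.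
have lc : continuous (fun z => lam (c z)) by exact: cvg_clamp_within.
have bcc j : continuous (fun z => b (c z) j 0) by exact: (cvg_clamp_within a0 (bc j)).
have sc j : continuous (fun z => score X y (b (c z)) j).
  move=> z; apply: (@cvgM _ _ _ _ _ _ _ (n%:R^-1)); last exact: cvg_cst.
  have E v : (X^T *m (y - X *m v)) j 0 = (X^T *m y) j 0 - \sum_k (X^T *m X) j k * v k 0.
    by rewrite mulmxBr mulmxA !mxE.
  rewrite E; under eq_cvg do rewrite E.
  apply: cvgB; first exact: cvg_cst.
  apply: cvg_bigsum => k; apply: cvgM; first exact: cvg_cst.
  exact: bcc.
pose N := [set z | (#|supp (b (c z))| <= m)%N].
have cz z : lam1 <= lam (c z) by exact/al/c0.
have ceq z : forall j, mcp_eq gamma (lam (c z)) (b (c z) j 0) (score X y (b (c z)) j).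
  apply: pathb_eq; first by have /andP[] := c0 z.
  exact: lt_le_trans (cz z).
have Nopen : open N.
  rewrite openE => z Nz; rewrite /interior.
  have Sz := card_near_active_lt (cz z) (ceq z) Nz.
  have : \forall t \near z, forall j,
      j \notin near_active (lam (c z)) (b (c z)) -> j \notin supp (b (c t)).
    apply: (@filter_forall _ _ (fun j t => j \notin near_active (lam (c z)) (b (c z)) ->
      j \notin supp (b (c t))) (nbhs z) (nbhs_filter z)) => j.
    have [jS|jS] := boolP (j \in near_active (lam (c z)) (b (c z))); first by apply: nearW.
    have [jB|jB] := boolP (j \in B); first by apply: nearW => t _; rewrite inE jB.
    move: jS; rewrite inE jB/= -ltNge => jS.
    have fc : (lam (c t) - (`|score X y (b (c t)) j| + `|b (c t) j 0| / gamma)) @[t --> z] -->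
        (lam (c z) - (`|score X y (b (c z)) j| + `|b (c z) j 0| / gamma)).
      apply: cvgB; first exact: lc.
      apply: cvgD; first by apply: cvg_norm; exact: sc.
      by apply: cvgM; [apply: cvg_norm; exact: bcc|exact: cvg_cst].
    have f0 : 0 < lam (c z) - (`|score X y (b (c z)) j| + `|b (c z) j 0| / gamma).
      by rewrite subr_gt0.
    apply: filterS (cvgr_gt _ fc _ f0) => t; rewrite subr_gt0 => ht _.
    rewrite inE jB/=; apply/negP => bj.
    by have := mcp_eq_active (ceq t j) bj; rewrite leNgt ht.
  apply: filterS => t ht; apply: leq_trans (ltnW Sz).
  by apply/subset_leq_card/fintype.subsetP => j; apply: contraLR; exact: ht.
have Nclosed : closed N.
  rewrite -openC openE => z /negP; rewrite -ltnNge => Nz; rewrite /interior.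
  have : \forall t \near z, forall j, j \in supp (b (c z)) -> j \in supp (b (c t)).
    apply: (@filter_forall _ _ (fun j t => j \in supp (b (c z)) -> j \in supp (b (c t)))
      (nbhs z) (nbhs_filter z)) => j.
    have [jS|jS] := boolP (j \in supp (b (c z))); last by apply: nearW.
    move: jS; rewrite inE => /andP[jB bj].
    have fc : `|b (c t) j 0| @[t --> z] --> `|b (c z) j 0| by apply: cvg_norm; exact: bcc.
    have f0 : 0 < `|b (c z) j 0| by rewrite normr_gt0.
    apply: filterS (cvgr_gt _ fc _ f0) => t ht _.
    by rewrite inE jB/= -normr_gt0.
  apply: filterS => t ht; apply/negP; rewrite -ltnNge; apply: (leq_trans Nz).
  by apply/subset_leq_card/fintype.subsetP => j; exact: ht.
have NT : N = setT.
  have : connected [set: R] by apply/connected_intervalP => u v _ _ w _.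
  apply.
  - exists 0; rewrite /N/= /c max_l// min_r// b00.
    rewrite [supp _](_ : _ = finset.set0) ?cards0//.
    by apply/setP => j; rewrite !inE mxE eqxx andbF.
  - by exists N => //; rewrite setTI.
  - by exists N => //; rewrite setTI.
move=> x /andP[x0 xa]; have : N x by rewrite NT.
by rewrite /N/= /c max_r// min_r.
Qed.

(** The penalty level need not be monotone along the path. At the first point [a] where it reaches
    [l] it equals [l], and before [a] it is larger, so the sparsity bound covers [0, a]. *)
Lemma path_selector_eq_lse l : lam1 <= l <= lam2 -> path_selector lam b l = b0.
Proof.
move=> /andP[l1 l2]; have l0 : 0 < l by exact: lt_le_trans l1.
have [lamc bc beq b00 lim] := pathb.
rewrite /path_selector; set E := [set x | _].
have E0 : has_inf E.
  split; last by exists 0 => x [].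
  have : \forall x \near +oo, lam x < l by apply: (cvgr_lt _ lim).
  move=> [M [_ hM]]; exists (Num.max 0 (M + 1)); split; first by rewrite le_max lexx.
  by apply/ltW/hM; rewrite lt_max ltrDl ltr01 orbT.
set a := inf E.
have a0 : 0 <= a by apply: lb_le_inf; [case: E0|move=> x []].
have below x : 0 <= x -> x < a -> l < lam x.
  move=> x0 xa; rewrite ltNge; apply/negP => lx.
  have : a <= x by apply: ge_inf; [case: E0|split].
  by rewrite leNgt xa.
(* Clamping at a + 1 leaves room on the right of [a], as both one-sided comparisons are needed. *)
pose c (z : R) := Num.min (a + 1) (Num.max 0 z).
have cE x : 0 <= x <= a + 1 -> c x = x.
  by move=> /andP[x0 xa]; rewrite /c max_r// min_r.
have ca : c a = a by rewrite cE// a0/= lerDl.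
have lc : (lam (c z)) @[z --> a] --> lam a.
  have a10 : 0 <= a + 1 by rewrite addr_ge0.
  have : lam (c z) @[z --> a] --> lam (c a) by exact: (cvg_clamp_within a10 lamc).
  by rewrite ca.
have la : lam a <= l.
  rewrite leNgt; apply/negP => /(cvgr_gt _ lc)[e /= e0 he].
  (* If the level exceeded [l] at [a], it would do so up to a + min (e, 1), a larger lower bound of
     [E]; the minimum with 1 stays where clamping is the identity. *)
  have : a + Num.min e 1 <= a.
    apply: lb_le_inf; first by case: E0.
    move=> x [x0 xl]; rewrite leNgt; apply/negP => xa.
    have ax : a <= x by apply: ge_inf; [case: E0|split].
    have : l < lam (c x).
      apply: he; rewrite /= distrC ger0_norm ?subr_ge0// ltrBlDl.
      by apply: lt_le_trans xa _; rewrite lerD2l ge_min lexx.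
    rewrite cE ?x0/=; first by rewrite ltNge xl.
    by apply: le_trans (ltW xa) _; rewrite lerD2l ge_min lexx orbT.
  by rewrite leNgt ltrDl lt_min e0 ltr01.
have [z0|an0] := eqVneq a 0.
  (* The path may start below the level l, but b = 0 still solves the equation there. *)
  rewrite z0 b00; apply: (@eq_lse l); rewrite ?l1 ?l2//.
    move=> j; split; rewrite mxE ?eqxx// => _.
    have := beq 0 (lexx 0) j; rewrite b00 mxE => -[_ /(_ erefl)] h.
    by apply: le_trans h _; rewrite -z0.
  rewrite [supp _](_ : _ = finset.set0) ?cards0//.
  by apply/setP => j; rewrite !inE mxE eqxx andbF.
have ap : 0 < a by rewrite lt_def an0.
have al : l <= lam a.
  rewrite leNgt; apply/negP => /(cvgr_lt _ lc)[e /= e0 he].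
  pose x := Num.max 0 (a - e / 2).
  have xa : x < a by rewrite gt_max ap/= ltrBlDr ltrDl divr_gt0.
  have x0 : 0 <= x by rewrite le_max lexx.
  have : lam (c x) < l.
    apply: he; rewrite /= ger0_norm ?subr_ge0 ?(ltW xa)// ltrBlDr -ltrBlDl.
    rewrite lt_max; apply/orP; right; rewrite ltrD2l ltrN2 ltr_pdivrMr//.
    by rewrite mulr_natr mulr2n ltrDl.
  rewrite cE; first by rewrite ltNge (ltW (below x x0 xa)).
  by rewrite x0/= (le_trans (ltW xa))// lerDl.
have lE : lam a = l by apply/eqP; rewrite eq_le la al.
apply: (@eq_lse l); first by rewrite l1 l2.
  by rewrite -lE; apply: pathb_eq => //; rewrite lE.
apply: (@path_card_supp a) => //; last by rewrite a0 lexx.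
move=> x /andP[x0]; rewrite le_eqVlt => /orP[/eqP ->|xa]; first by rewrite lE.
by apply: le_trans l1 (ltW (below x x0 xa)).
Qed.
End path.

(** * Least squares projections of the noise *)

Section projections.
Context {R : realType}.
Variables (n p : nat) (X : 'M[R]_(n, p)) (d : nat) (clo chi : R).
Hypotheses (n0 : (0 < n)%N) (clo0 : 0 < clo) (SRC : sparse_riesz X d clo chi).

(** Orthogonal projection P_A of [e] onto the span of the columns in [A], under the Riesz
    condition. *)
Definition lse_fit (A : {set 'I_p}) (e : 'cV[R]_n) : 'cV[R]_n :=
  X *m restricted_solve X A (X^T *m e).

Lemma restricted_solveD A (c1 c2 : 'cV[R]_p) :
  restricted_solve X A (c1 + c2) = restricted_solve X A c1 + restricted_solve X A c2.
Proof. by rewrite /restricted_solve !mulmxDr scalerDr !mulmxDr. Qed.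

Lemma eq_restricted_solve (A : {set 'I_p}) (c1 c2 : 'cV[R]_p) :
  (forall j, j \in A -> c1 j 0 = c2 j 0) -> restricted_solve X A c1 = restricted_solve X A c2.
Proof.
move=> c12; rewrite /restricted_solve (_ : (emb A)^T *m c1 = (emb A)^T *m c2)//.
by apply/colP => i; rewrite !tr_emb_mul c12// enum_valP.
Qed.

Lemma restricted_solve_gram (A : {set 'I_p}) (h : 'cV[R]_p) : (#|A| <= d)%N -> supported A h ->
  restricted_solve X A (X^T *m (X *m h)) = h.
Proof.
move=> Ad hA; apply/eqP; rewrite -subr_eq0; apply/eqP.
apply: (supported_orth_eq0 clo0 SRC n0 Ad).
  by apply: supportedB hA; exact: supported_restricted_solve.
move=> j jA; rewrite !mulmxBr !mxE; apply/eqP; rewrite subr_eq0; apply/eqP.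
have := restricted_solveP clo0 SRC (X^T *m (X *m h)) n0 Ad jA.
by rewrite !mxE.
Qed.

Lemma dotv_restricted_solve (A : {set 'I_p}) (h c : 'cV[R]_p) : (#|A| <= d)%N -> supported A h ->
  dotv (X *m h) (X *m restricted_solve X A c) = dotv h c.
Proof.
move=> Ad hA; rewrite dotv_mulmx !(dotv_supported _ hA).
by apply: eq_bigr => j jA; rewrite (restricted_solveP clo0 SRC).
Qed.

Lemma dotv_lse_fit (A : {set 'I_p}) (h : 'cV[R]_p) (e : 'cV[R]_n) : (#|A| <= d)%N ->
  supported A h -> dotv (X *m h) (lse_fit A e) = dotv (X *m h) e.
Proof. by move=> Ad hA; rewrite dotv_restricted_solve// dotv_mulmx. Qed.

Lemma dotv_lse_fitl (A : {set 'I_p}) (u e : 'cV[R]_n) : (#|A| <= d)%N ->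
  dotv (lse_fit A u) e = dotv u (lse_fit A e).
Proof.
move=> Ad; have sA c := @supported_restricted_solve _ _ _ X A c.
by rewrite [RHS]dotvC -(dotv_lse_fit _ Ad (sA _)) -(dotv_lse_fit u Ad (sA _)) dotvC.
Qed.

Lemma lse_fit_id (A : {set 'I_p}) (h : 'cV[R]_p) : (#|A| <= d)%N -> supported A h ->
  lse_fit A (X *m h) = X *m h.
Proof. by move=> Ad hA; rewrite /lse_fit restricted_solve_gram. Qed.

Lemma dotv_lse_fit_id (A : {set 'I_p}) (e : 'cV[R]_n) : (#|A| <= d)%N ->
  dotv (lse_fit A e) (lse_fit A e) = dotv (lse_fit A e) e.
Proof. by move=> Ad; rewrite dotv_lse_fit//; exact: supported_restricted_solve. Qed.

(** The coefficient is the pairing of [e] with X v, where v solves the normal equations for the j-th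
    coordinate vector. Then |X v|^2 = v_j, a diagonal entry of the inverse Gram matrix over n. *)
Lemma coef_restricted_solve (A : {set 'I_p}) j : (#|A| <= d)%N -> j \in A ->
  exists c : 'cV[R]_n, [/\ dotv c c <= n%:R^-1 * max_diag_inv_gram X A, 0 < dotv c c &
    forall e, restricted_solve X A (X^T *m e) j 0 = dotv c e].
Proof.
move=> Ad jA; pose v := restricted_solve X A (delta_mx j 0).
have vA : supported A v by exact: supported_restricted_solve.
have dotd (h : 'cV[R]_p) : dotv h (delta_mx j 0) = h j 0.
  by rewrite /dotv (bigD1 j)//= mxE !eqxx mulr1 big1 ?addr0// => k /negbTE kj; rewrite mxE kj mulr0.
have vv : dotv (X *m v) (X *m v) = v j 0 by rewrite dotv_restricted_solve// dotd.
have [i ji] : exists i : 'I_#|A|, enum_val i = j.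
  by exists (enum_rank_in jA j); rewrite enum_rankK_in.
have vj : v j 0 = n%:R^-1 * invmx (gram X A) i i.
  have E (w : 'cV[R]_#|A|) : (emb A *m w) j 0 = w i 0 by rewrite -ji emb_mul_val.
  rewrite /v /restricted_solve E -scalemxAr mxE; congr (_ * _).
  have D (k : 'I_#|A|) : ((emb A)^T *m (delta_mx j 0 : 'cV[R]_p)) k 0 = (k == i)%:R.
    by rewrite tr_emb_mul mxE eqxx andbT -ji (inj_eq enum_val_inj).
  rewrite mxE (bigD1 i)//= D eqxx mulr1 big1 ?addr0// => k /negbTE ki.
  by rewrite D ki mulr0.
exists (X *m v); split.
- rewrite vv vj ler_wpM2l// /max_diag_inv_gram.
  by rewrite (bigD1 i)//= le_max lexx.
- rewrite lt_neqAle dotvv_ge0 andbT eq_sym dotvv_eq0; apply/eqP => Xv0.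
  have := restricted_solveP clo0 SRC (delta_mx j 0) n0 Ad jA.
  by rewrite -/v Xv0 mulmx0 !mxE !eqxx => /esym/eqP; rewrite oner_eq0.
- move=> e; rewrite -(dotv_lse_fit _ Ad vA) /lse_fit dotvC dotv_restricted_solve ?dotd//.
  exact: supported_restricted_solve.
Qed.

Variables (beta : 'cV[R]_p) (B : {set 'I_p}).
Hypotheses (Bd : (#|B| <= d)%N) (betaB : supported B beta).

Lemma restricted_solve_response (e : 'cV[R]_n) :
  restricted_solve X B (X^T *m (X *m beta + e)) = beta + restricted_solve X B (X^T *m e).
Proof. by rewrite mulmxDr restricted_solveD restricted_solve_gram. Qed.

(** The mean X beta is fitted exactly, which leaves the pairing of the noise with (x_j - P_B x_j) /
    n; a projection does not increase the squared length n of x_j. *)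
Lemma score_lse_response j : dotv (col j X) (col j X) = n%:R ->
  exists2 a : 'cV[R]_n, dotv a a <= n%:R^-1 &
    forall e, let y := X *m beta + e in
      score X y (restricted_solve X B (X^T *m y)) j = dotv a e.
Proof.
move=> xj; set x := col j X.
exists (n%:R^-1 *: (x - lse_fit B x)).
  rewrite dotvZl dotvZr dotvBl !dotvBr xj -(dotvC (lse_fit B x)) dotv_lse_fit_id//.
  rewrite subrr subr0 mulrA -expr2.
  have : 0 <= dotv (lse_fit B x) x by rewrite -dotv_lse_fit_id// dotvv_ge0.
  move: (dotv _ _) => D D0; rewrite mulrBr -[leRHS]subr0 lerB//.
    by rewrite expr2 -mulrA mulVf ?mulr1// pnatr_eq0 -lt0n.
  by rewrite mulr_ge0// sqr_ge0.
move=> e /=; rewrite restricted_solve_response /score mulrC dotvZl.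
congr (_ * _); rewrite [X *m (beta + _)]mulmxDr opprD addrACA subrr add0r.
rewrite -/(lse_fit B e) dotvBl dotv_lse_fitl// -dotvBr.
by rewrite /dotv mxE; apply: eq_bigr => i _; rewrite !mxE.
Qed.

Lemma lse_gap_response (C : {set 'I_p}) (e : 'cV[R]_n) : (#|B :|: C| <= d)%N ->
  lse_gap X (X *m beta + e) B (B :|: C) = lse_fit (B :|: C) e - lse_fit B e.
Proof.
move=> Ad; rewrite /lse_gap restricted_solve_response [X^T *m _]mulmxDr restricted_solveD.
rewrite restricted_solve_gram//; last by apply: supportedS betaB; exact: finset.subsetUl.
by rewrite opprD addrACA subrr add0r mulmxBr.
Qed.

(** P_A - P_B is itself an orthogonal projection because the column spaces are nested. *)
Lemma dotv_lse_gap (C : {set 'I_p}) (e : 'cV[R]_n) : (#|B :|: C| <= d)%N ->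
  let W := lse_fit (B :|: C) e - lse_fit B e in dotv W W = dotv W e.
Proof.
move=> Ad /=; set A := B :|: C in Ad *.
have BA : supported A (restricted_solve X B (X^T *m e)).
  by apply: supportedS (@supported_restricted_solve _ _ _ X B _); exact: finset.subsetUl.
have h : dotv (lse_fit B e) (lse_fit A e) = dotv (lse_fit B e) e by exact: dotv_lse_fit.
rewrite !dotvBl !dotvBr (dotvC (lse_fit A e) (lse_fit B e)) h.
by rewrite !dotv_lse_fit_id// subrr subr0.
Qed.

(** As P_B P_A = P_B, the gap is (I - P_B) P_A e, and I - P_B kills the columns in [B]. Only the |C|
    fixed columns of (I - P_B) X_C remain, whence m degrees of freedom. *)
Lemma lse_gap_span (C : {set 'I_p}) : (forall j, j \in B -> j \notin C) ->
  (#|B :|: C| <= d)%N -> exists V : 'M[R]_(n, #|C|), forall e, exists c : 'cV[R]_#|C|,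
  lse_fit (B :|: C) e - lse_fit B e = V *m c.
Proof.
move=> BC Ad; set A := B :|: C in Ad *.
pose F := X *m (emb B *m (invmx (gram X B) *m (n%:R^-1 *: ((emb B)^T *m X^T)))).
have FE u : lse_fit B u = F *m u.
  by rewrite /F /lse_fit /restricted_solve -!mulmxA -scalemxAl -!mulmxA.
exists (X *m emb C - F *m (X *m emb C)) => e.
pose h := restricted_solve X A (X^T *m e).
have hA : supported A h by exact: supported_restricted_solve.
pose hC := emb C *m ((emb C)^T *m h).
have hB : supported B (h - hC).
  move=> j jB; have -> (u v : 'cV[R]_p) : (u - v) j 0 = u j 0 - v j 0 by rewrite !mxE.
  have [jC|jC] := boolP (j \in C); last first.
    by rewrite hA ?inE ?(negbTE jB) ?(negbTE jC)// [hC j 0]supported_emb// subr0.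
  have [i ji] : exists i : 'I_#|C|, enum_val i = j.
    by exists (enum_rank_in jC j); rewrite enum_rankK_in.
  by rewrite -ji /hC emb_mul_val tr_emb_mul subrr.
exists ((emb C)^T *m h).
have -> : lse_fit B e = lse_fit B (lse_fit A e).
  rewrite /lse_fit; congr (X *m _); apply: eq_restricted_solve => j jB.
  by rewrite (restricted_solveP clo0 SRC)// inE jB.
have -> : lse_fit A e = X *m (h - hC) + X *m hC by rewrite -mulmxDr subrK.
rewrite [lse_fit B (_ + _)]FE [F *m (_ + _)]mulmxDr -!FE lse_fit_id//.
rewrite opprD addrACA subrr add0r FE.
by rewrite mulmxBl -!mulmxA.
Qed.

End projections.

Lemma card_le_sample_size (R : realType) n p (X : 'M[R]_(n, p)) d (clo chi : R) (A : {set 'I_p}) :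
  0 < clo -> sparse_riesz X d clo chi -> (#|A| <= d)%N -> (#|A| <= n)%N.
Proof.
move=> clo0 SRC Ad; have := gram_unit clo0 SRC Ad.
rewrite -row_free_unit -row_leq_rank => /leq_trans; apply.
rewrite gramE; apply: leq_trans (mxrank_scale _ _) _.
by apply: leq_trans (mxrankM_maxr _ _) _; exact: rank_leq_row.
Qed.

(** * Exceptional events and union bounds for the noise *)

Section holds_outside.
Context {R : realType} d (T : measurableType d) (P : probability T R).

(** Only the exceptional event has to be measurable, not [Q]: this accommodates the existence of a
    path, known almost everywhere. *)
Definition holds_outside (q : R) (Q : T -> Prop) : Prop :=
  exists E : set T, [/\ measurable E, (P E <= q%:E)%E & forall w, ~ E w -> Q w].

Lemma holds_outsideS q (Q Q' : T -> Prop) : (forall w, Q w -> Q' w) ->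
  holds_outside q Q -> holds_outside q Q'.
Proof. by move=> QQ [E [mE PE EQ]]; exists E; split=> // w /EQ/QQ. Qed.

Lemma holds_outsideI q q' (Q Q' : T -> Prop) : holds_outside q Q -> holds_outside q' Q' ->
  holds_outside (q + q') (fun w => Q w /\ Q' w).
Proof.
move=> [E [mE PE EQ]] [E' [mE' PE' EQ']]; exists (E `|` E'); split.
- exact: measurableU.
- rewrite EFinD; apply: le_trans (leeD PE PE').
  exact: measureU2.
- by move=> w; rewrite /setU/= => /not_orP[/EQ ? /EQ' ?].
Qed.

Lemma holds_outside_forall (I : finType) (A : pred I) q (Q : I -> T -> Prop) : 0 <= q ->
  (forall i, A i -> holds_outside q (Q i)) ->
  holds_outside (#|A|%:R * q) (fun w => forall i, A i -> Q i w).
Proof.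
move=> q0 h; rewrite cardE.
suff: holds_outside ((size (enum A))%:R * q) (fun w => forall i, i \in enum A -> Q i w).
  by apply: holds_outsideS => w hw i Ai; apply: hw; rewrite mem_enum.
have : forall i, i \in enum A -> holds_outside q (Q i) by move=> i; rewrite mem_enum; exact: h.
elim: (enum A) => [_|i s IH hs] /=.
  by exists set0; split=> //; rewrite measure0 mul0r.
have hs' j : j \in s -> holds_outside q (Q j) by move=> js; apply: hs; rewrite inE js orbT.
have := holds_outsideI (hs i (mem_head _ _)) (IH hs').
rewrite -[X in X + _]mul1r -mulrDl -natr1 addrC.
apply: holds_outsideS => w [Qi Qs] j; rewrite inE => /orP[/eqP ->//|]; exact: Qs.
Qed.

Lemma holds_outside_sub q (E : set T) (Q : T -> Prop) : measurable E -> (P E <= q%:E)%E ->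
  (forall w, ~ E w -> Q w) -> holds_outside q Q.
Proof. by exists E. Qed.

End holds_outside.

Definition normal_tail_bound {R : realType} (u : R) : R := expR (- u ^+ 2 / 2) / (2 * u).

Section noise_events.
Context {R : realType} dT (T : measurableType dT) (P : probability T R).
Variables (n p : nat) (X : 'M[R]_(n, p)) (d : nat) (clo chi sigma : R).
Hypotheses (n0 : (0 < n)%N) (clo0 : 0 < clo) (cc : clo <= chi) (SRC : sparse_riesz X d clo chi).
Hypothesis sigma0 : 0 < sigma.
Variable Z : 'I_n -> {RV P >-> R}.
Hypothesis iZ : iid_normal sigma Z.

Let noise w : 'cV[R]_n := \col_i Z i w.

Let nn0 : 0 < n%:R :> R. Proof. by rewrite ltr0n. Qed.

Let dotv_noise a w : dotv a (noise w) = \sum_k a k 0 * Z k w.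
Proof. by apply: eq_bigr => k _; rewrite mxE. Qed.

Lemma measurable_dotv_noise (a : 'cV[R]_n) : measurable_fun setT (fun w => dotv a (\col_i Z i w)).
Proof.
under eq_fun do rewrite dotv_noise.
apply: measurable_sum => k; apply: measurable_funM => //.
Qed.

Lemma dotv_noise_gt (a : 'cV[R]_n) (c u : R) : 0 < c -> 0 < u -> dotv a a <= c ^+ 2 ->
  holds_outside P (normal_tail_bound u) (fun w => - (c * (u * sigma)) < dotv a (noise w)).
Proof.
move=> c0 u0 ac.
have ac' : \sum_k a k 0 ^+ 2 <= c ^+ 2 by rewrite (eq_bigr (fun k => a k 0 * a k 0)).
have := linear_form_le_tail sigma0 iZ n0 c0 u0 ac' => h.
apply: (holds_outside_sub _ h) => [|w /=].
  rewrite (_ : [set w | _] = (fun w => dotv a (noise w)) @^-1` `]-oo, - (c * (u * sigma))]%classic).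
    by rewrite -[X in measurable X]setTI; apply: measurable_dotv_noise => //; exact: measurable_itv.
  by apply/seteqP; split=> w /=; rewrite in_itv/= dotv_noise.
by move/negP; rewrite -ltNge dotv_noise.
Qed.

Lemma dotv_noise_norm_lt (a : 'cV[R]_n) (c u : R) : 0 < c -> 0 < u -> dotv a a <= c ^+ 2 ->
  holds_outside P (2 * normal_tail_bound u) (fun w => `|dotv a (noise w)| < c * (u * sigma)).
Proof.
move=> c0 u0 ac.
have aN : dotv (- a) (- a) <= c ^+ 2 by rewrite dotvNl dotvNr opprK.
rewrite mulr_natl mulr2n.
have := holds_outsideI (dotv_noise_gt c0 u0 ac) (dotv_noise_gt c0 u0 aN).
apply: holds_outsideS => w [h1 h2].
by rewrite ltr_norml h1/=; move: h2; rewrite dotvNl ltrN2.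
Qed.

Variables (beta : 'cV[R]_p) (B : {set 'I_p}).
Hypotheses (Bd : (#|B| < d)%N) (betaB : supported B beta).

Let y w : 'cV[R]_n := X *m beta + noise w.
Let b0 w := restricted_solve X B (X^T *m y w).

Lemma score_lt_outside (u : R) j : 0 < u -> dotv (col j X) (col j X) = n%:R ->
  holds_outside P (2 * normal_tail_bound u)
    (fun w => `|score X (y w) (b0 w) j| < Num.sqrt n%:R^-1 * (u * sigma)).
Proof.
move=> u0 xj; have [a aa aE] := score_lse_response n0 clo0 SRC (ltnW Bd) betaB xj.
have c0 : 0 < Num.sqrt (n%:R^-1 : R) by rewrite sqrtr_gt0 invr_gt0.
have ac : dotv a a <= Num.sqrt n%:R^-1 ^+ 2 by rewrite sqr_sqrtr// invr_ge0 ltW.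
by apply: holds_outsideS (dotv_noise_norm_lt c0 u0 ac) => w; rewrite -aE.
Qed.

(** The sign of beta_j is known, so one tail is enough, against two for the scores. *)
Lemma signal_gt_outside (u tau : R) j : 0 < u -> j \in B ->
  tau + Num.sqrt (n%:R^-1 * max_diag_inv_gram X B) * (u * sigma) <= `|beta j 0| ->
  holds_outside P (normal_tail_bound u) (fun w => tau < Num.sg (beta j 0) * b0 w j 0).
Proof.
move=> u0 jB hb; have [c [cc1 cc2 cE]] := coef_restricted_solve n0 clo0 SRC (ltnW Bd) jB.
have w0 : 0 < n%:R^-1 * max_diag_inv_gram X B by exact: lt_le_trans cc1.
have c0 : 0 < Num.sqrt (n%:R^-1 * max_diag_inv_gram X B) by rewrite sqrtr_gt0.
have ac : dotv (Num.sg (beta j 0) *: c) (Num.sg (beta j 0) *: c) <=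
    Num.sqrt (n%:R^-1 * max_diag_inv_gram X B) ^+ 2.
  rewrite sqr_sqrtr ?(ltW w0)// dotvZl dotvZr mulrA -expr2 sqr_sg.
  by case: (_ != 0); rewrite ?mul1r// mul0r ltW.
apply: holds_outsideS (dotv_noise_gt c0 u0 ac) => w h.
have -> : b0 w j 0 = beta j 0 + dotv c (noise w).
  rewrite -cE /b0 /y (restricted_solve_response n0 clo0 SRC (ltnW Bd) betaB) [LHS]mxE.
  by [].
rewrite mulrDr -normrEsg -dotvZl.
apply: (@le_lt_trans _ _
  (`|beta j 0| - Num.sqrt (n%:R^-1 * max_diag_inv_gram X B) * (u * sigma))).
  by rewrite lerBrDr.
by rewrite ltrD2l.
Qed.

Lemma lse_gap_le_outside (t : R) (C : {set 'I_p}) : 1 <= t -> (forall j, j \in B -> j \notin C) ->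
  #|C| = (d - #|B|)%N ->
  holds_outside P (Num.min 1 (2 / Num.sqrt t) * expR (- (#|C|%:R / 2 * (t - 1 - ln t))))
    (fun w => dotv (lse_gap X (y w) B (B :|: C)) (lse_gap X (y w) B (B :|: C)) <=
      #|C|%:R * t * sigma ^+ 2).
Proof.
move=> t1 BC Cm.
have Ad : (#|B :|: C| <= d)%N.
  by apply: leq_trans (leq_card_setU _ _) _; rewrite Cm subnKC// ltnW.
have Cn : (#|C| <= n)%N.
  by apply: (card_le_sample_size clo0 SRC); rewrite Cm leq_subr.
have C0 : (0 < #|C|)%N by rewrite Cm subn_gt0.
have [V VE] := lse_gap_span n0 clo0 SRC (ltnW Bd) BC Ad.
have [Z' iZ' Z'E] := projection_le_sum_sqr sigma0 (fun k a => V k a) iZ Cn.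
have := iid_normal_sum_sqr_tail sigma0 iZ' C0 t1 => h.
apply: (holds_outside_sub _ h) => [|w /=].
  rewrite (_ : [set w | _] =
      (fun w => \sum_i Z' i w ^+ 2) @^-1` `[#|C|%:R * t * sigma ^+ 2, +oo[%classic).
    rewrite -[X in measurable X]setTI.
    have mf : measurable_fun setT (fun w => \sum_i Z' i w ^+ 2).
      by apply: measurable_sum => k; exact: measurable_funX.
    by apply: mf => //; exact: measurable_itv.
  by apply/seteqP; split=> w /=; rewrite in_itv/= andbT.
move/negP; rewrite -ltNge => /ltW; apply: le_trans.
rewrite (lse_gap_response n0 clo0 SRC (ltnW Bd) betaB _ Ad).
have [c cE] := VE (noise w).
have := dotv_lse_gap n0 clo0 SRC (ltnW Bd) _ Ad => /(_ (noise w)) /=.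
rewrite cE => hW; have := Z'E w (fun a => c a 0) => /=.
have VcE k : (V *m c) k 0 = \sum_a V k a * c a 0 by rewrite mxE.
under eq_bigr do rewrite -VcE.
under [X in _ = X -> _]eq_bigr do rewrite -VcE.
by apply; rewrite -dotv_noise.
Qed.

End noise_events.

(** * The level defining [ptilde] *)

Section ptilde.
Context {R : realType}.
Implicit Types t r e : R.

Lemma sub_ln_solution r : 0 <= r -> exists2 t : R, 1 <= t & t - 1 - ln t = r.
Proof.
(* At this endpoint ln b = 2 ln (2 + r) <= 2 (1 + r), hence f b >= (1 + r)^2 >= r. *)
move=> r0; pose f (t : R) := t - 1 - ln t; pose b := (2 + r) ^+ 2.
have b1 : 1 <= b by rewrite /b; nra.
have f1 : f 1 = 0 by rewrite /f ln1; lra.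
have fb : r <= f b.
  have : ln (2 + r) <= 1 + r.
    by rewrite (_ : 2 + r = 1 + (1 + r)); [apply: le_ln1Dx; lra|ring].
  rewrite /f /b lnXn; last lra.
  by rewrite mulr2n; nra.
have fc : {within `[1, b], continuous f}.
  apply: continuous_in_subspaceT => x; rewrite inE/= in_itv/= => /andP[x1 _].
  apply: cvgB; last by apply: continuous_ln; exact: lt_le_trans x1.
  by apply: cvgB; [exact: cvg_id|exact: cvg_cst].
have [|t + ft] := IVT (v := r) b1 fc.
  by rewrite f1 min_l ?max_r ?(le_trans r0)// r0 fb.
by rewrite in_itv/= => /andP[t1 _]; exists t.
Qed.

(** If t > t', then ln (t / t') < t / t' - 1 <= t - t', which reverses the inequality strictly. *)
Lemma sub_ln_mono t t' : 1 <= t -> 1 <= t' -> t - 1 - ln t <= t' - 1 - ln t' -> t <= t'.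
Proof.
move=> t1 t'1; apply: contra_le => tt.
have t'0 : 0 < t' by exact: lt_le_trans t'1.
have t0 : 0 < t by exact: lt_trans tt.
have v0 : ln (t / t') != 0.
  rewrite gt_eqF// -ln1 ltr_ln ?posrE ?divr_gt0//.
  by rewrite ltr_pdivlMr// mul1r.
have := expR_gt1Dx v0; rewrite lnK ?posrE ?divr_gt0//.
rewrite lnM ?posrE ?invr_gt0// lnV ?posrE// => h.
have : t / t' - 1 <= t - t'.
  rewrite -[X in _ - X](@divff _ t') ?gt_eqF// -mulrBl ler_pdivrMr//.
  by rewrite ler_peMr// subr_ge0 ltW.
lra.
Qed.

Lemma ptildeP (N m : nat) e : (0 < m <= N)%N -> 0 < e <= 1 ->
  1 <= 2 * ln (ptilde N m e) /\
    2 * ln (ptilde N m e) - 1 - ln (2 * ln (ptilde N m e)) =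
      2 / m%:R * (ln 'C(N, m)%:R + ln (1 / e)).
Proof.
move=> /andP[m0 mN] /andP[e0 e1].
apply: (xgetPex 1 (P := [set x : R | 1 <= 2 * ln x /\
    2 * ln x - 1 - ln (2 * ln x) = 2 / m%:R * (ln ('C(N, m)%:R) + ln (1 / e))])).
have C1 : 1 <= 'C(N, m)%:R :> R by rewrite (ler_nat _ 1) bin_gt0.
have r0 : 0 <= 2 / m%:R * (ln 'C(N, m)%:R + ln (1 / e)).
  rewrite mulr_ge0 ?divr_ge0// addr_ge0 ?ln_ge0//.
  by rewrite ler_pdivlMr// mul1r.
have [t t1 tE] := sub_ln_solution r0.
exists (expR (t / 2)) => /=; rewrite expRK.
by have -> : 2 * (t / 2) = t by field.
Qed.

Lemma ptilde_ln_mono (N m : nat) e e' : (0 < m <= N)%N -> 0 < e -> e <= e' -> e' <= 1 ->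
  2 * ln (ptilde N m e') <= 2 * ln (ptilde N m e).
Proof.
move=> mN e0 ee' e'1.
have e'0 : 0 < e' by exact: lt_le_trans ee'.
have [|t1 tE] := @ptildeP N m e mN; first by rewrite e0 (le_trans ee').
have [|t'1 t'E] := @ptildeP N m e' mN; first by rewrite e'0.
apply: sub_ln_mono => //; rewrite tE t'E ler_wpM2l ?divr_ge0// lerD2l.
rewrite ler_ln ?posrE ?divr_gt0// ler_pdivrMr// mulrC mulrA mulr1 ler_pdivlMr// mul1r.
by [].
Qed.

(** The purpose of [ptilde]: the exponential part of the chi-square tail, summed over all sets of m
    variables off the support, is exactly [e]. *)
Lemma ptilde_expR (N m : nat) e (t := 2 * ln (ptilde N m e)) : (0 < m <= N)%N -> 0 < e <= 1 ->
  'C(N, m)%:R * expR (- (m%:R / 2 * (t - 1 - ln t))) = e.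
Proof.
move=> mN e01; have [_] := ptildeP mN e01; rewrite -/t => ->.
have /andP[m0 mN'] := mN; have /andP[e0 e1] := e01.
have m00 : m%:R != 0 :> R by rewrite pnatr_eq0 -lt0n.
have C0 : 0 < 'C(N, m)%:R :> R by rewrite ltr0n bin_gt0.
rewrite mulrA (_ : m%:R / 2 * (2 / m%:R) = 1); last by field.
rewrite mul1r div1r lnV ?posrE// opprB expRD lnK ?posrE// expRN lnK ?posrE//.
by rewrite mulrCA divff ?mulr1// gt_eqF.
Qed.
End ptilde.

Lemma gaussian_noise_iid (R : realType) dT (T : measurableType dT) (P : probability T R) n sigma
  (Z : 'I_n -> {RV P >-> R}) : gaussian_noise sigma Z -> iid_normal sigma Z.
Proof.
move=> [ind dis] B mB; rewrite ind//; apply: eq_bigr => i _.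
by rewrite -(dis i).
Qed.

(** * Probability of recovering the oracle *)

Section main_event.
Context {R : realType}.
Variable D : problem R.
Hypothesis HD : assumptions D.

Local Notation n := (pb_n D).
Local Notation p := (pb_p D).
Local Notation X := (pb_X D).
Local Notation beta := (pb_beta D).
Local Notation sigma := (pb_sigma D).
Local Notation dstar := (pb_dstar D).
Local Notation clo := (pb_clo D).
Local Notation chi := (pb_chi D).
Local Notation eps := (pb_eps D).
Local Notation lam2 := (pb_lam2 D).
Local Notation gamma := (pb_gamma D).
Local Notation P := (pb_Pr D).
Local Notation B := (true_support D).
Local Notation m := (dstar - true_size D)%N.
Local Notation N := (p - true_size D)%N.

Let sigma0 : 0 < sigma. Proof. by case: HD => [[]]. Qed.
Let iZ : iid_normal sigma (@pb_noise R D).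
Proof. by case: HD => [[_ /gaussian_noise_iid]]. Qed.
Let clo0 : 0 < clo. Proof. by case: HD => _ [[_ /andP[]]]. Qed.
Let cc : clo <= chi. Proof. by case: HD => _ [[_ /andP[]]]. Qed.
Let SRC : sparse_riesz X dstar clo chi. Proof. by case: HD => _ [[]]. Qed.
Let eps01 : 0 < eps <= 1. Proof. by case: HD => _ [_ []]. Qed.
Let chi0 : 0 < chi. Proof. exact: lt_le_trans cc. Qed.
Let dstar0 : (0 < dstar)%N. Proof. by case: HD => _ [[/andP[]]]. Qed.
Let dstar_le : (dstar <= p)%N. Proof. by case: HD => _ [[/andP[]]]. Qed.

Lemma problem_size_gt0 : (0 < n)%N.
Proof. by apply: (sample_size_gt0 clo0 SRC); rewrite dstar0. Qed.

Let sizeE : (true_size D)%:R * (chi / clo + 1 / 2) <= dstar%:R.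
Proof.
case: HD => _ [[_ _ _ h] _]; move: h; rewrite ler_pdivlMr//.
by rewrite addr_gt0// divr_gt0.
Qed.

Lemma true_size_lt : (true_size D < dstar)%N.
Proof.
have [d0|d0] := posnP (true_size D); first by rewrite d0.
rewrite -(ltr_nat R); apply: lt_le_trans sizeE.
rewrite ltr_pMr ?ltr0n//.
have : 1 <= chi / clo by rewrite ler_pdivlMr// mul1r.
lra.
Qed.

Lemma excess_bounds : (0 < m <= N)%N.
Proof. by rewrite subn_gt0 true_size_lt leq_sub2r. Qed.

Let dB : (true_size D)%:R * (2 * chi - clo) <= 2 * m%:R * clo.
Proof.
rewrite natrB ?(ltnW true_size_lt)//.
have : (true_size D)%:R * (chi / clo + 1 / 2) * (2 * clo) <= dstar%:R * (2 * clo).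
  by rewrite ler_wpM2r// mulr_ge0// ltW.
have -> : (true_size D)%:R * (chi / clo + 1 / 2) * (2 * clo) = (true_size D)%:R * (2 * chi + clo).
  by field; rewrite gt_eqF.
lra.
Qed.

Lemma problem_gamma_gt0 : 0 < gamma.
Proof.
case: HD => _ [_ [_ _ h _]]; apply: lt_le_trans h.
by rewrite mulr_gt0 ?invr_gt0// sqrtr_gt0 addr_gt0// divr_gt0.
Qed.

Let gam : 4 * chi + clo <= gamma ^+ 2 * clo ^+ 2 * chi.
Proof.
case: HD => _ [_ [_ _ h _]].
have s0 : 0 <= 4 + clo / chi by rewrite addr_ge0// divr_ge0// ltW.
have : Num.sqrt (4 + clo / chi) <= gamma * clo by rewrite [gamma * _]mulrC -ler_pdivrMl.
rewrite -ler_sqr ?nnegrE ?sqrtr_ge0 ?mulr_ge0 ?(ltW problem_gamma_gt0) ?(ltW clo0)//.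
rewrite sqr_sqrtr// exprMn -(ler_pM2r chi0); apply: le_trans.
by rewrite [(_ + clo / _) * _]mulrDl divfK ?gt_eqF.
Qed.

Let betaB : supported B beta.
Proof. by move=> j; rewrite inE negbK => /eqP. Qed.

Let colX j : dotv (col j X) (col j X) = n%:R.
Proof. by case: HD => [[_ _ h]] _; rewrite -(h j) sqnormE. Qed.

Lemma oracleE w : oracle w = restricted_solve X B (X^T *m response w).
Proof.
rewrite /oracle (restricted_lse_eq clo0 SRC)//; first exact: problem_size_gt0.
exact: ltnW true_size_lt.
Qed.

Local Notation t := (2 * ln (ptilde_at D eps)).

Definition oracle_recovered (w : pb_Omega D) : Prop :=
  estimator w = oracle w /\ map_mx Num.sg (estimator w) = map_mx Num.sg beta.

(** The three summands pay for the noise, signal and gap conditions of the path argument. The signal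
    level [u2] stays free because the finite and the asymptotic bounds choose it differently. *)
Lemma oracle_recovered_outside (u1 u2 : R) : 0 < u1 -> 0 < u2 ->
  lam1 D = Num.sqrt n%:R^-1 * (u1 * sigma) ->
  (forall j, j \in B ->
     gamma * lam2 + Num.sqrt (n%:R^-1 * w_oracle D) * (u2 * sigma) <= `|beta j 0|) ->
  holds_outside P (N%:R * (2 * normal_tail_bound u1) +
    ((true_size D)%:R * normal_tail_bound u2 + eps * Num.min 1 (2 / Num.sqrt t)))
    (fun w => lamhat_in_range D w -> oracle_recovered w).
Proof.
move=> u10 u20 lam1E sigE.
have n0 := problem_size_gt0; have Bd := true_size_lt; have g0 := problem_gamma_gt0.
have lam1_gt0 : 0 < lam1 D.
  by rewrite lam1E !mulr_gt0// sqrtr_gt0 invr_gt0 ltr0n.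
have [sel lamle] : is_mcp_selector D /\ Num.max (2 * Num.sqrt chi * sigma *
                 Num.sqrt (2 / n%:R * ln (ptilde_at D eps))) (lam1 D) <= lam2.
  by case: HD => _ [_ []].
move: lamle; rewrite ge_max => /andP[lam2t lam12].
have tail0 u : 0 < u -> 0 <= normal_tail_bound u.
  by move=> u0; rewrite divr_ge0 ?expR_ge0// mulr_ge0// ltW.
have [t1 _] := ptildeP excess_bounds eps01; rewrite -/(ptilde_at D eps) in t1.
have cB : #|~: B| = N.
  by have /(congr1 (subn^~ (true_size D))) := cardsC B; rewrite /= card_ord addKn.
have H1 : holds_outside P (N%:R * (2 * normal_tail_bound u1))
   (fun w => forall j, j \in ~: B -> `|score X (response w) (oracle w) j| < lam1 D).
  have -> : N = #|[pred j | j \in ~: B]|.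
    by rewrite -cB; apply: eq_card => j; rewrite !inE.
  apply: holds_outside_forall; first by rewrite mulr_ge0// tail0.
  move=> j _; have := score_lt_outside n0 clo0 SRC sigma0 iZ Bd betaB u10 (colX j).
  by apply: holds_outsideS => w; rewrite oracleE lam1E.
have H2 : holds_outside P ((true_size D)%:R * normal_tail_bound u2)
   (fun w => forall j, j \in B -> gamma * lam2 < Num.sg (beta j 0) * oracle w j 0).
  apply: holds_outside_forall; first by rewrite tail0.
  move=> j jB; have := signal_gt_outside n0 clo0 SRC sigma0 iZ Bd betaB u20 jB (sigE j jB).
  by apply: holds_outsideS => w; rewrite oracleE.
have H3 : holds_outside P (eps * Num.min 1 (2 / Num.sqrt t))
   (fun w => forall C : {set 'I_p},
      C \in [set C : {set 'I_p} | (C \subset ~: B) && (#|C| == m)]%SET ->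
      dotv (lse_gap X (response w) B (B :|: C)) (lse_gap X (response w) B (B :|: C)) <=
      m%:R * t * sigma ^+ 2).
  have -> : eps * Num.min 1 (2 / Num.sqrt t) =
    #|[pred C : {set 'I_p} | C \in [set C : {set 'I_p} | (C \subset ~: B) && (#|C| == m)]%SET]|%:R *
     (Num.min 1 (2 / Num.sqrt t) * expR (- (m%:R / 2 * (t - 1 - ln t)))).
    rewrite -{1}(ptilde_expR excess_bounds eps01) -/(ptilde_at D eps).
    rewrite (_ : #|_| = 'C(N, m)); last first.
      by rewrite -cB -cards_draws; apply: eq_card => C; rewrite !inE.
    by rewrite [Num.min _ _ * _]mulrC mulrA.
  apply: holds_outside_forall.
    by rewrite mulr_ge0 ?expR_ge0// le_min ler01 divr_ge0// sqrtr_ge0.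
  move=> C; rewrite /= inE => /andP[CB /eqP Cm].
  have BC j : j \in B -> j \notin C.
    by move=> jB; apply/negP => /(fintype.subsetP CB); rewrite inE jB.
  have := lse_gap_le_outside n0 clo0 SRC sigma0 iZ Bd betaB t1 BC Cm.
  by rewrite Cm.
(* The selector comes from a path only almost surely; the exceptional null set costs 0. *)
have H0 : holds_outside P 0 (fun w => exists (lam : R -> R) (b : R -> 'cV[R]_p),
     solution_path (mcp gamma) X (response w) lam b /\
     estimator w = path_selector lam b (pb_lamhat D w)).
  have [E [mE E0 EQ]] := sel; exists E; split; rewrite ?E0//.
  by move=> w nE; apply: contrapT => h; apply: nE; exact: EQ.
have := holds_outsideI H1 (holds_outsideI H2 (holds_outsideI H3 H0)).
rewrite addr0; apply: holds_outsideS => w [g1 [g2 [g3 [lam [b [pathb estE]]]]]] range.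
have sgE j : j \in B -> Num.sg (oracle w j 0) = Num.sg (beta j 0).
  move=> jB; have h : 0 < Num.sg (beta j 0) * oracle w j 0.
    by apply: lt_trans (g2 j jB); rewrite mulr_gt0// (lt_le_trans lam1_gt0).
  have : Num.sg (Num.sg (beta j 0) * oracle w j 0) = 1 by rewrite gtr0_sg.
  rewrite sgrM sgr_id; move: jB; rewrite inE => bj.
  have : Num.sg (beta j 0) ^+ 2 = 1 by rewrite sqr_sg bj.
  by rewrite expr2 => ss h1; rewrite -[LHS]mul1r -ss -mulrA h1 mulr1.
have eE : estimator w = oracle w.
  rewrite estE oracleE.
  apply: (path_selector_eq_lse n0 clo0 cc SRC g0 gam Bd dB lam1_gt0 lam12 _ _ _ pathb range).
  - move=> j jB; rewrite -oracleE; apply: lt_le_trans (g2 j jB) _.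
    apply: le_trans (ler_norm _) _; rewrite normrM normr_sg.
    by case: (_ != 0); rewrite ?mul1r// mul0r.
  - by move=> j jB; rewrite -oracleE g1// inE.
  - move=> C BC Cm; have := g3 C; rewrite inE Cm eqxx andbT => h.
    have {}h := h (introT fintype.subsetP _).
    apply: (le_trans (ler_wpM2l _ (h _))); first by rewrite invr_ge0.
      by move=> j jC; rewrite inE; apply: contraL jC; exact: BC.
    (* The lower bound on lambda_2 squares to lambda_2^2 >= 4 chi sigma^2 t / n, exactly what m t
       sigma^2 / n <= m lambda_2^2 / (4 chi) requires. *)
    rewrite ler_pdivlMr ?mulr_gt0//.
    have nn0 : 0 < n%:R :> R by rewrite ltr0n.
    have lam20 : 0 <= lam2 by rewrite (le_trans (ltW lam1_gt0)).
    have : (2 * Num.sqrt chi * sigma * Num.sqrt (2 / n%:R * ln (ptilde_at D eps))) ^+ 2 <=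
        lam2 ^+ 2.
      by rewrite ler_sqr ?nnegrE// !mulr_ge0// ?sqrtr_ge0// ltW.
    rewrite !exprMn sqr_sqrtr ?(ltW chi0)// sqr_sqrtr; last first.
      by rewrite mulrAC divr_ge0// (le_trans _ t1).
    move=> h2; apply: (@le_trans _ _ (m%:R *
        (2 ^+ 2 * chi * sigma ^+ 2 * (2 / n%:R * ln (ptilde_at D eps))))).
      by rewrite le_eqVlt; apply/orP; left; apply/eqP; ring.
    by rewrite ler_wpM2l.
split=> //; rewrite eE; apply/colP => j; rewrite !mxE.
have [/sgE//|jB] := boolP (j \in B).
rewrite betaB// oracleE supported_restricted_solve//.
Qed.

End main_event.

(** * Measurability and the failure probability *)

Lemma measurable_sg_eq (R : realType) (b : R) : measurable [set x : R | Num.sg x = Num.sg b].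
Proof.
have [b0|b0|->] := ltrgtP b 0.
- rewrite (_ : [set x | _] = `]-oo, 0[%classic); first exact: measurable_itv.
  apply/seteqP; split=> x /=; rewrite in_itv/= (ltr0_sg b0).
    by move/eqP; rewrite sgr_cp0.
  by move=> x0; apply/eqP; rewrite sgr_cp0.
- rewrite (_ : [set x | _] = `]0, +oo[%classic); first exact: measurable_itv.
  apply/seteqP; split=> x /=; rewrite in_itv/= andbT (gtr0_sg b0).
    by move/eqP; rewrite sgr_cp0.
  by move=> x0; apply/eqP; rewrite sgr_cp0.
- rewrite (_ : [set x | _] = [set 0]); first exact: measurable_set1.
  apply/seteqP; split=> x /=; rewrite sgr0; last by move=> ->; rewrite sgr0.
  by move/eqP; rewrite sgr_cp0 => /eqP.
Qed.

Lemma measurable_forall_ord d (T : measurableType d) p (Q : 'I_p -> set T) :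
  (forall j, measurable (Q j)) -> measurable [set w | forall j, Q j w].
Proof.
move=> mQ; rewrite (_ : [set w | _] = \bigcap_(j in [set: 'I_p]) Q j); last first.
  by apply/seteqP; split=> w /= h j *; exact: h.
by apply: fin_bigcap_measurable; first exact: finite_finset.
Qed.

Section probability_bounds.
Context {R : realType}.
Variable D : problem R.
Hypothesis HD : assumptions D.

Local Notation n := (pb_n D).
Local Notation p := (pb_p D).
Local Notation X := (pb_X D).
Local Notation beta := (pb_beta D).
Local Notation sigma := (pb_sigma D).
Local Notation dstar := (pb_dstar D).
Local Notation eps := (pb_eps D).
Local Notation lam2 := (pb_lam2 D).
Local Notation gamma := (pb_gamma D).
Local Notation P := (pb_Pr D).
Local Notation B := (true_support D).
Local Notation m := (dstar - true_size D)%N.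
Local Notation N := (p - true_size D)%N.
Local Notation t := (2 * ln (ptilde_at D eps)).

Lemma measurable_oracle j : measurable_fun setT (fun w : pb_Omega D => oracle w j 0).
Proof.
have clo0 : 0 < pb_clo D by case: HD => _ [[_ /andP[]]].
have SRC : sparse_riesz X dstar (pb_clo D) (pb_chi D) by case: HD => _ [[]].
have Bd : (#|B| <= dstar)%N by exact: ltnW (true_size_lt HD).
have n0 := problem_size_gt0 HD.
have bB : supported B beta by move=> k; rewrite inE negbK => /eqP.
have [jB|jB] := boolP (j \in B); last first.
  rewrite (_ : (fun w => _) = cst 0); first exact: measurable_cst.
  by apply/funext => w; rewrite oracleE// supported_restricted_solve.
have [c [_ _ cE]] := coef_restricted_solve n0 clo0 SRC Bd jB.
rewrite (_ : (fun w => _) = (fun w => beta j 0 + dotv c (\col_i pb_noise i w))).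
  by apply: measurable_funD; [exact: measurable_cst|exact: measurable_dotv_noise].
apply/funext => w; rewrite oracleE// /response (restricted_solve_response n0 clo0 SRC Bd bB).
by rewrite mxE cE.
Qed.

Lemma measurable_estimator_eq_oracle :
  measurable [set w : pb_Omega D | estimator w = oracle w].
Proof.
rewrite (_ : [set w | _] = [set w | forall j, pb_bhat j w = oracle w j 0]); last first.
  apply/seteqP; split=> w /= h; first by move=> j; rewrite -h mxE.
  by apply/colP => j; rewrite mxE h.
apply: measurable_forall_ord => j.
have := measurable_fun_eqr (f := pb_bhat j) (measurable_funPT _) (measurable_oracle j).
move=> /(_ measurableT [set true] I); rewrite setTI => h.
rewrite (_ : (fun w => _ = _) = (fun w => pb_bhat j w == oracle w j 0) @^-1` [set true])//.
by apply/seteqP; split=> w /= /eqP.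
Qed.

Lemma measurable_oracle_recovered : measurable [set w | @oracle_recovered R D w].
Proof.
rewrite (_ : [set w | _] = [set w | estimator w = oracle w] `&`
   [set w | forall j, Num.sg (pb_bhat j w) = Num.sg (beta j 0)]); last first.
  apply/seteqP; split=> w /= [h1 h2]; split=> //.
    by move=> j; have /colP/(_ j) := h2; rewrite !mxE.
  by apply/colP => j; rewrite !mxE h2.
apply: measurableI; first exact: measurable_estimator_eq_oracle.
apply: measurable_forall_ord => j.
by have := measurable_funPTI (pb_bhat j) (measurable_sg_eq (beta j 0)).
Qed.

Lemma measurable_lamhat_in_range : measurable (lamhat_in_range D).
Proof.
rewrite (_ : lamhat_in_range D = pb_lamhat D @^-1` `[lam1 D, lam2]%classic).
  by apply: measurable_funPTI; exact: measurable_itv.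
by apply/seteqP; split=> w /=; rewrite in_itv.
Qed.

Lemma prob_not_recovered_le (q : R) :
  holds_outside P q (fun w => lamhat_in_range D w -> oracle_recovered w) ->
  (P (~` [set w | oracle_recovered w]) <= P (~` lamhat_in_range D) + q%:E)%E.
Proof.
move=> [E [mE PE EQ]].
have mR := measurableC measurable_lamhat_in_range.
apply: le_trans (leeD (lexx _) PE).
apply: (@le_trans _ _ (P (~` lamhat_in_range D `|` E))); last exact: measureU2.
apply: le_measure; rewrite ?inE.
- exact/measurableC/measurable_oracle_recovered.
- exact: measurableU.
move=> w /= nr; have [nE|wE] := pselect (~ E w); last by right; exact: contrapT.
by left => /= rg; apply: nr; exact: EQ.
Qed.

Let eps01 : 0 < eps <= 1. Proof. by case: HD => _ [_ []]. Qed.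
Let sigma0 : 0 < sigma. Proof. by case: HD => [[]]. Qed.

(** At u1 = sqrt (2 ln (N / eps)) the two-sided noise tails add up to eps / u1 <= eps / v; the
    one-sided signal tails give at most eps / (2 v), and the gap eps k. *)
Lemma prob_not_recovered_tail (v k u2 : R) : 0 < v ->
  v <= Num.sqrt (2 * ln (N%:R / eps)) -> v <= u2 ->
  (true_size D)%:R * expR (- u2 ^+ 2 / 2) <= eps ->
  (forall j, j \in B ->
     gamma * lam2 + Num.sqrt (n%:R^-1 * w_oracle D) * (u2 * sigma) <= `|beta j 0|) ->
  Num.min 1 (2 / Num.sqrt t) <= k ->
  (P (~` [set w | @oracle_recovered R D w]) <=
    P (~` lamhat_in_range D) + (eps * (3 / (2 * v) + k))%:E)%E.
Proof.
move=> v0 vu1 vu2 du2 sig tk; have /andP[e0 e1] := eps01.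
have u20 : 0 < u2 by exact: lt_le_trans vu2.
set u1 := Num.sqrt _ in vu1; have u10 : 0 < u1 by exact: lt_le_trans vu1.
have N0 : 0 < N%:R :> R.
  by rewrite ltr0n; have /andP[m0 mN] := excess_bounds HD; exact: leq_trans mN.
have L0 : 0 <= 2 * ln (N%:R / eps).
  rewrite mulr_ge0// ln_ge0// ler_pdivlMr// mul1r; apply: (le_trans e1).
  by rewrite (ler_nat _ 1) -(ltr_nat R).
have nn0 : 0 < n%:R :> R by rewrite ltr0n problem_size_gt0.
have lam1E : lam1 D = Num.sqrt n%:R^-1 * (u1 * sigma).
  rewrite /lam1 /u1 mulrA -sqrtrM ?invr_ge0 ?(ltW nn0)// mulrC.
  by congr (Num.sqrt _ * _); ring.
have := oracle_recovered_outside HD u10 u20 lam1E sig.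
move=> /prob_not_recovered_le/le_trans; apply; rewrite leeD2l// lee_fin.
rewrite mulrDr addrA; apply: lerD; last by rewrite ler_wpM2l// ltW.
have -> : eps * (3 / (2 * v)) = eps / v + eps / (2 * v) by field; rewrite gt_eqF.
have exp1 : expR (- u1 ^+ 2 / 2) = eps / N%:R.
  rewrite /u1 sqr_sqrtr// (_ : - (2 * _) / 2 = - ln (N%:R / eps)); last by field.
  by rewrite expRN lnK ?posrE ?divr_gt0// invf_div.
apply: lerD.
  rewrite /normal_tail_bound exp1.
  rewrite (_ : N%:R * (2 * (eps / N%:R / (2 * u1))) = eps / u1); last first.
    by field; rewrite !gt_eqF.
  by rewrite ler_wpM2l ?(ltW e0)// lef_pV2.
rewrite /normal_tail_bound mulrA; apply: ler_pM => //.
- by rewrite invr_ge0 mulr_ge0// ltW.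
- by rewrite lef_pV2 ?posrE ?mulr_gt0// ler_pM2l.
Qed.

Hypothesis HB : beta_min_condition D.

Lemma beta_min_signal j (u := Num.sqrt (2 * ln ((true_size D)%:R / eps))) : j \in B ->
  gamma * lam2 + Num.sqrt (n%:R^-1 * w_oracle D) * (u * sigma) <= `|beta j 0|.
Proof.
move=> jB; rewrite -lee_fin.
apply: le_trans (bigmin_le_cond (P := mem B) +oo%E (fun i => (`|beta i 0|%:E)%E) jB).
apply: le_trans HB; rewrite lee_fin addrC lerD2r.
have /andP[e0 e1] := eps01.
have L0 : 0 <= 2 * ln ((true_size D)%:R / eps).
  rewrite mulr_ge0// ln_ge0// ler_pdivlMr// mul1r (le_trans e1)// (ler_nat _ 1).
  by rewrite card_gt0; apply/set0Pn; exists j.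
have -> : Num.sqrt (n%:R^-1 * w_oracle D) * (u * sigma) =
    sigma * (u * Num.sqrt (n%:R^-1 * w_oracle D)) by ring.
suff -> : u * Num.sqrt (n%:R^-1 * w_oracle D) =
    Num.sqrt (w_oracle D * (2 / n%:R) * ln ((true_size D)%:R / eps)) by [].
rewrite /u -sqrtrM//.
have -> : 2 * ln ((true_size D)%:R / eps) * (n%:R^-1 * w_oracle D) =
    w_oracle D * (2 / n%:R) * ln ((true_size D)%:R / eps) by ring.
by [].
Qed.

Lemma beta_min_tail (u : R) : Num.sqrt (2 * ln ((true_size D)%:R / eps)) <= u ->
  (true_size D)%:R * expR (- u ^+ 2 / 2) <= eps.
Proof.
have /andP[e0 e1] := eps01.
have [->|d0] := posnP (true_size D); first by move=> _; rewrite mul0r ltW.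
have d0' : 0 < (true_size D)%:R :> R by rewrite ltr0n.
have L0 : 0 <= 2 * ln ((true_size D)%:R / eps).
  by rewrite mulr_ge0// ln_ge0// ler_pdivlMr// mul1r (le_trans e1)// (ler_nat _ 1).
move=> hu; have u0 : 0 <= u by apply: le_trans hu; exact: sqrtr_ge0.
have : 2 * ln ((true_size D)%:R / eps) <= u ^+ 2.
  by rewrite -[leLHS]sqr_sqrtr// ler_sqr ?nnegrE ?sqrtr_ge0.
move=> hu2; have : expR (- u ^+ 2 / 2) <= eps / (true_size D)%:R.
  have -> : eps / (true_size D)%:R = expR (- ln ((true_size D)%:R / eps)).
    by rewrite expRN lnK ?posrE ?divr_gt0// invf_div.
  rewrite ler_expR; lra.
move=> h; rewrite mulrC; apply: le_trans (ler_wpM2r (ltW d0') h) _.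
by rewrite divfK// gt_eqF.
Qed.
End probability_bounds.

(** From exp (-1/82) >= 81/82, six squarings reach exp (- 32/41), as 64/82 = 32/41. After each
    squaring but the last, the lower bound is rounded down to a simpler fraction; the chain is read
    from the bottom. *)
Lemma expR_32_41 (R : realType) : expR (32 / 41) <= (46 / 31) ^+ 2 :> R.
Proof.
have a0 : 81 / 82 <= expR (- (32 / 41) / 64) :> R.
  by apply: le_trans (expR_ge1Dx _); lra.
have E (x : R) : expR x = expR (x / 64) ^+ 2 ^+ 2 ^+ 2 ^+ 2 ^+ 2 ^+ 2.
  by rewrite -!exprM -expRM_natl; congr expR; field.
have sq (b a x : R) : 0 <= b -> a <= b ^+ 2 -> b <= x -> a <= x ^+ 2.
  by move=> b0 ab bx; apply: (le_trans ab); rewrite ler_sqr ?nnegrE// (le_trans b0).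
have : ((46 / 31) ^+ 2)^-1 <= expR (- (32 / 41)) :> R.
  rewrite -exprVn invf_div E.
  apply: (sq (31 / 46)); [lra|exact: lexx|].
  apply: (sq (78 / 95)); [lra|lra|].
  apply: (sq (29 / 32)); [lra|lra|].
  apply: (sq (159 / 167)); [lra|lra|].
  apply: (sq (161 / 165)); [lra|lra|].
  by apply: (sq (81 / 82)); [lra|lra|].
by rewrite expRN lef_pV2// posrE ?expR_gt0// exprn_gt0// divr_gt0.
Qed.

(* With r = 1 / sqrt 2, the level v solves 3 / (2 v) + 1 = 3 / 2 + r, and the
   inequality reads 9 / (6 + 8 r) <= ln (3 / 2 + r). *)
Lemma tail_constant (R : realType) (c := 3 / 2 + 1 / Num.sqrt 2 : R) :
  exists2 v : R, 0 < v & 3 / (2 * v) + 1 = c /\ v <= Num.sqrt (2 * ln c).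
Proof.
pose r : R := 1 / Num.sqrt 2.
have r2 : r ^+ 2 = 1 / 2 by rewrite /r expr_div_n sqr_sqrtr// expr1n.
have r0 : 0 < r by rewrite divr_gt0// sqrtr_gt0.
have cE : c = 3 / 2 + r by [].
clearbody r c.
(* A rational bound just below 1 / sqrt 2, still large enough for (46/31)^2 <= 3/2 + 33/47. *)
have rl : 33 / 47 <= r by nra.
have c0 : 0 < c - 1 by lra.
pose v := 3 / (2 * (c - 1)).
have v0 : 0 < v by rewrite divr_gt0// mulr_gt0.
exists v => //; split.
  by rewrite /v; field; rewrite gt_eqF.
have [x x0 [xc xr]] : exists2 x : R, 0 <= x & expR x <= c /\ 9 <= x * (6 + 8 * r).
  (* A rational number between 9 / (6 + 8 r), about 0.772, and ln c, about 0.792. *)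
  exists (32 / 41); first lra.
  by split; [apply: le_trans (expR_32_41 R) _; lra|lra].
have lnc : x <= ln c by rewrite -ler_expR lnK// posrE; lra.
rewrite -ler_sqr ?nnegrE ?sqrtr_ge0 ?(ltW v0)// sqr_sqrtr; last first.
  by rewrite mulr_ge0// (le_trans x0).
apply: (@le_trans _ _ (2 * x)); last by rewrite ler_pM2l.
rewrite /v expr_div_n ler_pdivrMr; last by rewrite exprn_gt0// mulr_gt0.
rewrite cE (_ : 2 * x * (2 * (3 / 2 + r - 1)) ^+ 2 = x * (8 * (1 / 4 + r + r ^+ 2))); last by field.
rewrite r2; lra.
Qed.

(** * Failure bounds under the signal condition *)

Section theorem_bounds.
Context {R : realType}.
Variable D : problem R.
Hypotheses (HD : assumptions D) (HB : beta_min_condition D).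

Local Notation n := (pb_n D).
Local Notation p := (pb_p D).
Local Notation beta := (pb_beta D).
Local Notation sigma := (pb_sigma D).
Local Notation dstar := (pb_dstar D).
Local Notation eps := (pb_eps D).
Local Notation lam2 := (pb_lam2 D).
Local Notation gamma := (pb_gamma D).
Local Notation P := (pb_Pr D).
Local Notation B := (true_support D).
Local Notation d := (true_size D).
Local Notation m := (dstar - d)%N.
Local Notation N := (p - d)%N.
Local Notation t := (2 * ln (ptilde_at D eps)).

Let eps01 : 0 < eps <= 1. Proof. by case: HD => _ [_ []]. Qed.
Let eps_gt0 : 0 < eps. Proof. by case/andP: eps01. Qed.
Let eps_le1 : eps <= 1. Proof. by case/andP: eps01. Qed.
Let sigma0 : 0 < sigma. Proof. by case: HD => [[]]. Qed.

Let N_ge1 : 1 <= N%:R :> R.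
Proof.
by rewrite (ler_nat _ 1); have /andP[m0 mN] := excess_bounds HD; exact: leq_trans mN.
Qed.

Let sqrt_ln_le (M x : R) : 0 < M -> M <= x -> Num.sqrt (2 * ln M) <= Num.sqrt (2 * ln x).
Proof.
move=> M0 Mx; rewrite ler_wsqrtr// ler_pM2l// ler_ln ?posrE//.
exact: lt_le_trans Mx.
Qed.

Lemma prob_not_recovered_eps (v : R) : 0 < v -> v <= Num.sqrt (2 * ln eps^-1) ->
  (P (~` [set w | @oracle_recovered R D w]) <=
    P (~` lamhat_in_range D) + (eps * (3 / (2 * v) + 1))%:E)%E.
Proof.
move=> v0 vs; have ei0 : 0 < eps^-1 by rewrite invr_gt0.
have le_sqrt (k : nat) : (0 < k)%N -> v <= Num.sqrt (2 * ln (k%:R / eps)).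
  move=> k0; apply: le_trans vs _; apply: sqrt_ln_le => //.
  by rewrite ler_peMl ?(ltW ei0)// (ler_nat _ 1).
(* For nonempty [B] the maximum is its second argument, the level of [beta_min_condition]; [v] only
   keeps the level positive when [B] is empty. *)
apply: (prob_not_recovered_tail HD (u2 := Num.max v (Num.sqrt (2 * ln (d%:R / eps))))) => //.
- by apply: le_sqrt; rewrite -(ler_nat R).
- by rewrite le_max lexx.
- by apply: (beta_min_tail HD); rewrite le_max lexx orbT.
- move=> j jB; rewrite max_r; first exact: (beta_min_signal HD HB jB).
  by apply: le_sqrt; rewrite card_gt0; apply/set0Pn; exists j.
Qed.

(** If c eps >= 1 the bound is trivial. Otherwise eps^-1 > c, so the level [v] of [tail_constant] is
    admissible and yields eps (3 / (2 v) + 1) = c eps. *)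
Lemma prob_not_recovered_main :
  (P (~` [set w | @oracle_recovered R D w]) <=
    P (~` lamhat_in_range D) + ((3 / 2 + 1 / Num.sqrt 2) * eps)%:E)%E.
Proof.
have [v v0 [vc vs]] := tail_constant R; move: vc vs; set c := 3 / 2 + _ => vc vs.
have [c1|c1] := leP 1 (c * eps).
  apply: le_trans (probability_le1 _ (measurableC (measurable_oracle_recovered HD))) _.
  rewrite -[1%E]add0e; apply: leeD; first exact: measure_ge0.
  by rewrite lee_fin.
have c0 : 0 < c by rewrite addr_gt0// divr_gt0// sqrtr_gt0.
have vE : v <= Num.sqrt (2 * ln eps^-1).
  apply: le_trans vs _; apply: sqrt_ln_le => //.
  by rewrite -[eps^-1]mul1r ler_pdivlMr// ltW.
apply: le_trans (prob_not_recovered_eps v0 vE) _.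
by rewrite vc mulrC.
Qed.

(** The threshold M = exp (v^2 / 2) satisfies sqrt (2 ln M) = v. If eps^-1 > M, the factor eps is
    itself at most 1 / v. Otherwise all three quantities in the minimum exceed M, and each of the
    three costs is of order 1 / v even for eps = 1. *)
Lemma prob_not_recovered_asymptotic (v : R) : 0 < v ->
  ((expR (v ^+ 2 / 2))%:E < Order.max (eps^-1)%:E
        (Order.min (N%:R)%:E
          (Order.min (ptilde_at D 1)%:E (signal_strength D))))%E ->
  (P (~` [set w | @oracle_recovered R D w]) <=
    P (~` lamhat_in_range D) + (5 / v)%:E)%E.
Proof.
move=> v0; set M := expR _; have M0 : 0 < M by exact: expR_gt0.
have lnM2 : 2 * ln M = v ^+ 2 by rewrite /M expRK; field.
have vM : Num.sqrt (2 * ln M) = v by rewrite lnM2 sqrtr_sqr gtr0_norm.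
have vleM : v <= M.
  apply: le_trans (expR_ge1Dx _); nra.
rewrite lt_max => /orP[|]; last rewrite !lt_min => /and3P[]; rewrite lte_fin.
  move=> Me; have vs : v <= Num.sqrt (2 * ln eps^-1).
    by rewrite -{1}vM; apply: sqrt_ln_le => //; exact: ltW.
  apply: le_trans (prob_not_recovered_eps v0 vs) _.
  rewrite leeD2l// lee_fin mulrDr mulr1.
  have ev : eps <= 1 / v.
    rewrite div1r -[eps]invrK lef_pV2 ?posrE ?invr_gt0//.
    by apply: le_trans vleM (ltW Me).
  have : eps * (3 / (2 * v)) <= 3 / (2 * v).
    by rewrite ler_piMl// divr_ge0// mulr_ge0// ltW.
  rewrite (_ : 3 / (2 * v) = 3 / 2 * (1 / v)); last by field; rewrite gt_eqF.
  rewrite (_ : 5 / v = 5 * (1 / v)); last by field; rewrite gt_eqF.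
  have : 0 < 1 / v by rewrite divr_gt0.
  lra.
move=> MN; rewrite lte_fin => Mp Ms.
have tv : v ^+ 2 <= t.
  rewrite -lnM2; apply: (@le_trans _ _ (2 * ln (ptilde_at D 1))).
    by rewrite ler_pM2l// ler_ln ?posrE//; [exact: ltW|exact: lt_trans Mp].
  exact: (ptilde_ln_mono (excess_bounds HD) eps_gt0 eps_le1 (lexx _)).
have tk : Num.min 1 (2 / Num.sqrt t) <= 2 / v.
  rewrite ge_min; apply/orP; right; rewrite ler_pM2l//.
  have vt : v <= Num.sqrt t.
    by rewrite -[v]gtr0_norm// -sqrtr_sqr ler_wsqrtr.
  by rewrite lef_pV2 ?posrE//; exact: lt_le_trans vt.
have sv j : j \in B -> gamma * lam2 + Num.sqrt (n%:R^-1 * w_oracle D) * (v * sigma) <= `|beta j 0|.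
  move=> jB; move: Ms; rewrite /signal_strength.
  case: ifPn => [/eqP B0|_]; first by move: jB; rewrite B0 inE.
  have nn0 : 0 < n%:R :> R by rewrite ltr0n problem_size_gt0.
  have w0 : 0 < w_oracle D.
    have clo0 : 0 < pb_clo D by case: HD => _ [[_ /andP[]]].
    have SRC : sparse_riesz (pb_X D) dstar (pb_clo D) (pb_chi D) by case: HD => _ [[]].
    have Bd : (#|B| <= dstar)%N by exact: ltnW (true_size_lt HD).
    have [c [c1 c2 _]] := coef_restricted_solve (problem_size_gt0 HD) clo0 SRC Bd jB.
    by rewrite -(pmulr_rgt0 _ (_ : 0 < n%:R^-1)) ?invr_gt0//; exact: lt_le_trans c1.
  pose q := Num.sqrt (n%:R / w_oracle D) / sigma.
  have q0 : 0 < q by rewrite divr_gt0// sqrtr_gt0 divr_gt0.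
  have qE : Num.sqrt (n%:R^-1 * w_oracle D) * (v * sigma) = v / q.
    rewrite /q (_ : n%:R^-1 * w_oracle D = (n%:R / w_oracle D)^-1); last by rewrite invf_div mulrC.
    rewrite sqrtrV; last by rewrite divr_ge0// ltW.
    by field; rewrite !gt_eqF// sqrtr_gt0 divr_gt0.
  move=> /lt_le_trans/(_ (lee_wpmul2l _ (leeB (bigmin_le_cond (P := mem B) +oo%E
    (fun i => (`|beta i 0|%:E)%E) jB) (lexx _)))).
  rewrite -/q lee_fin (ltW q0) => /(_ isT); rewrite -EFinB -EFinM lte_fin => h.
  rewrite qE -lerBrDl ler_pdivrMr// mulrC; exact: le_trans vleM (ltW h).
(* Whichever argument is larger, the coefficients are strong enough for it: [signal_strength]
   provides the level [v], and [beta_min_condition] the other. *)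
pose u2 := Num.max v (Num.sqrt (2 * ln (d%:R / eps))).
apply: le_trans (prob_not_recovered_tail HD (v := v) (k := 2 / v) (u2 := u2) v0 _ _ _ _ tk) _.
- rewrite -{1}vM; apply: sqrt_ln_le => //; apply: le_trans (ltW MN) _.
  by rewrite ler_peMr ?(le_trans ler01 N_ge1)// -div1r ler_pdivlMr// mul1r.
- by rewrite le_max lexx.
- by apply: (beta_min_tail HD); rewrite le_max lexx orbT.
- move=> j jB; rewrite /u2; case: (leP v (Num.sqrt (2 * ln (d%:R / eps)))) => _; last exact: sv.
  exact: (beta_min_signal HD HB jB).
rewrite leeD2l// lee_fin.
have -> : 3 / (2 * v) + 2 / v = 7 / 2 * (1 / v) by field; rewrite gt_eqF.
rewrite (_ : 5 / v = 5 * (1 / v)); last by field; rewrite gt_eqF.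
have : 0 < 1 / v by rewrite divr_gt0.
move: (1 / v) => iv iv0.
have : eps * (7 / 2 * iv) <= 1 * (7 / 2 * iv) by rewrite ler_wpM2r// mulr_ge0// ltW.
lra.
Qed.

End theorem_bounds.

Lemma measurable_active_set (R : realType) (D : problem R) (A : {set 'I_(pb_p D)}) :
  measurable [set w : pb_Omega D | active_set (estimator w) = A].
Proof.
rewrite (_ : [set w | _] = [set w | forall j, (pb_bhat j w != 0) = (j \in A)]); last first.
  apply/seteqP; split=> w /= h; first by move=> j; rewrite -h inE mxE.
  by apply/setP => j; rewrite inE mxE h.
apply: measurable_forall_ord => j.
have m0 : measurable (pb_bhat (p := D) j @^-1` [set 0]).
  by apply: measurable_funPTI; exact: measurable_set1.
case: (j \in A).
  rewrite (_ : (fun w => _ = _) = ~` (pb_bhat (p := D) j @^-1` [set 0])); first exact: measurableC.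
  by apply/seteqP; split=> w /= /eqP.
rewrite (_ : (fun w => _ = _) = pb_bhat (p := D) j @^-1` [set 0])//.
by apply/seteqP; split=> w /=; [move/negbT; rewrite negbK => /eqP|move=> ->; rewrite eqxx].
Qed.

(** * Limits along a sequence of problems *)

Section limits.
Context {R : realType}.
Variable D : nat -> problem R.
Hypotheses (HD : forall k, assumptions (D k)) (HB : forall k, beta_min_condition (D k)).

Local Notation failure k := (~` [set w | @oracle_recovered R (D k) w]).

Let mF k : measurable (failure k).
Proof. exact/measurableC/measurable_oracle_recovered. Qed.

Lemma failure_cvg0 :
  pb_Pr (D k) (lamhat_in_range (D k)) @[k --> \oo] --> 1%E ->
  Order.max ((pb_eps (D k))^-1)%:E
    (Order.min ((pb_p (D k) - true_size (D k))%N%:R)%:E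
      (Order.min (ptilde_at (D k) 1)%:E (signal_strength (D k))))
    @[k --> \oo] --> +oo%E ->
  fine (pb_Pr (D k) (failure k)) @[k --> \oo] --> (0 : R).
Proof.
move=> /fine_cvgP[_ r1] /cvgeyPgt hoo; apply/cvgrPdist_le => e e0.
(* With v = 10 / e the tail cost 5 / v is e / 2; the other half is left for the penalty level being
   out of range. *)
have v0 : 0 < 10 / e by rewrite divr_gt0.
have e20 : 0 < e / 2 by rewrite divr_gt0.
move/cvgrPdist_le : r1 => /(_ _ e20) r1.
near=> k.
rewrite sub0r normrN ger0_norm ?fine_ge0//.
rewrite -lee_fin fineK ?fin_num_measure//.
apply: le_trans (prob_not_recovered_asymptotic (HD k) (HB k) v0 _) _; first by near: k; exact: hoo.
have mr := measurable_lamhat_in_range (D k).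
rewrite probability_setC// -(fineK (fin_num_measure _ _ mr)) -EFinB -EFinD lee_fin.
have : `|1 - fine (pb_Pr (D k) (lamhat_in_range (D k)))| <= e / 2 by near: k.
move/(le_trans (ler_norm _)).
rewrite (_ : 5 / (10 / e) = e / 2); last by field; rewrite gt_eqF.
lra.
Unshelve. all: by end_near. Qed.

Hypothesis F0 : fine (pb_Pr (D k) (failure k)) @[k --> \oo] --> (0 : R).

Lemma prob_cvg1 (E : forall k, set (pb_Omega (D k))) : (forall k, measurable (E k)) ->
  (forall k w, oracle_recovered w -> E k w) -> pb_Pr (D k) (E k) @[k --> \oo] --> 1%E.
Proof.
move=> mE RE.
apply: (squeeze_cvge (f := fun k => (1 - fine (pb_Pr (D k) (failure k)))%:E) (h := fun=> 1%E)).
- apply: nearW => k; rewrite probability_le1// andbT EFinB fineK ?fin_num_measure//.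
  rewrite leeBlDr ?fin_num_measure// -(@probability_setT _ _ _ (pb_Pr (D k))).
  apply: (@le_trans _ _ (pb_Pr (D k) (E k `|` failure k))); last exact: measureU2.
  apply: le_measure; rewrite ?inE//; first exact: measurableU.
  by move=> w _; have [/RE|] := pselect (oracle_recovered w); [left|right].
- apply: cvg_EFin; first exact: nearW.
  by rewrite -[X in _ --> X]subr0; apply: cvgB; [exact: cvg_cst|exact: F0].
- exact: cvg_cst.
Qed.

(** The events agree outside the failure event, so their probabilities differ by at most its
    probability. That bound does not depend on the events, which is what gives convergence in total
    variation. *)
Lemma prob_diff_cvg0 (E E' : forall k, set (pb_Omega (D k))) :
  (forall k, measurable (E k)) -> (forall k, measurable (E' k)) ->
  (forall k w, oracle_recovered w -> E k w <-> E' k w) ->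
  (pb_Pr (D k) (E k) - pb_Pr (D k) (E' k))%E @[k --> \oo] --> 0%E.
Proof.
move=> mE mE' EE'.
have sub k (S S' : set (pb_Omega (D k))) : measurable S -> measurable S' ->
    (forall w, oracle_recovered w -> S w -> S' w) ->
    fine (pb_Pr (D k) S) <= fine (pb_Pr (D k) S') + fine (pb_Pr (D k) (failure k)).
  move=> mS mS' SS; rewrite -lee_fin EFinD !fineK ?fin_num_measure//.
  apply: (@le_trans _ _ (pb_Pr (D k) (S' `|` failure k))); last exact: measureU2.
  apply: le_measure; rewrite ?inE//; first exact: measurableU.
  by move=> w Sw; have [/SS/(_ Sw)|] := pselect (oracle_recovered w); [left|right].
rewrite (_ : (fun k => _) = (fun k => (fine (pb_Pr (D k) (E k)) - fine (pb_Pr (D k) (E' k)))%:E)).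
  apply: cvg_EFin; first exact: nearW.
  apply: (squeeze_cvgr (f := fun k => - fine (pb_Pr (D k) (failure k)))
    (h := fun k => fine (pb_Pr (D k) (failure k)))).
  - apply: nearW => k /=.
    have := sub k _ _ (mE k) (mE' k) (fun w r => (EE' k w r).1).
    have := sub k _ _ (mE' k) (mE k) (fun w r => (EE' k w r).2).
    move=> h1 h2; apply/andP; split; lra.
  - by rewrite -[X in _ --> X]oppr0; apply: cvgN; exact: F0.
  - exact: F0.
by apply/funext => k; rewrite EFinB !fineK ?fin_num_measure.
Qed.

End limits.

Theorem theorem1 (R : realType) :
  (forall D : problem R, assumptions D -> beta_min_condition D ->
     (pb_Pr D [set w | estimator w <> oracle w \/
                       map_mx Num.sg (estimator w) <> map_mx Num.sg (pb_beta D)]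
      <= pb_Pr D (~` lamhat_in_range D) +
         ((3 / 2 + 1 / Num.sqrt 2) * pb_eps D)%:E)%E) /\
  (forall D : nat -> problem R,
     (forall k, assumptions (D k)) -> (forall k, beta_min_condition (D k)) ->
     pb_Pr (D k) (lamhat_in_range (D k)) @[k --> \oo] --> 1%E ->
     Order.max ((pb_eps (D k))^-1)%:E
       (Order.min ((pb_p (D k) - true_size (D k))%N%:R)%:E
          (Order.min (ptilde_at (D k) 1)%:E (signal_strength (D k))))
       @[k --> \oo] --> +oo%E ->
     (pb_Pr (D k) [set w | active_set (estimator w) = true_support (D k)]
        @[k --> \oo] --> 1%E) /\
     oracle_efficient D).
Proof.
split=> [D HD HB|D HD HB hr hoo].
  apply: le_trans (prob_not_recovered_main HD HB).
  rewrite le_eqVlt; apply/orP; left; apply/eqP; congr (pb_Pr D _).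
  by apply/seteqP; split=> w /=; rewrite /oracle_recovered not_andP.
have F0 := failure_cvg0 HD HB hr hoo; split; last split.
- apply: (prob_cvg1 HD F0) => [k|k w [_ /colP sg]]; first exact: measurable_active_set.
  apply/setP => j; have := sg j; rewrite !inE !mxE => sgj.
  by rewrite -sgr_eq0 sgj sgr_eq0.
- apply: (prob_cvg1 HD F0) => [k|k w []//]; exact: measurable_estimator_eq_oracle.
- move=> S mS mS'; apply: (prob_diff_cvg0 HD F0) => // k w [/= -> _]; by split.
Qed.
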